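(* Let $\mathcal{Q}$ be an effective $n$-dimensional orbifold without boundary, with stratification by singular dimension $Q=\bigsqcup_{k=0}^n\Sigma_k$. For each $k=0,\ldots,n$, the set $\Sigma_k$ has naturally the structure of a $k$-dimensional manifold without boundary. The tangent space $T_x\Sigma_k$ at a point $x\in\Sigma_k$ is canonically identified with $T_xQ^{\Gamma_x}$, the space of tangent vectors at $x$. Furthermore, if $\mathcal{Q}$ is a Riemannian orbifold, then each connected component of $\Sigma_k$, $k\ge1$, is totally geodesic in $\mathcal{Q}$.
   Context: An effective $n$-orbifold $\mathcal{Q}=(Q,\mathcal{A})$ is a paracompact Hausdorff space $Q$ with an equivalence class of atlases $\mathcal{A}$ of charts $(\widetilde U_i,\Gamma_i,\varphi_i)$ over a locally finite open cover $\{U_i\}$ of $Q$: $\widetilde U_i$ is a simply connected smooth $n$-manifold, $\Gamma_i$ is a finite subgroup of $\mathrm{Diff}(\widetilde U_i)$, and $\varphi_i\colon\widetilde U_i\to U_i$ is a continuous surjection inducing a homeomorphism $\widetilde U_i/\Gamma_i\cong U_i$. Compatibility: whenever $\varphi_i(\tilde x_i)=\varphi_j(\tilde x_j)$ there is a diffeomorphism $h$ (a change of charts) from a connected open neighbourhood $\widetilde U$ of $\tilde x_i$ onto a neighbourhood of $\tilde x_j$ with $\varphi_j\circ h=\varphi_i|_{\widetilde U}$. $\mathcal{Q}$ is Riemannian if all $\widetilde U_i$ are Riemannian manifolds, each $\Gamma_i$ acts by isometries, and all changes of charts are isometries. The isotropy group $\Gamma_x$ of $x\in Q$ is the stabilizer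 $\Gamma_{\tilde x}$ of a lift $\tilde x$ of $x$ in a chart (well defined up to isomorphism). The fixed subspace $(T_{\tilde x}\widetilde U)^{\Gamma_{\tilde x}}$ of the linear action of $\Gamma_{\tilde x}$ on $T_{\tilde x}\widetilde U$ is, up to isomorphism, independent of the chart and the lift; it is denoted $T_xQ^{\Gamma_x}$ and called the space of tangent vectors at $x$. The singular dimension of $x$ is its dimension, and $\Sigma_k$ is the set of points of singular dimension $k$. ''Naturally'' means that the manifold charts of $\Sigma_k$ are obtained by restricting orbifold charts: around $x\in\Sigma_k$, in an orbifold chart $(\widetilde U_x,\Gamma_x,\varphi_x)$ whose group is the isotropy group of $x$, the neighbourhood of $x$ in $\Sigma_k$ corresponds via $\varphi_x$ to the fixed-point set of $\Gamma_x$ in $\widetilde U_x$. A component of $\Sigma_k$ is totally geodesic in $\mathcal{Q}$ if its geodesics, with respect to the induced metric, lift locally to geodesics in the Riemannian manifolds $\widetilde U$ of the orbifold charts (equivalently, the corresponding submanifolds of the $\widetilde U$ are totally geodesic). *)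

(* Defs.v *)
From HB Require Import structures.
From mathcomp Require Import all_boot all_order all_algebra.
From mathcomp Require Import all_classical all_reals all_analysis.

Set Implicit Arguments.
Unset Strict Implicit.
Unset Printing Implicit Defensive.

Import Order.TTheory GRing.Theory Num.Theory.
Import numFieldNormedType.Exports.

Local Open Scope classical_set_scope.
Local Open Scope ring_scope.

(** * Point-set topology *)

Definition open_cover (T : topologicalType) (C : set (set T)) : Prop :=
  (forall A, C A -> open A) /\ \bigcup_(A in C) A = setT.

Definition locally_finite (I : Type) (T : topologicalType) (D : set I)
    (F : I -> set T) : Prop :=
  forall x : T, exists2 V : set T,
    nbhs x V & finite_set [set i | D i /\ F i `&` V !=set0].

Definition paracompact (T : topologicalType) : Prop :=
  forall C : set (set T), open_cover C ->
  exists D : set (set T),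
    [/\ open_cover D,
        (forall B, D B -> exists2 A, C A & B `<=` A) &
        locally_finite D id].

Section simply_connected.
Variables (R : realType) (T : topologicalType).

Let I01 : set R := `[0, 1].

Definition path_connected : Prop :=
  forall x y : T, exists p : R -> T,
    [/\ {within I01, continuous p}, p 0 = x & p 1 = y].

Definition simply_connected : Prop :=
  path_connected /\
  forall p : R -> T, {within I01, continuous p} -> p 0 = p 1 ->
  exists H : R * R -> T,
    [/\ {within I01 `*` I01, continuous H},
        (forall t, I01 t -> H (0, t) = p t /\ H (1, t) = p 0) &
        (forall s, I01 s -> H (s, 0) = p 0 /\ H (s, 1) = p 0)].

End simply_connected.

(** * Smooth maps between open subsets of normed spaces *)

Section smooth_on.
Variables (R : realType) (V W : normedModType R).

(* In finite dimension and for [U] open, [f] is of class C^(r+1) on [U] iff it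
   is differentiable on [U] with all directional derivatives of class C^r. *)
Fixpoint class_C (r : nat) (U : set V) (f : V -> W) : Prop :=
  match r with
  | 0 => forall x, U x -> {for x, continuous f}
  | r'.+1 => (forall x, U x -> differentiable f x) /\
             (forall v, class_C r' U (fun x => derive f x v))
  end.

Definition smooth_on (U : set V) (f : V -> W) : Prop :=
  forall r, class_C r U f.

End smooth_on.

(** * Smooth manifolds without boundary *)

(* A coordinate chart: a homeomorphism from the open set [mc_dom] onto an open
   subset of R^n.  The values of [mc_fwd] outside [mc_dom], and of [mc_bwd]
   outside [mc_img], are irrelevant. *)
Record mchart (R : realType) (n : nat) (T : topologicalType) := MChart {
  mc_dom : set T;
  mc_fwd : T -> 'rV[R]_n;
  mc_bwd : 'rV[R]_n -> T;
  mc_img := mc_fwd @` mc_dom;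
  mc_dom_open : open mc_dom;
  mc_img_open : open mc_img;
  mc_fwdK : forall p, mc_dom p -> mc_bwd (mc_fwd p) = p;
  mc_fwd_cont : forall p, mc_dom p -> {for p, continuous mc_fwd};
  mc_bwd_cont : forall x, mc_img x -> {for x, continuous mc_bwd}
}.

Record smooth_manifold (R : realType) (n : nat) (T : topologicalType) :=
  SmoothManifold {
  mf_hausdorff : hausdorff_space T;
  mf_paracompact : paracompact T;
  mf_atlas : set (mchart R n T);
  mf_cover : forall p : T, exists c, mf_atlas c /\ mc_dom c p;
  mf_compat : forall c d, mf_atlas c -> mf_atlas d ->
    smooth_on (mc_fwd c @` (mc_dom c `&` mc_dom d)) (mc_fwd d \o mc_bwd c)
}.

(* A preferred chart at [p].  The tangent space of [M] at [p] is represented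
   by 'rV[R]_n, a tangent vector being given by its components in
   [chart_at M p]. *)
Definition chart_at (R : realType) (n : nat) (T : topologicalType)
    (M : smooth_manifold R n T) (p : T) : mchart R n T :=
  projT1 (cid (mf_cover M p)).

Section maps.
Variables (R : realType) (m n : nat) (S T : topologicalType).
Variables (M : smooth_manifold R m S) (N : smooth_manifold R n T).

(* Meant for [W] open. *)
Definition smooth_map (W : set S) (f : S -> T) : Prop :=
  (forall p, W p -> {for p, continuous f}) /\
  forall c d, mf_atlas M c -> mf_atlas N d ->
    smooth_on (mc_fwd c @` (W `&` mc_dom c `&` f @^-1` mc_dom d))
              (mc_fwd d \o f \o mc_bwd c).

(* The differential T_p M -> T_(f p) N. *)
Definition mdiff (f : S -> T) (p : S) : {linear 'rV[R]_m -> 'rV[R]_n} :=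
  'd (mc_fwd (chart_at N (f p)) \o f \o mc_bwd (chart_at M p))
     (mc_fwd (chart_at M p) p).

Definition smooth_embedding (W : set S) (f : S -> T) : Prop :=
  [/\ open W,
      smooth_map W f,
      (forall p, W p -> injective (mdiff f p)),
      set_inj W f &
      (forall V, open V -> V `<=` W ->
         exists2 V', open V' & f @` V = f @` W `&` V')].

End maps.

Definition diffeo_on (R : realType) (n : nat) (S T : topologicalType)
    (M : smooth_manifold R n S) (N : smooth_manifold R n T)
    (W : set S) (h : S -> T) : Prop :=
  [/\ open W, open (h @` W), smooth_map M N W h &
      exists h' : T -> S,
        smooth_map N M (h @` W) h' /\ (forall p, W p -> h' (h p) = p)].

(** * Riemannian metrics and geodesics *)

Section gram.
Variables (R : realType) (n : nat) (T : topologicalType).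
Variable M : smooth_manifold R n T.

(* The matrix, in the coordinates of [c] and at the point with coordinates
   [x], of a field of bilinear forms [g] on tangent spaces. *)
Definition gram_of (g : T -> 'M[R]_n) (c : mchart R n T) (x : 'rV[R]_n) :
    'M[R]_n :=
  let p := mc_bwd c x in
  let J := jacobian (mc_fwd (chart_at M p) \o mc_bwd c) x in
  J *m g p *m J^T.

Record riemannian_metric := RiemannianMetric {
  rm_form : T -> 'M[R]_n;
  rm_sym : forall p, (rm_form p)^T = rm_form p;
  rm_pos : forall p (u : 'rV[R]_n), u != 0 ->
    0 < (u *m rm_form p *m u^T) 0 0;
  rm_smooth : forall c, mf_atlas M c -> smooth_on (mc_img c) (gram_of rm_form c)
}.

Variable g : riemannian_metric.

Definition inner (p : T) (u v : 'rV[R]_n) : R := (u *m rm_form g p *m v^T) 0 0.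

Definition gram := gram_of (rm_form g).

(* Gamma^l_ij
     = 1/2 sum_m g^lm (d_i g_jm + d_j g_im - d_m g_ij). *)
Definition christoffel (c : mchart R n T) (x : 'rV[R]_n) (l i j : 'I_n) : R :=
  let G a b := fun y : 'rV[R]_n => gram c y a b in
  let e a := delta_mx 0 a : 'rV[R]_n in
  2^-1 * \sum_(m < n) invmx (gram c x) l m *
    (derive (G j m) x (e i) + derive (G i m) x (e j) - derive (G i j) x (e m)).

Definition geodesic (J : set R) (gamma : R -> T) : Prop :=
  (forall t, J t -> {for t, continuous gamma}) /\
  forall c, mf_atlas M c ->
    let x := mc_fwd c \o gamma in
    smooth_on (J `&` gamma @^-1` mc_dom c) x /\
    forall t, J t -> mc_dom c (gamma t) -> forall l : 'I_n,
      derive1n 2 x t 0 l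
      + \sum_(i < n) \sum_(j < n)
          christoffel c (x t) l i j * derive1 x t 0 i * derive1 x t 0 j = 0.

End gram.

Definition isometric_on (R : realType) (n : nat) (S T : topologicalType)
    (M : smooth_manifold R n S) (N : smooth_manifold R n T)
    (g : riemannian_metric M) (g' : riemannian_metric N)
    (W : set S) (h : S -> T) : Prop :=
  forall p, W p -> forall u v : 'rV[R]_n,
    inner g' (h p) (mdiff M N h p u) (mdiff M N h p v) = inner g p u v.

(** * Effective orbifolds *)

(* The clause [oc_quotient], together with [oc_fiber] and [oc_open], says that
   [oc_proj] induces a homeomorphism from the quotient of [oc_space] by
   [oc_group] onto its open image. *)
Record orbichart (R : realType) (n : nat) (Q : topologicalType) := OrbiChart {
  oc_space : topologicalType;
  oc_mfd : smooth_manifold R n oc_space;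
  oc_sc : simply_connected R oc_space;
  oc_group : set (oc_space -> oc_space);
  oc_group_fin : finite_set oc_group;
  oc_group_id : oc_group id;
  oc_group_comp : forall a b, oc_group a -> oc_group b -> oc_group (a \o b);
  oc_group_inv : forall a, oc_group a ->
    exists b, [/\ oc_group b, cancel a b & cancel b a];
  oc_group_smooth : forall a, oc_group a -> smooth_map oc_mfd oc_mfd setT a;
  oc_proj : oc_space -> Q;
  oc_open : open (range oc_proj);
  oc_fiber : forall x y,
    oc_proj x = oc_proj y <-> exists2 a, oc_group a & a x = y;
  oc_quotient : forall V, V `<=` range oc_proj ->
    (open V <-> open (oc_proj @^-1` V))
}.

Arguments oc_proj {R n Q} _ _.
Arguments oc_group {R n Q} _ _.

Section orbicharts.
Variables (R : realType) (n : nat) (Q : topologicalType).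

Definition change_of_charts (c d : orbichart R n Q) (W : set (oc_space c))
    (h : oc_space c -> oc_space d) : Prop :=
  [/\ connected W,
      diffeo_on (oc_mfd c) (oc_mfd d) W h &
      forall x, W x -> oc_proj d (h x) = oc_proj c x].

Definition oc_compatible (c d : orbichart R n Q) : Prop :=
  forall x y, oc_proj c x = oc_proj d y ->
  exists (W : set (oc_space c)) (h : oc_space c -> oc_space d),
    [/\ change_of_charts W h, W x & (h @` W) y].

Definition isotropy (c : orbichart R n Q) (x : oc_space c) :
    set (oc_space c -> oc_space c) :=
  [set a | oc_group c a /\ a x = x].

Definition fixed_points (c : orbichart R n Q)
    (G : set (oc_space c -> oc_space c)) : set (oc_space c) :=
  [set x | forall a, G a -> a x = x].

(* The fixed subspace of the linear action of the isotropy group of [x] on the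
   tangent space at [x]. *)
Definition fixed_tangent (c : orbichart R n Q) (x : oc_space c) :
    set 'rV[R]_n :=
  [set v | forall a, isotropy x a -> mdiff (oc_mfd c) (oc_mfd c) a x v = v].

(* [W] is stable under the isotropy group of [x] and disjoint from its other
   translates, so that the chart [c] restricts to [W] with group the isotropy
   group of [x]. *)
Definition isotropy_nbhd (c : orbichart R n Q) (x : oc_space c)
    (W : set (oc_space c)) : Prop :=
  [/\ open W, W x,
      (forall a, isotropy x a -> a @` W = W) &
      (forall a, oc_group c a -> a x <> x -> a @` W `&` W = set0)].

End orbicharts.

Record orbifold (R : realType) (n : nat) := Orbifold {
  orb_space :> topologicalType;
  orb_hausdorff : hausdorff_space orb_space;
  orb_paracompact : paracompact orb_space;
  orb_index : Type;
  orb_chart : orb_index -> orbichart R n orb_space;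
  orb_cover : \bigcup_i range (oc_proj (orb_chart i)) = setT;
  orb_locfin :
    locally_finite setT (fun i => range (oc_proj (orb_chart i)));
  orb_compat : forall i j, oc_compatible (orb_chart i) (orb_chart j)
}.

Arguments orb_chart {R n} _ _.

Record riemannian_orbifold (R : realType) (n : nat) (Q : orbifold R n) :=
  RiemannianOrbifold {
  ro_metric : forall i, riemannian_metric (oc_mfd (orb_chart Q i));
  ro_group : forall i a, oc_group (orb_chart Q i) a ->
    isometric_on (ro_metric i) (ro_metric i) setT a;
  ro_change : forall i j (W : set (oc_space (orb_chart Q i)))
      (h : oc_space (orb_chart Q i) -> oc_space (orb_chart Q j)),
    change_of_charts W h -> isometric_on (ro_metric i) (ro_metric j) W h
}.

(** * The stratification by singular dimension *)

Section strata.
Variables (R : realType) (n : nat) (Q : orbifold R n).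

(* The orbifold charts of [Q], i.e. those of all atlases equivalent to the
   given one. *)
Definition orbifold_chart (c : orbichart R n Q) : Prop :=
  forall i, oc_compatible c (orb_chart Q i).

Definition singular_dim (x : Q) (k : nat) : Prop :=
  exists (i : orb_index Q) (y : oc_space (orb_chart Q i)),
    oc_proj (orb_chart Q i) y = x /\
    exists E : {vspace 'rV[R]_n},
      \dim E = k /\ fixed_tangent y = [set v | v \in E].

Definition Sigma (k : nat) : set Q := [set x | singular_dim x k].

Variables (k : nat) (S : smooth_manifold R k (Sigma k)).

(* The part of [Sigma k] lying in the image of [W], as a subset of the
   subspace [Sigma k]. *)
Definition stratum_in (c : orbichart R n Q) (W : set (oc_space c)) :
    set (Sigma k) :=
  set_val @^-1` (oc_proj c @` W).

(* The projection of [c] restricts to a bijection from the [G]-fixed points of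
   [W] onto [stratum_in W], whose inverse [s] is a smooth embedding into the
   manifold of [c]: via the chart, [stratum_in W] corresponds to the
   fixed-point set of [G], and its smooth structure is the one of the
   submanifold of fixed points. *)
Definition stratum_lift (c : orbichart R n Q)
    (G : set (oc_space c -> oc_space c)) (W : set (oc_space c))
    (s : Sigma k -> oc_space c) : Prop :=
  [/\ open W,
      (forall p, stratum_in W p -> oc_proj c (s p) = set_val p),
      s @` stratum_in W = W `&` fixed_points G &
      smooth_embedding S (oc_mfd c) (stratum_in W) s].

(* The charts of [Sigma k] are obtained by restricting orbifold charts: each
   point has an orbifold chart whose group is its isotropy group and in which
   [Sigma k] is the whole fixed-point set, and the same holds in suitable
   neighbourhoods for every orbifold chart. *)
Definition natural_structure : Prop :=
  (forall p : Sigma k,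
     exists (c : orbichart R n Q) (x : oc_space c) (s : Sigma k -> oc_space c),
       [/\ orbifold_chart c, oc_proj c x = set_val p,
           isotropy x = oc_group c & stratum_lift (oc_group c) setT s]) /\
  (forall (c : orbichart R n Q) (x : oc_space c),
     orbifold_chart c -> Sigma k (oc_proj c x) ->
     exists (W : set (oc_space c)) (s : Sigma k -> oc_space c),
       isotropy_nbhd x W /\ stratum_lift (isotropy x) W s).

(* The differential of the local inverse of the projection identifies the
   tangent space of [Sigma k] linearly with the fixed subspace in every
   orbifold chart, compatibly with the changes of charts. *)
Definition tangent_identification : Prop :=
  (forall (c : orbichart R n Q) (x : oc_space c) (p : Sigma k)
          (W : set (oc_space c)) (s : Sigma k -> oc_space c),
     orbifold_chart c -> oc_proj c x = set_val p ->
     W x -> stratum_lift (isotropy x) W s ->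
     set_bij setT (fixed_tangent x) (mdiff S (oc_mfd c) s p)) /\
  (forall (c d : orbichart R n Q) (x : oc_space c) (p : Sigma k)
          (W : set (oc_space c)) (s : Sigma k -> oc_space c)
          (W' : set (oc_space d)) (s' : Sigma k -> oc_space d)
          (Wh : set (oc_space c)) (h : oc_space c -> oc_space d),
     orbifold_chart c -> orbifold_chart d -> oc_proj c x = set_val p ->
     W x -> stratum_lift (isotropy x) W s ->
     change_of_charts Wh h -> Wh x ->
     W' (h x) -> stratum_lift (isotropy (h x)) W' s' ->
     forall u : 'rV[R]_k,
       mdiff (oc_mfd c) (oc_mfd d) h x (mdiff S (oc_mfd c) s p u)
       = mdiff S (oc_mfd d) s' p u).

Variables (g : riemannian_orbifold Q) (gS : riemannian_metric S).

Definition induced_metric : Prop :=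
  forall (i : orb_index Q) (x : oc_space (orb_chart Q i)) (p : Sigma k)
         (W : set (oc_space (orb_chart Q i)))
         (s : Sigma k -> oc_space (orb_chart Q i)),
    oc_proj (orb_chart Q i) x = set_val p ->
    W x -> stratum_lift (isotropy x) W s ->
    forall u v : 'rV[R]_k,
      inner gS p u v =
      inner (ro_metric g i) x (mdiff S (oc_mfd (orb_chart Q i)) s p u)
                              (mdiff S (oc_mfd (orb_chart Q i)) s p v).

Definition totally_geodesic (C : set (Sigma k)) : Prop :=
  forall (J : set R) (gamma : R -> Sigma k),
    open J -> is_interval J -> (forall t, J t -> C (gamma t)) ->
    geodesic gS J gamma ->
  forall (t0 : R) (i : orb_index Q) (x : oc_space (orb_chart Q i)),
    J t0 -> oc_proj (orb_chart Q i) x = set_val (gamma t0) ->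
  exists (e : R) (gamma' : R -> oc_space (orb_chart Q i)),
    [/\ 0 < e /\ ball t0 e `<=` J, gamma' t0 = x,
        (forall t, ball t0 e t ->
           oc_proj (orb_chart Q i) (gamma' t) = set_val (gamma t)) &
        geodesic (ro_metric g i) (ball t0 e) gamma'].

End strata.

Arguments Sigma {R n} Q k _.

(* Main.v *)
(** Averaging a chart of the manifold [oc_space c] over the isotropy group of a
    point [x] and applying the inverse function theorem linearizes the action
    near [x]; a radial diffeomorphism, built from an invariant quadratic form,
    turns the linearized neighbourhood into an orbifold chart on R^n with a
    finite linear group.  In it the points of singular dimension
    [dim (fixed space)] are exactly the fixed vectors, so the fixed subspaces
    give the manifold charts of the strata.  That singular dimension does not
    depend on the chart: if [h] is a change of charts and [a] fixes [x], near [x]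
    the map [h \o a] agrees at each point with one of the finitely many [b \o h],
    so a single [b] agrees with it on an open set accumulating at [x], and the
    differentials at [x] intertwine [a] and [b].

    Local lifts of a stratum are isometric for the induced metric, so the
    Euler-Lagrange covector of a lifted geodesic vanishes on the fixed subspace.
    It is also invariant under the isotropy group, which acts by isometries
    fixing the curve; as the average of a vector over the group is fixed, the
    covector vanishes, i.e. the lifted curve is a geodesic. *)
Require Import Defs.
From HB Require Import structures.
From mathcomp Require Import all_boot all_order all_algebra.
From mathcomp Require Import all_classical all_reals all_analysis.
From mathcomp Require Import finmap ring lra.
Set Implicit Arguments.
Unset Strict Implicit.
Unset Printing Implicit Defensive.
Import Order.TTheory GRing.Theory Num.Theory.
Import numFieldNormedType.Exports.
Local Open Scope classical_set_scope.
Local Open Scope ring_scope.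

(** Several obstacles shape the proof. A change of charts comes with no homomorphism between the
    groups: compatibility only says that [h (a z)] and [h z] have the same projection, so [b] may
    vary with the point, and all that is extracted is agreement on open sets accumulating at [x].
    This suffices because differentials are continuous. The linear model must satisfy every clause
    of [orbichart], simple connectedness included, which is why an invariant ball is stretched onto
    all of R^n. The averaged chart has the identity as differential at the centre, so the inverse
    function theorem is proved in that normalization. Strata may be neither open nor closed, so
    their paracompactness is not inherited directly; it is shown that every subspace of a
    paracompact Hausdorff space covered by open images of Euclidean open sets is paracompact.
    Finally, Christoffel symbols do not pull back along maps between different dimensions, whereas
    the Euler-Lagrange covector does; hence the geodesic equation is translated into the vanishing
    of that covector. *)

(** * Calculus of C^r maps on open sets *)

Section class_C_theory.
Variables (R : realType) (V : normedModType R).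
Implicit Types (U : set V) (r : nat).

Lemma near_eq_differentiable (W : normedModType R) (f g : V -> W) x :
  (\near x, f x = g x) -> differentiable f x -> differentiable g x.
Proof.
move=> fg /diff_locallyP[cf ef]; have fgx : f x = g x by exact: nbhs_singleton fg.
have eg : g \o shift x = cst (g x) + 'd f x +o_ 0 id.
  apply/eqaddoP => e e0; move/eqaddoP : ef => /(_ e e0) ef.
  have fg0 : \forall y \near 0, f (y + x) = g (y + x).
    by move/nbhs0P : fg; apply: filterS => y; rewrite addrC.
  near=> y; rewrite fctE /= -fgx -(near fg0 y)//.
  by near: y.
by apply/diff_locallyP; rewrite (diff_unique cf eg).
Unshelve. all: by end_near. Qed.

Section general_codomain.
Variables W : normedModType R.
Implicit Types f g : V -> W.

Lemma class_C_sub r U U' f : U `<=` U' -> class_C r U' f -> class_C r U f.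
Proof.
elim: r f => [|r IH] f UU /=; first by move=> cf x /UU; exact: cf.
by move=> [df cf]; split=> [x /UU|v]; [exact: df|exact: IH].
Qed.

Lemma class_C_continuous r U f : class_C r U f -> class_C 0 U f.
Proof. by case: r => //= r [df _] x Ux; exact: differentiable_continuous (df _ Ux). Qed.

Lemma class_C_pred r U f : class_C r.+1 U f -> class_C r U f.
Proof.
elim: r f => [f|r IH f [df cf]]; first exact: class_C_continuous.
by split=> // v; exact: IH.
Qed.

(** Openness matters: derivatives at a point of [U] see a full neighbourhood, on which the two
    functions have to agree. *)
Lemma class_C_ext r U f g : open U -> (forall x, U x -> f x = g x) ->
  class_C r U f -> class_C r U g.
Proof.
move=> oU; elim: r f g => [|r IH] f g fg.
  have fgn x : U x -> \near x, f x = g x.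
    by move=> Ux; near=> y; apply: fg; near: y; exact: open_nbhs_nbhs.
  move=> cf x Ux; suff: g @ x --> g x by [].
  have : f @ x --> f x by exact: cf.
  by rewrite (fg x Ux); apply: cvg_trans; apply: near_eq_cvg; apply: filterS (fgn _ Ux) => y ->.
have fgn x : U x -> \near x, f x = g x.
  by move=> Ux; near=> y; apply: fg; near: y; exact: open_nbhs_nbhs.
move=> [df cf]; split=> [x Ux|v].
  exact: near_eq_differentiable (fgn _ Ux) (df _ Ux).
apply: IH (cf v) => x Ux; apply: near_eq_derive; exact: fgn.
Unshelve. all: by end_near. Qed.

(** Every clause of [class_C] is a condition at single points of the set, on unrestricted
    derivatives, so membership in any set where [f] is C^r is enough. *)
Lemma class_C_local r U f :
  (forall x, U x -> exists2 U', U' x & class_C r U' f) -> class_C r U f.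
Proof.
elim: r f => [|r IH] f H.
  by move=> x /H[U' U'x]; exact.
split=> [x /H[U' U'x [df _]]|v]; first exact: df.
by apply: IH => x /H[U' U'x [_ cf]]; exists U' => //; exact: cf.
Qed.

Lemma class_C_cst r U (w : W) : class_C r U (cst w).
Proof.
elim: r w => [|r IH] w /=; first by move=> x _; exact: cst_continuous.
split=> [x _|v]; first exact: differentiable_cst.
rewrite (_ : (fun x => _) = cst 0); first exact: IH.
by apply/funext => x; rewrite derive_cst.
Qed.

Lemma class_CD r U f g : open U -> class_C r U f -> class_C r U g ->
  class_C r U (fun x => f x + g x).
Proof.
move=> oU; elim: r f g => [|r IH] f g.
  by move=> cf cg x Ux; apply: continuousD; [exact: cf|exact: cg].
move=> [df cf] [dg cg]; split=> [x Ux|v].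
  by apply: differentiableD; [exact: df|exact: dg].
apply: class_C_ext (IH _ _ (cf v) (cg v)) => // x Ux.
by apply/esym/deriveD; apply: diff_derivable; [exact: df|exact: dg].
Qed.

Lemma class_CZ r U (k : R) f : open U -> class_C r U f ->
  class_C r U (fun x => k *: f x).
Proof.
move=> oU; elim: r f => [|r IH] f.
  move=> cf x Ux; apply: continuousZl_tmp; exact: cf.
move=> [df cf]; split=> [x Ux|v].
  by apply: differentiableZ; exact: df.
apply: class_C_ext (IH _ (cf v)) => // x Ux.
by apply/esym/deriveZ; apply: diff_derivable; exact: df.
Qed.

Lemma class_C_sum r U (I : Type) (s : seq I) (F : I -> V -> W) : open U ->
  (forall i, class_C r U (F i)) -> class_C r U (fun x => \sum_(i <- s) F i x).
Proof.
move=> oU cF; elim: s => [|i s IH].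
  by under [X in class_C _ _ X]funext do rewrite big_nil; exact: class_C_cst.
by under [X in class_C _ _ X]funext do rewrite big_cons; exact: class_CD.
Qed.

End general_codomain.

(** The Leibniz rule contains the factors themselves, so the induction also lowers the hypotheses by
    [class_C_pred]. The same pattern handles the inverse and the square root, whose derivatives are
    expressed through the function being differentiated. *)
Lemma class_CM r U (f g : V -> R) : open U -> class_C r U f -> class_C r U g ->
  class_C r U (fun x => f x * g x).
Proof.
move=> oU; elim: r f g => [|r IH] f g.
  by move=> cf cg x Ux; apply: continuousM; [exact: cf|exact: cg].
move=> Cf Cg; have [df cf] := Cf; have [dg cg] := Cg; split=> [x Ux|v].
  by apply: differentiableM; [exact: df|exact: dg].
apply: class_C_ext (class_CD oU (IH _ _ (class_C_pred Cf) (cg v))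
  (IH _ _ (class_C_pred Cg) (cf v))) => // x Ux.
by apply/esym/deriveM; apply: diff_derivable; [exact: df|exact: dg].
Qed.

Lemma class_C_prod r U (I : Type) (s : seq I) (F : I -> V -> R) : open U ->
  (forall i, class_C r U (F i)) -> class_C r U (fun x => \prod_(i <- s) F i x).
Proof.
move=> oU cF; elim: s => [|i s IH].
  by under [X in class_C _ _ X]funext do rewrite big_nil; exact: class_C_cst.
by under [X in class_C _ _ X]funext do rewrite big_cons; exact: class_CM.
Qed.

Lemma class_CV r U (f : V -> R) : open U -> (forall x, U x -> f x != 0) ->
  class_C r U f -> class_C r U (fun x => (f x)^-1).
Proof.
move=> oU f0; elim: r => [|r IH].
  by move=> cf x Ux; apply: continuousV; [exact: f0|exact: cf].
move=> Cf; have [df cf] := Cf; split=> [x Ux|v].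
  by apply: differentiableV; [exact: df|exact: f0].
have Cfr := IH (class_C_pred Cf).
apply: class_C_ext (class_CZ (-1) oU (class_CM oU (class_CM oU Cfr Cfr) (cf v)))
  => // x Ux.
rewrite (deriveV (f0 _ Ux) (diff_derivable (df _ Ux))) scaleN1r.
by rewrite -exprVn scaleNr.
Qed.

Lemma class_C_sqrt r U (f : V -> R) : open U -> (forall x, U x -> 0 < f x) ->
  class_C r U f -> class_C r U (fun x => Num.sqrt (f x)).
Proof.
move=> oU f0; elim: r => [|r IH].
  move=> cf x Ux; apply: (continuous_comp (cf x Ux)); exact: sqrt_continuous.
move=> Cf; have [df cf] := Cf.
have dq (x : R) : 0 < x -> differentiable (@Num.sqrt R) x.
  by move=> x0; apply/derivable1_diffP; have [] := is_derive1_sqrt x0.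
split=> [x Ux|v].
  by apply: (differentiable_comp (df x Ux)); exact/dq/f0.
have Cfr := IH (class_C_pred Cf).
have q0 x : U x -> Num.sqrt (f x) != 0 by move=> Ux; rewrite sqrtr_eq0 -ltNge f0.
apply: class_C_ext (class_CZ 2^-1 oU (class_CM oU (class_CV oU q0 Cfr) (cf v)))
  => // x Ux.
have dqx := dq _ (f0 _ Ux); have dfx := df _ Ux.
have dqf := @differentiable_comp _ _ _ _ f (@Num.sqrt R) x dfx dqx.
rewrite -[fun _ => _]/(Num.sqrt \o f) (deriveE v dqf) (@diff_comp _ _ _ _ f (@Num.sqrt R) x dfx dqx) /= -(deriveE _ dfx).
rewrite (deriv1E (proj2 (derivable1_diffP _ _) dqx)).
have [_ e] := is_derive1_sqrt (f0 _ Ux).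
by rewrite derive1E e invfM /GRing.scale /= mulrA mulrC.
Qed.

End class_C_theory.

Section class_C_matrix.
Variables (R : realType) (V : normedModType R).
Implicit Types (U : set V) (r : nat).

Lemma class_C_scale r U (W : normedModType R) (k : V -> R) (w : W) : open U ->
  class_C r U k -> class_C r U (fun x => k x *: w).
Proof.
move=> oU; elim: r k => [|r IH] k.
  by move=> ck x Ux; apply: continuousZr_tmp; exact: ck.
move=> [dk ck]; split=> [x Ux|v]; first exact/differentiableZl/dk.
apply: class_C_ext (IH _ (ck v)) => // x Ux.
rewrite [RHS]deriveE; last exact/differentiableZl/dk.
by rewrite diffZl /= ?deriveE//; exact: dk.
Qed.

Lemma class_C_mxP r U m n (f : V -> 'M[R]_(m, n)) : open U ->
  class_C r U f <-> forall i j, class_C r U (fun x => f x i j).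
Proof.
move=> oU; split=> [|cf]; last first.
  rewrite (_ : f = fun x => \sum_i \sum_j f x i j *: delta_mx i j).
    by do 2!apply: class_C_sum => // ?; apply: class_C_scale.
  by apply/funext => x; exact: matrix_sum_delta.
elim: r f => [|r IH] f.
  move=> cf i j x Ux; apply: (@continuous_comp _ _ _ f (fun M : 'M[R]_(m, n) => M i j)).
    exact: cf.
  exact: coord_continuous.
move=> [df cf] i j; split=> [x Ux|v].
  apply: (@differentiable_comp _ _ _ _ f (fun M : 'M[R]_(m, n) => M i j)).
    exact: df.
  exact: differentiable_coord.
apply: class_C_ext (IH _ (cf v) i j) => // x Ux.
by rewrite derive_mx ?mxE//; exact/diff_derivable/df.
Qed.

Lemma class_C_mulmx r U m n p (A : V -> 'M[R]_(m, n)) (B : V -> 'M[R]_(n, p)) :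
  open U -> class_C r U A -> class_C r U B -> class_C r U (fun x => A x *m B x).
Proof.
move=> oU /(class_C_mxP _ _ oU) cA /(class_C_mxP _ _ oU) cB.
apply/(class_C_mxP _ _ oU) => i j; under [X in class_C _ _ X]funext do rewrite mxE.
by apply: class_C_sum => // l; exact: class_CM.
Qed.

Lemma class_C_trmx r U m n (A : V -> 'M[R]_(m, n)) :
  open U -> class_C r U A -> class_C r U (fun x => (A x)^T).
Proof.
move=> oU /(class_C_mxP _ _ oU) cA.
by apply/(class_C_mxP _ _ oU) => i j; under [X in class_C _ _ X]funext do rewrite mxE.
Qed.

Lemma class_C_det r U n (A : V -> 'M[R]_n) :
  open U -> class_C r U A -> class_C r U (fun x => \det (A x)).
Proof.
move=> oU /(class_C_mxP _ _ oU) cA; rewrite /determinant.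
apply: class_C_sum => // s; apply: class_CM => //; first exact: class_C_cst.
exact: class_C_prod.
Qed.

(** By Cramer's rule the entries are polynomials in the entries of [A] divided by the nonvanishing
    determinant. *)
Lemma class_C_invmx r U n (A : V -> 'M[R]_n) :
  open U -> (forall x, U x -> A x \in unitmx) ->
  class_C r U A -> class_C r U (fun x => invmx (A x)).
Proof.
move=> oU uA cA.
apply: (@class_C_ext _ _ _ _ _ (fun x => (\det (A x))^-1 *: \adj (A x))) => //.
  by move=> x Ux; rewrite /invmx uA.
apply/(class_C_mxP _ _ oU) => i j; under [X in class_C _ _ X]funext do rewrite !mxE.
apply: class_CM => //.
  apply: class_CV; [by []| |exact: class_C_det].
  by move=> x /uA; rewrite unitmxE unitfE.
apply: class_CM => //; first exact: class_C_cst.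
apply: class_C_det => //; apply/(class_C_mxP _ _ oU) => k l.
under [X in class_C _ _ X]funext do rewrite !mxE.
by move/(class_C_mxP _ _ oU) : cA.
Qed.

End class_C_matrix.

Section class_C_comp.
Variables (R : realType) (V : normedModType R) (n : nat).

Lemma derive_sum_delta (W : normedModType R) (f : 'rV[R]_n -> W) x w :
  differentiable f x -> 'D_w f x = \sum_j w 0 j *: 'D_(delta_mx 0 j) f x.
Proof.
move=> df; rewrite (deriveE _ df) [X in 'd f _ X]row_sum_delta linear_sum.
by apply: eq_bigr => j _; rewrite linearZ (deriveE _ df).
Qed.

Lemma derive_comp (W : normedModType R) (f : V -> 'rV[R]_n) (g : 'rV[R]_n -> W) x v :
  differentiable f x -> differentiable g (f x) ->
  'D_v (g \o f) x = 'D_('D_v f x) g (f x).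
Proof.
move=> df dg; rewrite (deriveE _ (differentiable_comp df dg)) (diff_comp df dg) /=.
by rewrite (deriveE _ dg) (deriveE _ df).
Qed.

(** The chain rule gives a derivative of [g] in the direction ['D_v f x], which moves with [x],
    while [class_C] speaks of fixed directions. Expanding in the standard basis turns it into
    products of derivatives in fixed directions; this is why the middle space is a space of row
    vectors. *)
Lemma class_C_comp_real r (U : set V) (U' : set 'rV[R]_n) (f : V -> 'rV[R]_n)
    (g : 'rV[R]_n -> R) : open U -> open U' -> f @` U `<=` U' ->
  class_C r U f -> class_C r U' g -> class_C r U (g \o f).
Proof.
move=> oU oU' fU; have fUx x : U x -> U' (f x) by move=> Ux; apply: fU; exists x.
elim: r g => [|r IH] g.
  by move=> cf cg x Ux; apply: (continuous_comp (cf x Ux)); exact/cg/fUx.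
move=> Cf [dg cg]; have [df cf] := Cf; split=> [x Ux|v].
  by apply: differentiable_comp; [exact: df|exact/dg/fUx].
apply: (@class_C_ext _ _ _ _ _
    (fun x => \sum_j 'D_v f x 0 j * 'D_(delta_mx 0 j) g (f x))) => //.
  by move=> x Ux; rewrite derive_comp ?derive_sum_delta//; [exact/dg/fUx|exact: df|exact/dg/fUx].
apply: class_C_sum => // j; apply: class_CM => //; first by move/(class_C_mxP _ _ oU): (cf v); exact.
exact: (IH _ (class_C_pred Cf) (cg _)).
Qed.

Lemma class_C_comp r (U : set V) (U' : set 'rV[R]_n) m p (f : V -> 'rV[R]_n)
    (g : 'rV[R]_n -> 'M[R]_(m, p)) : open U -> open U' -> f @` U `<=` U' ->
  class_C r U f -> class_C r U' g -> class_C r U (g \o f).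
Proof.
move=> oU oU' fU cf /(class_C_mxP _ _ oU') cg.
apply/(class_C_mxP _ _ oU) => i j.
exact: (class_C_comp_real oU oU' fU cf (cg i j)).
Qed.

End class_C_comp.

Section class_C_linear.
Variables (R : realType) (n : nat).

Lemma class_C_coord r (U : set 'rV[R]_n) i j : class_C r U (fun x : 'rV[R]_n => x i j).
Proof.
case: r => [x _|r]; first exact: coord_continuous.
split=> [x _|v]; first exact: differentiable_coord.
rewrite (_ : (fun x => _) = cst (v i j)); first exact: class_C_cst.
apply/funext => x; have /derive_mx : derivable (@id 'rV[R]_n) x v by exact: derivable_id.
by rewrite derive_id => /matrixP/(_ i j); rewrite mxE /= => <-.
Qed.

Lemma class_C_id r (U : set 'rV[R]_n) : open U -> class_C r U id.
Proof. by move=> oU; apply/class_C_mxP => // i j; exact: class_C_coord. Qed.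

Lemma class_C_mulmxr r (U : set 'rV[R]_n) m (A : 'M[R]_(n, m)) : open U ->
  class_C r U (fun x => x *m A).
Proof. by move=> oU; apply: class_C_mulmx => //; [exact: class_C_id|exact: class_C_cst]. Qed.

End class_C_linear.

(** * Mean value theorem and symmetry of second derivatives *)

Section mean_value.
Variables (R : realType) (V : normedModType R).

Lemma is_derive_line (W : normedModType R) (f : V -> W) (x u : V) (t : R) :
  differentiable f (x + t *: u) ->
  is_derive t 1 (fun s => f (x + s *: u)) ('D_u f (x + t *: u)).
Proof.
move=> df; have dfu : derivable f (x + t *: u) u by exact: diff_derivable.
pose q := fun h : R => h^-1 *: ((f \o shift (x + t *: u)) (h *: u) - f (x + t *: u)).
have E : (fun h : R => h^-1 *: (((fun s => f (x + s *: u)) \o shift t) (h *: 1)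
    - f (x + t *: u))) = q.
  apply/funext => h; rewrite /q /= [h *: 1]mulr1; congr (_ *: (f _ - _)).
  by rewrite scalerDl addrCA.
by split; rewrite ?/derivable ?/derive E.
Qed.

Lemma derive_translate (W : normedModType R) (f : V -> W) (x u w : V) :
  'D_u (fun y => f (y + w)) x = 'D_u f (x + w).
Proof.
have E : (fun h : R => h^-1 *: (((fun y => f (y + w)) \o shift x) (h *: u) - f (x + w)))
    = (fun h : R => h^-1 *: ((f \o shift (x + w)) (h *: u) - f (x + w))).
  by apply/funext => h /=; rewrite addrA.
by rewrite /derive E.
Qed.

Lemma MVT_line (f : V -> R) (x u : V) (s : R) : 0 < s ->
  (forall t, 0 <= t <= s -> differentiable f (x + t *: u)) ->
  exists2 t, 0 < t < s & f (x + s *: u) - f x = s * 'D_u f (x + t *: u).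
Proof.
move=> s0 df; pose F t := f (x + t *: u).
have dF t : 0 <= t <= s -> is_derive t 1 F ('D_u f (x + t *: u)).
  by move=> ts; exact/is_derive_line/df.
have [||t ts e] := @MVT R F (fun t => 'D_u f (x + t *: u)) 0 s s0.
- by move=> t; rewrite in_itv /= => /andP[/ltW t0 /ltW ts]; apply: dF; rewrite t0.
- apply: derivable_within_continuous => t; rewrite in_itv /= => ts.
  by have [] := dF t ts.
exists t; first by move: ts; rewrite in_itv.
by move: e; rewrite /F scale0r addr0 subr0 mulrC.
Qed.

End mean_value.

Section schwarz.
Variables (R : realType) (V : normedModType R).

(** The bound [B] is kept separate from the sum of norms so that one radius serves both orders of
    the two vectors; the summand 1 makes the inequality strict. *)
Lemma near_two_steps (x w w' : V) (s p q B : R) : 0 < p < s -> 0 < q < s ->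
  `|w| + `|w'| <= B -> `|x - (x + p *: w + q *: w')| < s * (1 + B).
Proof.
move=> /andP[p0 ps] /andP[q0 qs] wB; have s0 := lt_trans p0 ps.
rewrite -addrA opprD addrA subrr sub0r normrN.
apply: le_lt_trans (ler_normD _ _) _; rewrite !normrZ !gtr0_norm//.
rewrite mulrDr mulr1 ltr_pwDl//.
apply: le_trans (ler_wpM2l (ltW s0) wB); rewrite mulrDr.
by rewrite lerD// ler_wpM2r// ltW.
Qed.

(* The second difference is expressed by two applications of the mean value
   theorem as a mixed second derivative at a nearby point. *)
Lemma second_difference (U : set V) (f : V -> R) (u v : V) (x : V) : open U -> U x ->
  class_C 2 U f -> \forall s \near 0^'+, exists a b : R,
    [/\ 0 < a < s, 0 < b < s & f (x + s *: u + s *: v) - f (x + s *: u)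
      - (f (x + s *: v) - f x) = s ^+ 2 * 'D_v ('D_u f) (x + a *: u + b *: v)].
Proof.
move=> oU Ux [df cf].
pose C := 1 + (`|u| + `|v|).
have C0 : 0 < C by rewrite /C ltr_pwDl.
have inU s a b : 0 < s -> ball x (s * C) `<=` U -> 0 <= a <= s -> 0 <= b <= s ->
    U (x + a *: u + b *: v).
  move=> s0 sU /andP[a0 aS] /andP[b0 bS]; apply: sU.
  rewrite -ball_normE /= -addrA opprD addrA subrr sub0r normrN.
  apply: le_lt_trans (ler_normD _ _) _; rewrite !normrZ !ger0_norm//.
  rewrite /C !mulrDr mulr1 ltr_pwDl// lerD//; exact: ler_wpM2r.
have hs : \forall s \near 0^'+, ball x (s * C) `<=` U.
  have [e e0 eU] : exists2 e : R, 0 < e & ball x e `<=` U.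
    by have /nbhs_ballP[e /= e0 eU] := open_nbhs_nbhs (conj oU Ux); exists e.
  near=> s; apply: (subset_trans _ eU); apply: le_ball.
  by rewrite -ler_pdivlMr//; near: s; apply: nbhs_right_le; rewrite divr_gt0.
near=> s; have s0 : 0 < s by near: s; exact: nbhs_right_gt.
have sU : ball x (s * C) `<=` U by near: s.
pose g y := f (y + s *: v) - f y.
have ss : 0 <= s <= s by rewrite lexx ltW.
have z0 : 0 <= (0:R) <= s by rewrite lexx ltW.
have dU a : 0 <= a <= s -> U (x + a *: u + s *: v) /\ U (x + a *: u).
  move=> ha; split; first exact: inU ss.
  by have := inU s a 0 s0 sU ha z0; rewrite scale0r addr0.
have dg a : 0 <= a <= s -> differentiable g (x + a *: u) /\
    'D_u g (x + a *: u) = 'D_u f (x + a *: u + s *: v) - 'D_u f (x + a *: u).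
  move=> /dU[/df d1 /df d2].
  have dsh : differentiable (fun y : V => y + s *: v) (x + a *: u).
    by apply: differentiableD; [exact: ex_diff|exact: differentiable_cst].
  have d1' : differentiable (f \o (fun y : V => y + s *: v)) (x + a *: u).
    exact: differentiable_comp.
  split; first exact: differentiableB.
  rewrite (deriveB (diff_derivable d1') (diff_derivable d2)); congr (_ - _).
  exact: derive_translate.
have [a ha ea] := @MVT_line _ _ g x u s s0 (fun a ha => proj1 (dg a ha)).
have ha' : 0 <= a <= s by case/andP : ha => /ltW -> /ltW ->.
have [b hb eb] := @MVT_line _ _ ('D_u f) (x + a *: u) v s s0
  (fun b hb => proj1 (cf u) _ (inU s a b s0 sU ha' hb)).
exists a, b; split => //.
by rewrite -/(g (x + s *: u)) -/(g x) ea (proj2 (dg a ha')) eb mulrA expr2.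
Unshelve. all: by end_near. Qed.

(** The second difference is symmetric in [u] and [v], so for small [s] each mixed derivative takes
    the same value at some point within [s * C] of [x]; continuity brings both back to [x], each
    with an error below e/2. *)
Lemma derive_swap (U : set V) (f : V -> R) (u v : V) (x : V) : open U -> U x ->
  class_C 2 U f -> 'D_v ('D_u f) x = 'D_u ('D_v f) x.
Proof.
move=> oU Ux Cf; have [_ cf] := Cf.
pose C := 1 + (`|u| + `|v|).
have C0 : 0 < C by rewrite /C ltr_pwDl.
have cont w w' : {for x, continuous ('D_w ('D_w' f))}.
  exact: ((cf w').2 w x Ux).
have close w w' e : 0 < e -> \forall s \near 0^'+, forall y : V, `|x - y| < s * C ->
    `|'D_w ('D_w' f) x - 'D_w ('D_w' f) y| < e.
  move=> e0; have /cvgrPdist_lt/(_ e e0) := cont w w'.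
  move=> /nbhs_ballP[d /= d0 dP]; near=> s => y xy; apply: dP.
  rewrite -ball_normE /=; apply: (lt_le_trans xy); rewrite -ler_pdivlMr//.
  by near: s; apply: nbhs_right_le; rewrite divr_gt0.
apply/eqP; rewrite -subr_eq0 -normr_le0; apply/ler_addgt0Pl => e e0; rewrite addr0.
have e20 : 0 < e / 2 by rewrite divr_gt0.
have S1 := second_difference u v oU Ux Cf; have S2 := second_difference v u oU Ux Cf.
have K1 := close v u _ e20; have K2 := close u v _ e20.
have K3 : \forall s \near (0 : R)^'+, 0 < s by exact: nbhs_right_gt.
have [s [[a [b [ha hb ab]]] [[c [d [hc hd cd]]] [k1 [k2 s0]]]]] :=
  filter_ex (filterI S1 (filterI S2 (filterI K1 (filterI K2 K3)))).
have E : 'D_v ('D_u f) (x + a *: u + b *: v) = 'D_u ('D_v f) (x + c *: v + d *: u).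
  have s20 : s ^+ 2 != 0 by rewrite expf_neq0// gt_eqF.
  have sym (p q r t : R) : p - q - (r - t) = p - r - (q - t) by ring.
  move: cd; rewrite (addrAC x (s *: v)) => cd; apply: (mulfI s20).
  exact: etrans (esym ab) (etrans (sym _ _ _ _) cd).
have h1 := k1 _ (near_two_steps x ha hb (lexx _)).
have vu : `|v| + `|u| <= `|u| + `|v| by rewrite addrC.
have h2 := k2 _ (near_two_steps x hc hd vu).
move: h1 h2; rewrite E; move: ('D_v _ x) ('D_u _ x) ('D_u _ _) => A B D.
clear; move=> h1 h2; rewrite (_ : A - B = (A - D) - (B - D)); last by rewrite opprB addrA subrK.
by apply: le_trans (ler_normB _ _) _; rewrite [e]splitr ltW// ltrD.
Unshelve. all: by end_near. Qed.

End schwarz.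

(** * Lipschitz estimates and the inverse function theorem *)

Section row_norm.
Variables (R : realType) (n : nat).

Lemma norm_coord_le (x : 'rV[R]_n) j : `|x 0 j| <= `|x|.
Proof.
rewrite [leRHS]/Num.Def.normr /= mx_normrE.
exact: (le_bigmax _ (fun ij : 'I_1 * 'I_n => `|x ij.1 ij.2|) (0, j)).
Qed.

Lemma norm_rV_le (x : 'rV[R]_n) (c : R) : 0 <= c ->
  (forall j, `|x 0 j| <= c) -> `|x| <= c.
Proof.
move=> c0 xc; rewrite [leLHS]/Num.Def.normr /= mx_normrE.
by apply: bigmax_le => // -[i j] _ /=; rewrite ord1.
Qed.

Lemma rV_closed_ball_compact (x : 'rV[R]_n) (e : R) : 0 < e -> compact (closed_ball x e).
Proof.
move=> e0; apply: bounded_closed_compact; last exact: closed_ball_closed.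
exists (`|x| + e); split; first exact: num_real.
move=> M hM z; rewrite closed_ballE// => xz; apply/ltW; apply: le_lt_trans hM.
rewrite -(subKr x z); apply: le_trans (ler_normB _ _) _; exact: lerD.
Qed.

End row_norm.

Lemma ball_segment (R : realType) (V : normedModType R) (x0 x y : V) (r t : R) :
  ball x0 r x -> ball x0 r y -> 0 <= t <= 1 -> ball x0 r (y + t *: (x - y)).
Proof.
rewrite -ball_normE /= => hx hy /andP[t0 t1].
have -> : x0 - (y + t *: (x - y)) = (1 - t) *: (x0 - y) + t *: (x0 - x).
  have -> : x - y = (x0 - y) - (x0 - x) by rewrite [RHS]addrC opprB addrA subrK.
  by rewrite opprD addrA scalerBl scale1r scalerBr opprB addrA addrAC.
apply: le_lt_trans (ler_normD _ _) _; rewrite !normrZ (ger0_norm t0).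
rewrite ger0_norm ?subr_ge0//.
(* The strict inequality is taken from the summand with factor [t], hence the separate case
   [t = 0]. *)
have [->|tn0] := eqVneq t 0; first by rewrite subr0 mul1r mul0r addr0.
rewrite (_ : r = (1 - t) * r + t * r); last by rewrite -mulrDl subrK mul1r.
rewrite ler_ltD//; first by rewrite ler_wpM2l ?subr_ge0// ltW.
by rewrite ltr_pM2l// lt_def tn0.
Qed.

Section lipschitz.
Variables (R : realType) (n : nat) (phi : 'rV[R]_n -> 'rV[R]_n).
Variables (x0 : 'rV[R]_n) (r d : R).
Hypothesis d0 : 0 <= d.
Hypothesis dphi : forall x, ball x0 r x -> differentiable phi x.
Hypothesis phid : forall x, ball x0 r x ->
  forall i j, `|'D_(delta_mx 0 i) phi x 0 j| <= d.

(** The norm of a row vector is the maximum of its coordinates, and each coordinate of the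
    derivative is a sum of [n] terms: this is the factor [n]. *)
Lemma derive_bound x w : ball x0 r x -> `|'D_w phi x| <= n%:R * d * `|w|.
Proof.
move=> Bx; apply: norm_rV_le => [|j]; first by rewrite !mulr_ge0.
rewrite (derive_sum_delta _ (dphi Bx)) summxE.
apply: le_trans (ler_norm_sum _ _ _) _.
apply: (@le_trans _ _ (\sum_(i < n) d * `|w|)).
  apply: ler_sum => i _; rewrite mxE normrM mulrC.
  by apply: ler_pM => //; [exact: phid|exact: norm_coord_le].
by rewrite sumr_const card_ord -mulrA -[leLHS]mulr_natl.
Qed.

(** Vector-valued maps have no mean value equality, so it is applied to each coordinate separately,
    along the segment inside the ball; the maximum norm then loses nothing. *)
Lemma derive_bound_lipschitz x y : ball x0 r x -> ball x0 r y ->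
  `|phi x - phi y| <= n%:R * d * `|x - y|.
Proof.
move=> Bx By; apply: norm_rV_le => [|j]; first by rewrite !mulr_ge0.
have Bt t : 0 <= t <= 1 -> ball x0 r (y + t *: (x - y)) by exact: ball_segment.
pose F (z : 'rV[R]_n) : R := phi z 0 j.
have dF t : 0 <= t <= 1 -> differentiable F (y + t *: (x - y)).
  move=> /Bt/dphi dp.
  apply: (@differentiable_comp _ _ _ _ phi (fun M : 'rV[R]_n => M 0 j)) => //.
  exact: differentiable_coord.
have [t ht] := MVT_line ltr01 dF.
rewrite scale1r [y + _]addrC subrK mul1r /F => e; rewrite !mxE e.
have Bt' : ball x0 r (y + t *: (x - y)).
  by apply: Bt; case/andP : ht => /ltW -> /ltW ->.
apply: le_trans (derive_bound (x - y) Bt').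
rewrite (_ : 'D_(x - y) _ _ = ('D_(x - y) phi (y + t *: (x - y))) 0 j).
  exact: norm_coord_le.
by rewrite derive_mx ?mxE//; exact/diff_derivable/dphi.
Qed.

End lipschitz.

Lemma jacobianE (R : realType) m n (f : 'rV[R]_m -> 'rV[R]_n) x i j :
  differentiable f x -> 'J f x i j = 'D_(delta_mx 0 i) f x 0 j.
Proof. by move=> df; rewrite (deriveE _ df) /jacobian mxE. Qed.

Lemma class_C_jacobian (R : realType) m n r (U : set 'rV[R]_m)
    (f : 'rV[R]_m -> 'rV[R]_n) :
  open U -> class_C r.+1 U f -> class_C r U (jacobian f).
Proof.
move=> oU [df cf]; apply/(class_C_mxP _ _ oU) => i j.
apply: (@class_C_ext _ _ _ _ _ (fun x => 'D_(delta_mx 0 i) f x 0 j)) => //.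
  by move=> x /df dfx; rewrite jacobianE.
by move/(class_C_mxP _ _ oU): (cf (delta_mx 0 i)).
Qed.

Section inverse_function.
Variables (R : realType) (n : nat).
Implicit Types (f g : 'rV[R]_n -> 'rV[R]_n).

(** The difference [phi] of [f] and the identity has zero derivative at [x0]; its partial
    derivatives are continuous, hence small on a ball, where [phi] is a contraction with factor
    1/2. *)
Lemma near_isometry f U x0 : open U -> U x0 -> class_C 1 U f ->
  (forall v, 'D_v f x0 = v) ->
  exists2 r : R, 0 < r & [/\ ball x0 r `<=` U,
    (forall x w, ball x0 r x -> `|'D_w f x - w| <= 2^-1 * `|w|) &
    forall x y, ball x0 r x -> ball x0 r y ->
      `|f x - f y - (x - y)| <= 2^-1 * `|x - y|].
Proof.
move=> oU Ux0 [df cf] fid.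
pose phi (x : 'rV[R]_n) := f x - x.
have dphi x : U x -> differentiable phi x.
  by move=> Ux; apply: differentiableB; [exact: df|exact: ex_diff].
have Dphi w x : U x -> 'D_w phi x = 'D_w f x - w.
  move=> Ux; have -> : phi = f - id by [].
  rewrite deriveB; [|exact/diff_derivable/df|exact: derivable_id].
  by rewrite derive_id.
(* Chosen so that [n%:R * d] is at most 1/2; the successor avoids a division by zero in dimension
   0. *)
pose d : R := (2 * n.+1%:R)^-1.
have d0 : 0 < d by rewrite invr_gt0 mulr_gt0.
have close : \forall x \near x0, U x /\
    forall ij : 'I_n * 'I_n, `|('D_(delta_mx 0 ij.1) f x - delta_mx 0 ij.1) 0 ij.2| <= d.
  have hU : \forall x \near x0, U x by exact: open_nbhs_nbhs.
  suff hD (ij : 'I_n * 'I_n) : \forall x \near x0,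
      `|('D_(delta_mx 0 ij.1) f x - delta_mx 0 ij.1) 0 ij.2| <= d.
    have hA := filter_forall _ hD.
    by apply: filterS2 hU (hA _) => x Ux h; split.
  case: ij => i j /=.
  have := cf (delta_mx 0 i) x0 Ux0; move/cvgrPdist_le => /(_ d d0).
  apply: filterS => x; rewrite fid => h; apply: le_trans h.
  by rewrite distrC; exact: norm_coord_le.
have [r /= r0 rB] := (nbhs_ballP _ _).1 close; exists r => //.
have BU : ball x0 r `<=` U by move=> x /rB[].
have B1 x : ball x0 r x -> differentiable phi x by move=> /BU; exact: dphi.
have B2 x : ball x0 r x -> forall i j, `|'D_(delta_mx 0 i) phi x 0 j| <= d.
  by move=> Bx i j; rewrite Dphi; [have [_ /(_ (i, j))] := rB _ Bx|exact: BU].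
have nd : n%:R * d <= 2^-1.
  by rewrite /d invfM mulrCA ler_piMr// ler_pdivrMr// mul1r ler_nat.
split=> // [x w Bx|x y Bx By].
  rewrite -Dphi; last exact: BU.
  by apply: le_trans (derive_bound (ltW d0) B1 B2 w Bx) _; rewrite ler_wpM2r.
have -> : f x - f y - (x - y) = phi x - phi y.
  by rewrite /phi !opprB addrACA [RHS]addrACA; congr (_ + _); rewrite addrC.
by apply: le_trans (derive_bound_lipschitz (ltW d0) B1 B2 Bx By) _; rewrite ler_wpM2r.
Qed.

(* A minimum point of [|f x - y|] over a closed ball is a solution of [f x = y],
   as otherwise [x - (f x - y)] would be a better one. *)
Lemma near_isometry_open f x0 (r : R) x1 y :
  (forall x y, ball x0 r x -> ball x0 r y -> `|f x - f y - (x - y)| <= 2^-1 * `|x - y|) ->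
  (forall x, ball x0 r x -> {for x, continuous f}) ->
  forall e, 0 < e -> closed_ball x1 e `<=` ball x0 r ->
  `|y - f x1| <= e / 2 -> exists2 x, closed_ball x1 e x & f x = y.
Proof.
move=> H fc e e0 eB ye; have Be x : closed_ball x1 e x <-> `|x1 - x| <= e.
  by rewrite closed_ballE.
have Bx1 : closed_ball x1 e x1 by apply/Be; rewrite subrr normr0 ltW.
pose F x := `|f x - y|.
have Fc : {within closed_ball x1 e, continuous F}.
  apply: continuous_in_subspaceT => x /set_mem/eB/fc cfx.
  apply: (@continuous_comp _ _ _ (fun z => f z - y) (fun z : 'rV[R]_n => `|z|)).
    by apply: continuousB; [exact: cfx|exact: cst_continuous].
  exact: norm_continuous.
have Kc := rV_closed_ball_compact (x := x1) e0.
have [x xK xmin] := EVT_min_rV (ex_intro _ _ Bx1) Kc Fc.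
move/set_mem : xK => xK; exists x => //; apply/eqP; rewrite -subr_eq0 -normr_le0.
pose x' := x - (f x - y).
(* The radius splits into two halves: one bounds [y - f x1], the other is the contraction factor
   times [e]. *)
have x'K : closed_ball x1 e x'.
  apply/Be; rewrite distrC /x'.
  have -> : x - (f x - y) - x1 = (y - f x1) - (f x - f x1 - (x - x1)).
    rewrite !opprB [RHS]addrCA -!addrA; congr (_ + _).
    rewrite [RHS]addrC -!addrA; congr (_ + _).
    by rewrite addKr.
  apply: le_trans (ler_normB _ _) _; rewrite [leRHS]splitr lerD//.
  apply: le_trans (H _ _ (eB _ xK) (eB _ Bx1)) _.
  by rewrite mulrC ler_pM2r ?invr_gt0// distrC; exact/Be.
have := xmin x' (mem_set x'K); rewrite /F => h.
have : `|f x' - y| <= 2^-1 * `|f x - y|.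
  have e1 : x' - x = - (f x - y) by rewrite /x' addrAC subrr sub0r.
  have -> : f x' - y = f x' - f x - (x' - x) by rewrite e1 opprK addrA subrK.
  by apply: le_trans (H _ _ (eB _ x'K) (eB _ xK)) _; rewrite e1 normrN.
by move=> /(le_trans h); have := normr_ge0 (f x - y); clear; move=> *; lra.
Qed.

(** The last estimate on [f] makes its inverse 2-Lipschitz at [f x]. Applying the inverse Jacobian
    to the first-order expansion of [f] therefore gives one of [g], as an error small with respect
    to [z - x] is small with respect to [f z - f x]. *)
Lemma derive_inverse f g (V : set 'rV[R]_n) x : open V -> V x ->
  (forall z, V z -> g (f z) = z) -> open (f @` V) -> differentiable f x ->
  (forall z, V z -> `|f z - f x - (z - x)| <= 2^-1 * `|z - x|) ->
  'J f x \in unitmx -> differentiable g (f x) /\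
  forall v, 'D_v g (f x) = v *m invmx ('J f x).
Proof.
move=> oV Vx gK oW df H Ju; set L := invmx ('J f x).
have nearW : \forall h \near (0 : 'rV[R]_n), (f @` V) (h + f x).
  have /nbhs0P : nbhs (f x) (f @` V) by apply: open_nbhs_nbhs; split => //; exists x.
  by apply: filterS => h; rewrite addrC.
have kh z : V z -> `|z - x| <= 2 * `|f z - f x|.
  move=> /H h; have : `|z - x| <= `|f z - f x| + `|f z - f x - (z - x)|.
    rewrite -[X in `|X| <= _](subKr (f z - f x)); exact: ler_normB.
  by have := normr_ge0 (z - x); move: h; clear; move=> *; lra.
have cL : continuous (mulmxr L : 'rV[R]_n -> 'rV[R]_n).
  by move=> y; apply: differentiable_continuous;
     exact: ((class_C_mulmxr 1 L openT).1 y I).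
pose Lm : {linear 'rV[R]_n -> 'rV[R]_n} := mulmxr L.
have [M M0 ML] := linear_lipschitz (f := Lm) cL.
have cont_g : forall e, 0 < e -> \forall h \near (0 : 'rV[R]_n), `|g (h + f x) - x| <= e.
  move=> e e0; have : \forall h \near (0 : 'rV[R]_n), `|h| <= e / 2.
    apply: nbhs0_le; exact: divr_gt0.
  apply: filterS2 nearW => h [z Vz zh] he; rewrite -zh gK//.
  by apply: le_trans (kh _ Vz) _; rewrite zh addrK mulrC -ler_pdivlMr.
have eg : g \o shift (f x) = cst (g (f x)) + Lm +o_ (0 : 'rV[R]_n) id.
  apply/eqaddoP => e e0.
  have /diff_locallyP[_ /eqaddoP ef] := df.
  (* [M] bounds multiplication by the inverse Jacobian and 2 is the Lipschitz constant of [kh];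
     together they turn this tolerance into [e]. *)
  have d0 : 0 < e / (2 * M) by rewrite divr_gt0// mulr_gt0.
  have /nbhs_ballP[r /= r0 rB] := ef _ d0.
  have r20 : 0 < r / 2 by rewrite divr_gt0.
  apply: filterS2 nearW (cont_g _ r20) => h [z Vz zh].
  rewrite !fctE /= -zh !gK// => zx.
  have /rB : ball (0 : 'rV[R]_n) r (z - x).
    rewrite -ball_normE /= sub0r normrN; apply: le_lt_trans zx _.
    by rewrite ltr_pdivrMr// mulr2n mulrDr mulr1 ltrDl.
  rewrite !fctE /= subrK => hz.
  have hE : f z - f x = h by rewrite zh addrK.
  have Jzx : 'd f x (z - x) = (z - x) *m 'J f x by rewrite -(deriveE _ df) deriveEjacobian.
  have -> : z - (x + h *m L) = - ((f z - (f x + 'd f x (z - x))) *m L).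
    have JL : (z - x) *m 'J f x *m L = z - x by rewrite -mulmxA mulmxV// mulmx1.
    by rewrite Jzx (opprD (f x)) (addrA (f z)) (mulmxBl (f z - f x)) JL hE !opprB opprD addrA.
  rewrite normrN; apply: le_trans (ML _) _.
  apply: le_trans (ler_wpM2l (ltW M0) hz) _.
  apply: (le_trans (y := M * (e / (2 * M) * (2 * `|h|)))).
    rewrite !ler_wpM2l ?(ltW M0) ?(ltW d0)//.
    by rewrite -hE; exact: kh.
  rewrite le_eqVlt; apply/orP; left; apply/eqP; field.
  by rewrite gt_eqF.
have dg : 'd g (f x) = mulmxr L :> (_ -> _) by rewrite (diff_unique cL eg).
have dgx : differentiable g (f x) by apply/diff_locallyP; rewrite dg.
by split=> // v; rewrite deriveE// dg.
Qed.

(** Bootstrapping: the derivative of [g] is the inverse matrix of the Jacobian of [f] composed with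
    [g], so [g] of class C^r makes its own derivative of class C^r. *)
Lemma derive_inverse_continuous f g (V : set 'rV[R]_n) : open V ->
  (forall z, V z -> g (f z) = z) -> open (f @` V) ->
  smooth_on V f -> (forall z, V z -> 'J f z \in unitmx) ->
  (forall x z, V x -> V z -> `|f z - f x - (z - x)| <= 2^-1 * `|z - x|) ->
  smooth_on (f @` V) g.
Proof.
move=> oV gK oW Cf Ju H.
have dg y : (f @` V) y -> differentiable g y /\
    forall v, 'D_v g y = v *m invmx ('J f (g y)).
  move=> [x Vx <-]; rewrite gK//.
  apply: (derive_inverse oV Vx gK oW _ _ (Ju _ Vx)); first exact: (Cf 1).1.
  by move=> z; exact: H.
elim=> [|r IH]; first by move=> y /dg[/differentiable_continuous].
split=> [y /dg[]//|v].
apply: (@class_C_ext _ _ _ _ _ (fun y => v *m invmx ('J f (g y)))) => //.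
  by move=> y /dg[_ ->].
apply: class_C_mulmx => //; first exact: class_C_cst.
have gW : g @` (f @` V) `<=` V by move=> _ [_ [x Vx <-] <-]; rewrite gK.
apply: class_C_invmx => //.
  by move=> _ [x Vx <-]; rewrite gK//; exact: Ju.
exact: (class_C_comp (g := fun z => 'J f z) oW oV gW IH (class_C_jacobian oV (Cf r.+1))).
Qed.

Theorem inverse_function f U x0 : open U -> U x0 -> smooth_on U f ->
  (forall v, 'D_v f x0 = v) ->
  exists V g, [/\ open V, V x0, V `<=` U, open (f @` V) &
    (forall x, V x -> g (f x) = x) /\ smooth_on (f @` V) g].
Proof.
move=> oU Ux0 Cf fid; have [df _] := Cf 1.
have [r r0 [BU H2 H1]] := near_isometry oU Ux0 (Cf 1) fid.
pose V : set 'rV[R]_n := ball x0 r.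
have inj x y : V x -> V y -> f x = f y -> x = y.
  move=> Vx Vy fxy; have := H1 x y Vx Vy; rewrite fxy subrr sub0r normrN => h.
  apply/eqP; rewrite -subr_eq0 -normr_le0.
  by have := normr_ge0 (x - y); move: h; clear; move=> *; lra.
pose g y := xget x0 [set x | V x /\ f x = y].
have gK x : V x -> g (f x) = x.
  by move=> Vx; rewrite /g; case: xgetP => [z _ [Vz /inj->]//|/(_ x)[]].
have oV : open V by exact: ball_open.
have Vx0 : V x0 by exact: ballxx.
have fc x : V x -> {for x, continuous f}.
  by move=> /BU/df/differentiable_continuous.
have oW : open (f @` V).
  rewrite openE => _ [x Vx <-]; rewrite /interior.
  have /nbhs_closedballP[e eV] : nbhs x V by exact: open_nbhs_nbhs.
  have e0 : 0 < e%:num by [].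
  apply/nbhs_ballP; exists (e%:num / 2) => /=; first exact: divr_gt0.
  move=> y; rewrite -ball_normE /= distrC => /ltW ye.
  by have [z zK fz] := near_isometry_open H1 fc e0 eV ye; exists z => //; exact: eV.
exists V, g; split=> //; split=> //.
apply: (derive_inverse_continuous oV gK oW).
- by move=> k; exact: class_C_sub (Cf k).
(* A vector killed by the Jacobian at [z] would satisfy |v| <= |v|/2, as the derivative differs from
   the identity by at most half the norm on the whole ball. *)
- move=> z Vz; rewrite -row_free_unit; apply/inj_row_free => v vJ.
  have dfz := df z (BU z Vz).
  have := H2 z v Vz; rewrite (deriveEjacobian _ dfz) vJ sub0r normrN => h.
  apply/eqP; rewrite -normr_le0.
  by have := normr_ge0 v; move: h; clear; move=> *; lra.
- by move=> x z Vx Vz; exact: H1.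
Qed.

End inverse_function.

(** * Paracompactness of subspaces of locally Euclidean quotients *)

Section paracompactness.
Variable T : topologicalType.
Implicit Types (O N : set T) (C D : set (set T)).

(** Covers and refinements consist of open sets of the ambient space, which avoids subspace types;
    local finiteness is asked at points of [O] only. *)
Definition paracompact_on O := forall C, (forall A, C A -> open A) ->
  O `<=` \bigcup_(A in C) A -> exists D,
  [/\ (forall B, D B -> open B), O `<=` \bigcup_(B in D) B,
      (forall B, D B -> exists2 A, C A & B `<=` A) &
      forall x, O x -> exists2 V, nbhs x V & finite_set [set B | D B /\ B `&` V !=set0]].

Lemma paracompact_onT : paracompact_on setT -> paracompact T.
Proof.
move=> pT C [oC cC]; have [|D [oD cD DC lD]] := pT C oC; first by rewrite cC.
exists D; split=> //.
  by split=> //; apply/seteqP; split=> // x _; exact: cD.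
by move=> x; exact: lD.
Qed.

Lemma compact_finite_cover (K : set T) C : compact K -> (forall A, C A -> open A) ->
  K `<=` \bigcup_(A in C) A ->
  exists2 F : {fset set T}, {subset F <= C} & K `<=` \bigcup_(A in [set` F]) A.
Proof.
move=> cK oC KC.
(* Cover compactness is stated for pointed spaces; a point of a nonempty [K] serves as base
   point. *)
have [/eqP|/set0P[x0 _]] := boolP (K == set0).
  by move=> ->; exists fset0.
pose T' : ptopologicalType := HB.pack T (isPointed.Build T x0).
have : @cover_compact T' K by rewrite -compact_cover; exact: cK.
by move=> /(_ _ C id oC KC).
Qed.

(** The classical argument for exhaustions by compact sets: each compact layer needs finitely many
    members of the cover, and these are cut down to an open shell around the layer. A point has a
    neighbourhood that meets only finitely many shells. *)
Lemma exhaustion_paracompact_on O (K : nat -> set T) : hausdorff_space T ->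
  (forall m, compact (K m)) -> (forall m, K m `<=` (K m.+1)^°) ->
  O = \bigcup_m K m -> paracompact_on O.
Proof.
move=> hT cK KK OK C oC OC.
(* Two empty sets are put in front so that layers and shells have uniform formulas from index 0
   on. *)
pose E m := if m is m'.+2 then K m' else set0.
have cE m : compact (E m) by case: m => [|[|m]]; [exact: compact0..|exact: cK].
have EE m : E m `<=` (E m.+1)^° by case: m => [|[|m]] //; exact: KK.
have EO m : E m `<=` O by case: m => [|[|m]] //= x Kx; rewrite OK; exists m.
have clE m : closed (E m) by exact: compact_closed.
pose L m := E m.+2 `\` (E m.+1)^°.
have cL m : compact (L m).
  rewrite /L setDE; apply: compact_closedI => //.
  by apply: open_closedC; exact: open_interior.
have fc m : exists F : {fset set T}, {subset F <= C} /\ L m `<=` \bigcup_(A in [set` F]) A.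
  have [|F FC LF] := @compact_finite_cover (L m) C (cL m) oC; last by exists F.
  by move=> x [/EO/OC].
have [F FP] := choice fc.
have FC m := (FP m).1; have LF m := (FP m).2.
have FCs m A : A \in F m -> C A by move=> /FC/set_mem.
(* The shell extends one step beyond the layer [L m] on either side, so it contains the layer and is
   open. *)
pose W m A := A `&` ((E m.+3)^° `\` E m).
exists [set B | exists2 m, True & exists2 A, A \in F m & B = W m A]; split.
- move=> _ [m _ [A /FCs/oC oA ->]]; apply: openI => //.
  by rewrite setDE; apply: openI; [exact: open_interior|exact: closed_openC].
- move=> x; rewrite OK => -[j _ Kx].
  have : E j.+2 x by [].
  elim: {Kx}j.+2 => [//|i IH] Ex; have [/IH//|nEx] := pselect (E i x).
  case: i Ex nEx IH => [//|i] Ex nEx _.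
  have [iE|niE] := pselect ((E i.+1)^° x); first by case: nEx; exact: interior_subset iE.
  have [A AF Ax] := LF i x (conj Ex niE).
  exists (W i A); first by exists i => //; exists A.
  split=> //; split; first exact: EE.
  by move=> /EE/interior_subset.
- by move=> _ [m _ [A /FCs CA ->]]; exists A => // x [].
- move=> x; rewrite OK => -[j _ Kx]; exists ((E j.+3)^°).
    by apply: open_nbhs_nbhs; split; [exact: open_interior|exact: (EE j.+2)].
  apply: (@sub_finite_set _ _ (\bigcup_(m in [set m | (m < j.+3)%N])
      [set W m A | A in [set` F m]])).
    move=> _ [[m _ [A AF ->]] [y [[_ [_ nEy]] Ey]]].
    exists m; last by exists A.
    rewrite /= ltnNge; apply/negP => jm; apply: nEy.
    have mono k : E j.+3 `<=` E (j.+3 + k)%N.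
      elim: k => [|k IH]; first by rewrite addn0.
      by apply: subset_trans IH _; rewrite addnS => z /EE/interior_subset.
    by rewrite -(subnKC jm); apply: mono; exact: interior_subset Ey.
  apply: bigcup_finite; first exact: finite_II.
  by move=> m _; exact/finite_image/finite_fset.
Qed.

(** A locally finite cover [D0] of the space is taken inside the good sets; the given cover is
    refined in each good set, and the refinement is intersected with the corresponding member of
    [D0]. *)
Lemma open_paracompact_on : paracompact T ->
  (forall x, exists A N, [/\ open A, A x, open N, closure A `<=` N &
     forall O, open O -> O `<=` N -> paracompact_on O]) ->
  forall O, open O -> paracompact_on O.
Proof.
move=> pT loc O oO C oC OC.
pose good N := open N /\ forall O, open O -> O `<=` N -> paracompact_on O.
have [|D0 [[oD0 cD0] D0A lD0]] := pT [set A | open A /\ exists2 N, good N & closure A `<=` N].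
  split=> [A []//|]; apply/seteqP; split=> // x _.
  by have [A [N [oA Ax oN AN gN]]] := loc x; exists A => //; split=> //; exists N.
have ch B : exists NV : set T * set (set T), D0 B -> [/\ open NV.1, closure B `<=` NV.1,
    forall V, NV.2 V -> open V & [/\ O `&` NV.1 `<=` \bigcup_(V in NV.2) V,
    forall V, NV.2 V -> exists2 A, C A & V `<=` A &
    forall x, O x -> NV.1 x -> exists2 W, nbhs x W &
      finite_set [set V | NV.2 V /\ V `&` W !=set0]]].
  have [DB|nDB] := pselect (D0 B); last by exists (set0, set0).
  have [A [oA [N [oN gN] AN]] BA] := D0A B DB.
  have oON : open (O `&` N) by exact: openI.
  have [||VV [oV cV VC lV]] := gN (O `&` N) oON _ C oC; first by move=> x [].
    by move=> x [/OC].
  exists (N, VV) => _ /=; split=> //; first by apply: subset_trans AN; exact: closureS.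
  by split=> // x Ox Nx; apply: lV.
have [NV NVP] := choice ch.
exists [set U | exists2 B, D0 B & exists2 V, (NV B).2 V & U = V `&` B]; split.
- move=> _ [B DB [V VB ->]]; apply: openI; last exact: oD0.
  by have [_ _ oV _] := NVP B DB; exact: oV.
- move=> x Ox; have [B DB Bx] : (\bigcup_(B in D0) B) x by rewrite cD0.
  have [_ BN _ [cV _ _]] := NVP B DB.
  have [V VB Vx] := cV x (conj Ox (BN _ (subset_closure Bx))).
  by exists (V `&` B) => //; exists B => //; exists V.
- move=> _ [B DB [V VB ->]]; have [_ _ _ [_ VC _]] := NVP B DB.
  by have [A CA VA] := VC V VB; exists A => // x [/VA].
- move=> x Ox; have [W0 xW0 fW0] := lD0 x.
  (* For each [B] there are two cases: the refinement attached to [B] is already locally finite at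
     [x], or [x] is outside the good set and so outside the closure of [B], whose complement then
     works. This is the role of the closure in the choice of [D0]. *)
  have ch2 B : exists W, nbhs x W /\ (D0 B ->
      finite_set [set V | (NV B).2 V /\ V `&` B `&` W !=set0]).
    have [DB|nDB] := pselect (D0 B); last by exists setT; split=> //; exact: filterT.
    have [oN BN _ [_ _ lV]] := NVP B DB.
    have [Nx|nNx] := pselect ((NV B).1 x).
      have [W xW fW] := lV x Ox Nx; exists W; split=> // _; apply: sub_finite_set fW.
      by move=> V [VB [y [[Vy _] Wy]]]; split=> //; exists y.
    exists (~` closure B); split=> [|_].
      apply: open_nbhs_nbhs; split; first by apply: closed_openC; exact: closed_closure.
      by move=> /BN.
    apply: (@sub_finite_set _ _ set0) => // V [_ [y [[_ By]]]].
    by case; exact: subset_closure.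
  have [w wP] := choice ch2.
  have [F0 F0E] := finite_fsetP.1 fW0.
  exists (W0 `&` \bigcap_(B in [set` F0]) w B).
    by apply: filterI => //; apply: filter_bigI => B _; case: (wP B).
  apply: (@sub_finite_set _ _ (\bigcup_(B in [set B | D0 B /\ B `&` W0 !=set0])
     [set V `&` B | V in [set V | (NV B).2 V /\ V `&` B `&` w B !=set0]])).
    move=> _ [[B DB [V VB ->]] [y [[Vy By] [Wy wy]]]].
    have hB : [set B | D0 B /\ B `&` W0 !=set0] B by split=> //; exists y.
    exists B => //; exists V => //; split=> //; exists y; split=> //.
    by apply: wy; move: hB; rewrite F0E.
  apply: bigcup_finite => // B [DB _]; apply: finite_image.
  by case: (wP B) => _; exact.
Qed.

(** An open cover of [Y] extends to open sets of the ambient space, whose union is an open set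
    containing [Y]; a refinement there restricts to [Y]. *)
Lemma subspace_paracompact (Y : set T) :
  (forall O, open O -> paracompact_on O) -> paracompact Y.
Proof.
move=> pO C [oC cC].
pose C' := [set O : set T | open O /\ exists2 A, C A & set_val @^-1` O `<=` A].
have oC' : open (\bigcup_(O in C') O) by apply: bigcup_open => A [].
have oA' A : C' A -> open A by case.
have [D [oD cD DC lD]] := pO _ oC' C' oA' (@subset_refl _ _).
have YC' (y : Y) : (\bigcup_(O in C') O) (set_val y).
  have [A CA Ay] : (\bigcup_(A in C) A) y by rewrite cC.
  have [P oP PA] := oC A CA; exists P; last by rewrite -PA in Ay.
  by split=> //; exists A => //; rewrite PA.
exists [set B' : set Y | exists2 B, D B & B' = set_val @^-1` B]; split.
- split=> [_ [B DB ->]|]; first by exists B => //; exact: oD.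
  apply/seteqP; split=> // y _; have [B DB By] := cD _ (YC' y).
  by exists (set_val @^-1` B) => //; exists B.
- move=> _ [B DB ->]; have [P [oP [A CA PA]] BP] := DC B DB.
  by exists A => // y /BP; exact: PA.
- move=> y; have [V yV fV] := lD _ (YC' y).
  exists (set_val @^-1` V); first exact: (initial_continuous yV).
  apply: (@sub_finite_set _ _ [set set_val @^-1` B | B in [set B | D B /\ B `&` V !=set0]]).
    by move=> _ [[B DB ->] [z [Bz Vz]]]; exists B => //; split=> //; exists (set_val z).
  exact: finite_image.
Qed.

End paracompactness.

Section euclidean_image.
Variables (R : realType) (n : nat) (T : topologicalType).

(** Weaker than a chart, since [f] may identify points: the intended [f] is an inverse manifold
    chart followed by an orbifold projection. *)
Definition open_parametrization (G : set 'rV[R]_n) (f : 'rV[R]_n -> T) :=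
  [/\ open G, forall x, G x -> {for x, continuous f} &
      forall U, open U -> U `<=` G -> open (f @` U)].

Lemma euclidean_exhaustion (G : set 'rV[R]_n) : open G ->
  exists K : nat -> set 'rV[R]_n, [/\ forall m, compact (K m),
    forall m, K m `<=` (K m.+1)^° & G = \bigcup_m K m].
Proof.
move=> oG; pose K (m : nat) := [set x : 'rV[R]_n | `|x| <= m%:R /\ ball x m.+1%:R^-1 `<=` G].
have iv m : (0 : R) < m.+1%:R^-1 by rewrite invr_gt0.
exists K; split.
- move=> m; apply: bounded_closed_compact.
    exists m%:R; split; first exact: num_real.
    by move=> M mM x [xm _]; apply: le_trans xm (ltW mM).
  move=> x clx; split.
    apply/ler_addgt0Pl => e e0; have [z [[zm _] xz]] := clx _ (nbhsx_ballx x e e0).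
    rewrite -(subrK z x); apply: le_trans (ler_normD _ _) _.
    by rewrite lerD//; move: xz; rewrite -ball_normE /= => /ltW.
  move=> y; rewrite -ball_normE /= => xy.
  have d0 : 0 < m.+1%:R^-1 - `|x - y| by rewrite subr_gt0.
  have [z [[_ zG] xz]] := clx _ (nbhsx_ballx x _ d0); apply: zG.
  move: xz; rewrite -!ball_normE /= ltrBrDr; apply: le_lt_trans.
  by rewrite (distrC x z); exact: ler_distD.
- move=> m x [xm xG].
  (* A move shorter than the gap between consecutive radii keeps the smaller ball in [G]; as the gap
     is at most 1, the norm stays below the next bound too. *)
  pose d : R := m.+1%:R^-1 - m.+2%:R^-1.
  have d0 : 0 < d by rewrite subr_gt0 ltf_pV2 ?posrE// ltr_nat.
  apply/nbhs_ballP; exists d => //= z; rewrite -ball_normE /= => xz; split.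
    rewrite -(subrK x z) -natr1 addrC; apply: le_trans (ler_normD _ _) _.
    rewrite lerD// distrC ltW//; apply: lt_le_trans xz _.
    rewrite /d lerBlDr; apply: (@le_trans _ _ 1); first by rewrite invf_le1 ?ler1n.
    by rewrite lerDl invr_ge0.
  move=> y zy; apply: xG; rewrite (_ : m.+1%:R^-1 = d + m.+2%:R^-1); last by rewrite subrK.
  by apply: ball_triangle zy; rewrite -ball_normE.
- apply/seteqP; split=> [x Gx|x [m _ [_ xG]]]; last by apply: xG; exact: ballxx.
  have /nbhs_ballP[e /= e0 eG] : nbhs x G by exact: open_nbhs_nbhs.
  exists (maxn (Num.truncn `|x|).+1 (Num.truncn e^-1)) => //; split.
    by apply/ltW/(lt_le_trans (truncnS_gt _)); rewrite ler_nat leq_maxl.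
  apply: subset_trans eG; apply: le_ball; rewrite invf_ple ?posrE//.
  by apply/ltW/(lt_le_trans (truncnS_gt _)); rewrite ler_nat ltnS leq_maxr.
Qed.

Lemma parametrization_paracompact_on (G : set 'rV[R]_n) (f : 'rV[R]_n -> T) :
  hausdorff_space T -> open_parametrization G f ->
  forall O, open O -> O `<=` f @` G -> paracompact_on O.
Proof.
move=> hT [oG cf of_] O oO OG.
have oG' : open (G `&` f @^-1` O).
  rewrite openE => x [Gx Ofx]; apply: filterI; first exact: open_nbhs_nbhs.
  by apply: (cf x Gx); exact: open_nbhs_nbhs.
have [K [cK KK GK]] := euclidean_exhaustion oG'.
have KG m : K m `<=` G by move=> x Kx; have [] : (G `&` f @^-1` O) x by rewrite GK; exists m.
apply: (exhaustion_paracompact_on (K := fun m => f @` K m)) => //.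
- move=> m; apply: continuous_compact (cK m).
  by apply: continuous_in_subspaceT => x /set_mem/KG; exact: cf.
- move=> m _ [x /KK Kx <-].
  suff : (f @` (K m.+1)^°)  `<=` (f @` K m.+1)^° by apply; exists x.
  rewrite -open_subsetE; first by apply: image_subset; exact: interior_subset.
  apply: of_; first exact: open_interior.
  by apply: subset_trans (KG m.+1); exact: interior_subset.
- apply/seteqP; split=> [y Oy|_ [m _ [x Kx <-]]].
    have [x Gx xy] := OG y Oy; have : (G `&` f @^-1` O) x by rewrite /= xy.
    by rewrite GK => -[m _ Kx]; exists m => //; exists x.
  by have [] : (G `&` f @^-1` O) x by rewrite GK; exists m.
Qed.

(** The image of a closed ball is compact, hence closed, so it contains the closure of the image of
    the open ball: this provides the shrunken neighbourhoods that the local-to-global step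
    requires. *)
Lemma locally_parametrized_paracompact : hausdorff_space T -> paracompact T ->
  (forall x, exists G f, open_parametrization G f /\ (f @` G) x) ->
  forall Y : set T, paracompact Y.
Proof.
move=> hT pT loc Y; apply: subspace_paracompact; apply: open_paracompact_on => // x.
have [G [f [Gf [z Gz zx]]]] := loc x; have [oG cf of_] := Gf.
have /nbhs_closedballP[e eG] : nbhs z G by exact: open_nbhs_nbhs.
have e0 : 0 < e%:num by [].
have bc : ball z e%:num `<=` closed_ball z e%:num by exact: subset_closure.
exists (f @` ball z e%:num), (f @` G); split.
- apply: of_; [exact: ball_open|exact: subset_trans eG].
- by exists z => //; exact: ballxx.
- exact: of_.
- apply: (@subset_trans _ (f @` closed_ball z e%:num)); last exact: image_subset.
  have cL : closed (f @` closed_ball z e%:num).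
    apply: compact_closed => //; apply: continuous_compact.
      by apply: continuous_in_subspaceT => y /set_mem ye; apply: cf; exact: eG.
    exact: rV_closed_ball_compact.
  by rewrite [X in _ `<=` X](closure_id _).1//; apply: closureS; exact: image_subset.
- exact: parametrization_paracompact_on Gf.
Qed.

Lemma rV_paracompact : paracompact 'rV[R]_n.
Proof.
apply: paracompact_onT.
have hR : hausdorff_space 'rV[R]_n by exact: norm_hausdorff.
have [K [cK KK GK]] := euclidean_exhaustion (@openT 'rV[R]_n).
exact: exhaustion_paracompact_on GK.
Qed.

End euclidean_image.

(** * Smoothness at a point *)

Section smooth_at.
Variables (R : realType) (V : normedModType R).

(** One neighbourhood serves all orders of differentiability, which makes this both a property of
    germs and an open condition on [x]. *)
Definition smooth_at (W : normedModType R) (f : V -> W) (x : V) :=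
  exists U : set V, [/\ open U, U x & smooth_on U f].

Section general_codomain.
Variable W : normedModType R.
Implicit Types f g : V -> W.

Lemma smooth_on_at (U : set V) f x : open U -> smooth_on U f -> U x -> smooth_at f x.
Proof. by move=> oU Uf Ux; exists U. Qed.

Lemma smooth_at_on (U : set V) f : (forall x, U x -> smooth_at f x) -> smooth_on U f.
Proof.
move=> H r; apply: class_C_local => x /H[U' [_ U'x sf]]; exists U' => //; exact: sf.
Qed.

Lemma smooth_at_near f x : smooth_at f x -> \forall y \near x, smooth_at f y.
Proof.
move=> [U [oU Ux sf]]; apply: filterS (open_nbhs_nbhs (conj oU Ux)) => y Uy.
by exists U.
Qed.

Lemma near_eq_smooth_at f g x : (\near x, f x = g x) -> smooth_at f x -> smooth_at g x.
Proof.
move=> /nbhs_interior fg [U [oU Ux sf]].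
have oU' : open (U `&` [set y | f y = g y]^°) by apply: openI => //; exact: open_interior.
exists (U `&` [set y | f y = g y]^°); split=> //.
  by split=> //; exact: nbhs_singleton fg.
move=> r; apply: (class_C_ext (f := f)) => // [y [_ /interior_subset]//|].
by apply: class_C_sub (sf r) => y [].
Qed.

Lemma smooth_at_differentiable f x : smooth_at f x -> differentiable f x.
Proof. by move=> [U [_ Ux /(_ 1)[df _]]]; exact: df. Qed.

Lemma smooth_at_continuous f x : smooth_at f x -> {for x, continuous f}.
Proof. by move=> /smooth_at_differentiable; exact: differentiable_continuous. Qed.

Lemma smooth_at_derive f x v : smooth_at f x -> smooth_at ('D_v f) x.
Proof.
move=> [U [oU Ux sf]]; exists U; split=> // r; exact: (sf r.+1).2.
Qed.

Lemma smooth_at_cst (w : W) x : smooth_at (cst w) x.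
Proof. by exists setT; split=> //; [exact: openT|move=> r; exact: class_C_cst]. Qed.

Lemma smooth_atD f g x : smooth_at f x -> smooth_at g x -> smooth_at (fun y => f y + g y) x.
Proof.
move=> [U [oU Ux sf]] [U' [oU' Ux' sg]]; exists (U `&` U').
have oI := openI oU oU'; split=> // r; apply: class_CD => //.
  by apply: class_C_sub (sf r) => y [].
by apply: class_C_sub (sg r) => y [].
Qed.

Lemma smooth_at_sum (I : Type) (s : seq I) (F : I -> V -> W) x :
  (forall i, smooth_at (F i) x) -> smooth_at (fun y => \sum_(i <- s) F i y) x.
Proof.
move=> sF; elim: s => [|i s IH].
  by under [X in smooth_at X]funext do rewrite big_nil; exact: smooth_at_cst.
by under [X in smooth_at X]funext do rewrite big_cons; exact: smooth_atD.
Qed.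

Lemma smooth_atZ (k : R) f x : smooth_at f x -> smooth_at (fun y => k *: f y) x.
Proof. by move=> [U [oU Ux sf]]; exists U; split=> // r; exact: class_CZ. Qed.

End general_codomain.

Lemma smooth_atM (f g : V -> R) x :
  smooth_at f x -> smooth_at g x -> smooth_at (fun y => f y * g y) x.
Proof.
move=> [U [oU Ux sf]] [U' [oU' Ux' sg]]; exists (U `&` U').
have oI := openI oU oU'; split=> // r; apply: class_CM => //.
  by apply: class_C_sub (sf r) => y [].
by apply: class_C_sub (sg r) => y [].
Qed.

Lemma smooth_at_mulmx m n p (f : V -> 'M[R]_(m, n)) (g : V -> 'M[R]_(n, p)) x :
  smooth_at f x -> smooth_at g x -> smooth_at (fun y => f y *m g y) x.
Proof.
move=> [U [oU Ux sf]] [U' [oU' Ux' sg]]; exists (U `&` U').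
have oI := openI oU oU'; split=> // r; apply: class_C_mulmx => //.
  by apply: class_C_sub (sf r) => y [].
by apply: class_C_sub (sg r) => y [].
Qed.

Lemma smooth_at_trmx m n (f : V -> 'M[R]_(m, n)) x :
  smooth_at f x -> smooth_at (fun y => (f y)^T) x.
Proof. by move=> [U [oU Ux sf]]; exists U; split=> // r; exact: class_C_trmx. Qed.

Lemma smooth_at_mxP m n (f : V -> 'M[R]_(m, n)) x :
  smooth_at f x -> forall i j, smooth_at (fun y => f y i j) x.
Proof.
move=> [U [oU Ux sf]] i j; exists U; split=> // r.
by have /(class_C_mxP _ _ oU) := sf r.
Qed.

End smooth_at.

Section smooth_at_comp.
Variables (R : realType) (V : normedModType R) (n : nat).

Lemma smooth_at_comp_dom (W : normedModType R) (f : V -> 'rV[R]_n) (g : 'rV[R]_n -> W) x :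
  smooth_at f x -> smooth_at g (f x) -> exists U U', [/\ open U, open U', U x,
    f @` U `<=` U' & smooth_on U f /\ smooth_on U' g].
Proof.
move=> [U [oU Ux sf]] [U' [oU' Ux' sg]].
have cf y : U y -> {for y, continuous f}.
  by move=> Uy; apply: smooth_at_continuous; exists U.
exists (U `&` f @^-1` U'), U'; split=> //.
- rewrite openE => y [Uy Ufy]; apply: filterI; first exact: open_nbhs_nbhs.
  by apply: (cf y Uy); exact: open_nbhs_nbhs.
- by move=> _ [y [_ Uy] <-].
- by split=> // r; apply: class_C_sub (sf r) => y [].
Qed.

Lemma smooth_at_comp m p (f : V -> 'rV[R]_n) (g : 'rV[R]_n -> 'M[R]_(m, p)) x :
  smooth_at f x -> smooth_at g (f x) -> smooth_at (g \o f) x.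
Proof.
move=> sf sg; have [U [U' [oU oU' Ux fU [sfU sgU]]]] := smooth_at_comp_dom sf sg.
by exists U; split=> // r; exact: class_C_comp (sfU r) (sgU r).
Qed.

Lemma smooth_at_id (x : 'rV[R]_n) : smooth_at id x.
Proof. by exists setT; split=> //; [exact: openT|move=> r; exact: class_C_id openT]. Qed.

Lemma smooth_at_mulmxr m (A : 'M[R]_(n, m)) x : smooth_at (fun x : 'rV_n => x *m A) x.
Proof. by exists setT; split=> //; [exact: openT|move=> r; exact: class_C_mulmxr openT]. Qed.

Lemma smooth_at_jacobian m (f : 'rV[R]_n -> 'rV[R]_m) x :
  smooth_at f x -> smooth_at (jacobian f) x.
Proof.
by move=> [U [oU Ux sf]]; exists U; split=> // r; exact: class_C_jacobian (sf r.+1).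
Qed.

Lemma diff_mulmxr m (A : 'M[R]_(n, m)) (x v : 'rV[R]_n) :
  'd (fun x => x *m A) x v = v *m A.
Proof.
have cA : continuous (mulmxr A : 'rV[R]_n -> 'rV[R]_m).
  by move=> y; apply: smooth_at_continuous; exact: smooth_at_mulmxr.
by have -> : (fun x : 'rV[R]_n => x *m A) = mulmxr A by []; rewrite diff_lin.
Qed.

End smooth_at_comp.

Lemma near_eq_diff (R : realType) (V W : normedModType R) (f g : V -> W) x v :
  (\near x, f x = g x) -> differentiable f x -> 'd f x v = 'd g x v.
Proof.
move=> fg df; have dg := near_eq_differentiable fg df.
by rewrite -(deriveE _ df) -(deriveE _ dg); exact: near_eq_derive.
Qed.

(** * Manifold charts, smooth maps and differentials *)

Section mchart_theory.
Variables (R : realType) (n : nat) (T : topologicalType) (c : mchart R n T).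

Lemma mc_img_fwd p : mc_dom c p -> mc_img c (mc_fwd c p).
Proof. by move=> cp; exists p. Qed.

Lemma mc_dom_bwd x : mc_img c x -> mc_dom c (mc_bwd c x).
Proof. by move=> [p cp <-]; rewrite mc_fwdK. Qed.

Lemma mc_bwdK x : mc_img c x -> mc_fwd c (mc_bwd c x) = x.
Proof. by move=> [p cp <-]; rewrite mc_fwdK. Qed.

Lemma near_mc_bwd (P : T -> Prop) p : mc_dom c p ->
  (\near p, P p) -> \forall x \near mc_fwd c p, P (mc_bwd c x).
Proof.
move=> cp Pp; apply: (@mc_bwd_cont _ _ _ c _ (mc_img_fwd cp)).
by rewrite mc_fwdK.
Qed.

Lemma near_mc_fwd (P : 'rV[R]_n -> Prop) p : mc_dom c p ->
  (\forall x \near mc_fwd c p, P x) -> \forall q \near p, P (mc_fwd c q).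
Proof. by move=> cp; exact: (@mc_fwd_cont _ _ _ c _ cp). Qed.

Lemma near_mc_dom p : mc_dom c p -> \near p, mc_dom c p.
Proof. by move=> cp; apply: open_nbhs_nbhs; split=> //; exact: mc_dom_open. Qed.

Lemma near_mc_img p : mc_dom c p -> \forall x \near mc_fwd c p, mc_img c x.
Proof.
move=> cp; apply: open_nbhs_nbhs; split; [exact: mc_img_open|exact: mc_img_fwd].
Qed.

Lemma mc_fwd_open (U : set T) : open U -> U `<=` mc_dom c -> open (mc_fwd c @` U).
Proof.
move=> oU Uc; rewrite openE => _ [p Up <-]; have cp := Uc _ Up.
have : \forall x \near mc_fwd c p, U (mc_bwd c x).
  by apply: near_mc_bwd => //; exact: open_nbhs_nbhs.
apply: filterS2 (near_mc_img cp) => x cx Ux.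
by exists (mc_bwd c x) => //; exact: mc_bwdK.
Qed.

Lemma mc_bwd_open (U : set 'rV[R]_n) : open U -> U `<=` mc_img c -> open (mc_bwd c @` U).
Proof.
move=> oU Uc; rewrite openE => _ [x Ux <-].
have cx := mc_dom_bwd (Uc _ Ux).
have : \forall q \near mc_bwd c x, U (mc_fwd c q).
  apply: near_mc_fwd => //; rewrite mc_bwdK; last exact: Uc.
  exact: open_nbhs_nbhs.
apply: filterS2 (near_mc_dom cx) => q cq Uq.
by exists (mc_fwd c q) => //; exact: mc_fwdK.
Qed.

End mchart_theory.

Section manifold.
Variables (R : realType) (n : nat) (T : topologicalType) (M : smooth_manifold R n T).

Lemma mf_atlas_chart_at p : mf_atlas M (chart_at M p).
Proof. by rewrite /chart_at; case: cid => c []. Qed.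

Lemma mc_dom_chart_at p : mc_dom (chart_at M p) p.
Proof. by rewrite /chart_at; case: cid => c []. Qed.

Lemma smooth_transition c d p : mf_atlas M c -> mf_atlas M d ->
  mc_dom c p -> mc_dom d p -> smooth_at (mc_fwd d \o mc_bwd c) (mc_fwd c p).
Proof.
move=> Mc Md cp dp; apply: (smooth_on_at _ (mf_compat Mc Md)); last by exists p.
apply: mc_fwd_open; last by move=> q [].
by apply: openI; exact: mc_dom_open.
Qed.

End manifold.

Lemma near_diff_comp (R : realType) (U V W : normedModType R) (f : U -> V) (g : V -> W)
    (h : U -> W) x y v : differentiable f x -> f x = y -> differentiable g y ->
  (\near x, (g \o f) x = h x) -> 'd h x v = 'd g y ('d f x v).
Proof.
move=> df <- dg gfh; rewrite -(near_eq_diff _ gfh); last exact: differentiable_comp.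
by rewrite diff_comp.
Qed.

Section msmooth.
Variables (R : realType) (m n : nat) (S T : topologicalType).
Variables (M : smooth_manifold R m S) (N : smooth_manifold R n T).
Implicit Types (f g : S -> T) (p : S).

Definition in_charts (c : mchart R m S) (d : mchart R n T) f := mc_fwd d \o f \o mc_bwd c.

(** Asked in a single pair of charts, which makes it easy to establish; [msmooth_in_charts]
    transfers it to every pair by composing with transition maps. *)
Definition msmooth f p := {for p, continuous f} /\ exists c d,
  [/\ mf_atlas M c, mf_atlas N d, mc_dom c p, mc_dom d (f p) &
      smooth_at (in_charts c d f) (mc_fwd c p)].

Lemma msmooth_in_charts f p c d : msmooth f p -> mf_atlas M c -> mf_atlas N d ->
  mc_dom c p -> mc_dom d (f p) -> smooth_at (in_charts c d f) (mc_fwd c p).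
Proof.
move=> [cf [c0 [d0 [Mc0 Nd0 c0p d0p sf]]]] Mc Nd cp dp.
have s1 := smooth_transition Mc Mc0 cp c0p.
have s2 := smooth_transition Nd0 Nd d0p dp.
have e1 : (mc_fwd c0 \o mc_bwd c) (mc_fwd c p) = mc_fwd c0 p by rewrite /= mc_fwdK.
have s12 : smooth_at (in_charts c0 d0 f \o (mc_fwd c0 \o mc_bwd c)) (mc_fwd c p).
  by apply: smooth_at_comp => //; rewrite e1.
have e2 : (in_charts c0 d0 f \o (mc_fwd c0 \o mc_bwd c)) (mc_fwd c p) = mc_fwd d0 (f p).
  by rewrite /comp /in_charts /= !mc_fwdK.
have s123 : smooth_at ((mc_fwd d \o mc_bwd d0) \o
    (in_charts c0 d0 f \o (mc_fwd c0 \o mc_bwd c))) (mc_fwd c p).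
  by apply: smooth_at_comp => //; rewrite e2.
apply: near_eq_smooth_at s123.
have h1 : \forall x \near mc_fwd c p, mc_dom c0 (mc_bwd c x).
  by apply: near_mc_bwd => //; exact: near_mc_dom.
have h2 : \forall x \near mc_fwd c p, mc_dom d0 (f (mc_bwd c x)).
  by apply: (near_mc_bwd (P := fun q => mc_dom d0 (f q))) => //; apply: cf; exact: near_mc_dom.
by apply: filterS2 h1 h2 => x h1 h2; rewrite /comp /in_charts /= !mc_fwdK.
Qed.

Lemma smooth_mapP (W : set S) f : open W ->
  smooth_map M N W f <-> forall p, W p -> msmooth f p.
Proof.
move=> oW; split=> [[cf sf] p Wp|H].
  split; first exact: cf.
  exists (chart_at M p), (chart_at N (f p)); split.
  - exact: mf_atlas_chart_at.
  - exact: mf_atlas_chart_at.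
  - exact: mc_dom_chart_at.
  - exact: mc_dom_chart_at.
  have Mc := mf_atlas_chart_at M p; have Nd := mf_atlas_chart_at N (f p).
  apply: (smooth_on_at _ (sf _ _ Mc Nd)); last first.
    by exists p => //; split; [split=> //; exact: mc_dom_chart_at|exact: mc_dom_chart_at].
  apply: mc_fwd_open; last by move=> q [[]].
  rewrite openE => q [[Wq cq] dq].
  apply: filterI; first by apply: filterI; [exact: open_nbhs_nbhs|exact: near_mc_dom].
  by apply: (cf q Wq); exact: near_mc_dom.
split=> [p /H[]//|c d Mc Nd]; apply: smooth_at_on => _ [p [[Wp cp] dp] <-].
exact: msmooth_in_charts (H _ Wp) Mc Nd cp dp.
Qed.

Lemma msmooth_continuous f p : msmooth f p -> {for p, continuous f}.
Proof. by case. Qed.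

Lemma near_eq_msmooth f g p : (\near p, f p = g p) -> msmooth f p -> msmooth g p.
Proof.
move=> fg [cf [c [d [Mc Nd cp dp sf]]]]; have fgp : f p = g p by exact: nbhs_singleton fg.
split.
  suff : g @ p --> f p by rewrite fgp.
  by apply: cvg_trans cf; apply: near_eq_cvg.
exists c, d; split=> //; first by rewrite -fgp.
apply: near_eq_smooth_at sf.
have := near_mc_bwd cp fg; apply: filterS => x.
by rewrite /in_charts /= => ->.
Qed.

Lemma mdiffE f p v : msmooth f p ->
  mdiff M N f p v = 'D_v (in_charts (chart_at M p) (chart_at N (f p)) f) (mc_fwd (chart_at M p) p).
Proof.
move=> sf; rewrite deriveE//; apply: smooth_at_differentiable.
apply: msmooth_in_charts => //; first exact: mf_atlas_chart_at.
- exact: mf_atlas_chart_at.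
- exact: mc_dom_chart_at.
- exact: mc_dom_chart_at.
Qed.

Lemma msmooth_chart_at f p : msmooth f p ->
  smooth_at (in_charts (chart_at M p) (chart_at N (f p)) f) (mc_fwd (chart_at M p) p).
Proof.
move=> sf; apply: msmooth_in_charts => //.
- exact: mf_atlas_chart_at.
- exact: mf_atlas_chart_at.
- exact: mc_dom_chart_at.
- exact: mc_dom_chart_at.
Qed.

Lemma near_eq_mdiff f g p v : (\near p, f p = g p) -> msmooth f p ->
  mdiff M N f p v = mdiff M N g p v.
Proof.
move=> fg sf; have fgp : f p = g p by exact: nbhs_singleton fg.
rewrite /mdiff -fgp; apply: near_eq_diff; last first.
  exact/smooth_at_differentiable/msmooth_chart_at.
by have := near_mc_bwd (mc_dom_chart_at M p) fg; apply: filterS => x /= ->.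
Qed.

End msmooth.

Section msmooth_comp.
Variables (R : realType) (m n k : nat) (S T U : topologicalType).
Variables (M : smooth_manifold R m S) (N : smooth_manifold R n T).
Variable P : smooth_manifold R k U.

Lemma in_charts_comp (f : S -> T) (g : T -> U) (c : mchart R m S) (d : mchart R n T)
    (e : mchart R k U) p : {for p, continuous f} ->
  mc_dom c p -> mc_dom d (f p) ->
  \forall x \near mc_fwd c p, (in_charts d e g \o in_charts c d f) x = in_charts c e (g \o f) x.
Proof.
move=> cf cp dp.
have h : \forall x \near mc_fwd c p, mc_dom d (f (mc_bwd c x)).
  by apply: (near_mc_bwd (P := fun q => mc_dom d (f q))) => //; apply: cf; exact: near_mc_dom.
by apply: filterS h => x h; rewrite /in_charts /= mc_fwdK.
Qed.

Lemma msmooth_comp (f : S -> T) (g : T -> U) p :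
  msmooth M N f p -> msmooth N P g (f p) -> msmooth M P (g \o f) p.
Proof.
move=> sf sg; have [cf _] := sf; have [cg _] := sg; split.
  exact: continuous_comp.
have Mc := mf_atlas_chart_at M p; have Nd := mf_atlas_chart_at N (f p).
have Pe := mf_atlas_chart_at P (g (f p)).
have cp := mc_dom_chart_at M p; have dp := mc_dom_chart_at N (f p).
have ep := mc_dom_chart_at P (g (f p)).
exists (chart_at M p), (chart_at P (g (f p))); split=> //.
apply: near_eq_smooth_at (in_charts_comp g (chart_at P (g (f p))) cf cp dp) _.
apply: smooth_at_comp; first exact: (msmooth_in_charts sf Mc Nd cp dp).
by rewrite {2}/in_charts /= (mc_fwdK cp); exact: (msmooth_in_charts sg Nd Pe dp ep).
Qed.

(** Both differentials on the right use the same preferred chart at [f p], so it cancels and the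
    ordinary chain rule applies. *)
Lemma mdiff_comp (f : S -> T) (g : T -> U) p v :
  msmooth M N f p -> msmooth N P g (f p) ->
  mdiff M P (g \o f) p v = mdiff N P g (f p) (mdiff M N f p v).
Proof.
move=> sf sg; have [cf _] := sf.
have cp := mc_dom_chart_at M p; have dp := mc_dom_chart_at N (f p).
have E := in_charts_comp g (chart_at P (g (f p))) cf cp dp.
have s1 := msmooth_chart_at sf; have s2 := msmooth_chart_at sg.
have e : in_charts (chart_at M p) (chart_at N (f p)) f (mc_fwd (chart_at M p) p)
    = mc_fwd (chart_at N (f p)) (f p) by rewrite /in_charts /= (mc_fwdK cp).
rewrite /mdiff.
exact: (near_diff_comp v (smooth_at_differentiable s1) e (smooth_at_differentiable s2) E).
Qed.

End msmooth_comp.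

Section msmooth_id.
Variables (R : realType) (n : nat) (T : topologicalType) (M : smooth_manifold R n T).

Lemma near_in_charts_id (c : mchart R n T) p : mc_dom c p -> \forall x \near mc_fwd c p, x = in_charts c c id x.
Proof.
move=> cp; apply: filterS (near_mc_img cp) => x cx.
by rewrite /in_charts /= mc_bwdK.
Qed.

Lemma msmooth_id p : msmooth M M id p.
Proof.
split; first exact: cvg_id.
have Mc := mf_atlas_chart_at M p; have cp := mc_dom_chart_at M p.
exists (chart_at M p), (chart_at M p); split=> //.
by apply: near_eq_smooth_at (near_in_charts_id cp) _; exact: smooth_at_id.
Qed.

Lemma mdiff_id p v : mdiff M M id p v = v.
Proof.
have cp := mc_dom_chart_at M p.
rewrite (mdiffE _ (msmooth_id p)) -(near_eq_derive v (near_in_charts_id cp)).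
exact: derive_id.
Qed.

End msmooth_id.

Section rV_manifold.
Variables (R : realType) (n : nat).

Let setT_open : open [set: 'rV[R]_n]. Proof. exact: openT. Qed.
Let img_open : open (id @` [set: 'rV[R]_n]). Proof. by rewrite image_id. Qed.
Let idK (p : 'rV[R]_n) : setT p -> id (id p) = p. Proof. by []. Qed.
Let id_cont (p : 'rV[R]_n) : setT p -> {for p, continuous id}.
Proof. by move=> _; exact: cvg_id. Qed.
Let id_cont' (p : 'rV[R]_n) : (id @` setT) p -> {for p, continuous id}.
Proof. by move=> _; exact: cvg_id. Qed.

Definition rV_chart : mchart R n 'rV[R]_n := MChart setT_open img_open idK id_cont id_cont'.

Let rV_cover (p : 'rV[R]_n) : exists c, [set rV_chart] c /\ mc_dom c p.
Proof. by exists rV_chart. Qed.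

Let rV_compat c d : [set rV_chart] c -> [set rV_chart] d ->
  smooth_on (mc_fwd c @` (mc_dom c `&` mc_dom d)) (mc_fwd d \o mc_bwd c).
Proof. by move=> -> ->; apply: smooth_at_on => x _; exact: smooth_at_id. Qed.

(** The atlas is a singleton, so the preferred chart is forced to be the identity and [mdiff]
    reduces to the ordinary differential. *)
Definition rV_mfd : smooth_manifold R n 'rV[R]_n :=
  SmoothManifold (@norm_hausdorff _ _) (@rV_paracompact R n) rV_cover rV_compat.

Lemma chart_at_rV x : chart_at rV_mfd x = rV_chart.
Proof. exact: (mf_atlas_chart_at rV_mfd x). Qed.

End rV_manifold.

Section msmooth_rV.
Variables (R : realType) (m n : nat).

Lemma msmooth_rVP (f : 'rV[R]_m -> 'rV[R]_n) x :
  msmooth (rV_mfd R m) (rV_mfd R n) f x <-> smooth_at f x.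
Proof.
split=> [sf|sf].
  have := @msmooth_in_charts _ _ _ _ _ _ _ _ _ (rV_chart R m) (rV_chart R n) sf.
  by apply.
split; first exact: smooth_at_continuous.
by exists (rV_chart R m), (rV_chart R n).
Qed.

Lemma mdiff_rV (f : 'rV[R]_m -> 'rV[R]_n) x v :
  mdiff (rV_mfd R m) (rV_mfd R n) f x v = 'd f x v.
Proof. by rewrite /mdiff !chart_at_rV. Qed.

Variables (T : topologicalType) (M : smooth_manifold R n T).

Lemma msmooth_fwd c p : mf_atlas M c -> mc_dom c p -> msmooth M (rV_mfd R n) (mc_fwd c) p.
Proof.
move=> Mc cp; split; first exact: mc_fwd_cont.
exists c, (rV_chart R n); split=> //.
have := near_in_charts_id cp => h.
by apply: near_eq_smooth_at h _; exact: smooth_at_id.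
Qed.

Lemma msmooth_bwd c x : mf_atlas M c -> mc_img c x -> msmooth (rV_mfd R n) M (mc_bwd c) x.
Proof.
move=> Mc cx; split; first exact: mc_bwd_cont.
exists (rV_chart R n), c; split=> //; first exact: mc_dom_bwd.
have h : \forall y \near x, y = in_charts (rV_chart R n) c (mc_bwd c) y.
  have : \forall y \near x, mc_img c y by apply: open_nbhs_nbhs; split=> //; exact: mc_img_open.
  by apply: filterS => y cy; rewrite /in_charts /= mc_bwdK.
by apply: near_eq_smooth_at h _; exact: smooth_at_id.
Qed.

End msmooth_rV.

Lemma near_finite (T : topologicalType) (I : choiceType) (A : set I) (P : I -> T -> Prop) (x : T) :
  finite_set A -> (forall i, A i -> \near x, P i x) -> \forall y \near x, forall i, A i -> P i y.
Proof.
move=> /finite_fsetP[F ->] AP.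
have := @filter_bigI _ _ F (fun i => [set y | P i y]) (nbhs x) _ AP.
by move=> /(_ _); apply: filterS => y Py i iF; exact: Py.
Qed.

Section connectedness.
Variables (R : realType).

Lemma connected_ball (V : normedModType R) (x : V) (r : R) : connected (ball x r).
Proof.
have [r0|r0] := leP r 0.
  rewrite (_ : ball x r = set0); first exact: connected0.
  rewrite -subset0 => y; rewrite -ball_normE /= => /(le_lt_trans (normr_ge0 _)).
  by rewrite ltNge r0.
pose sg (y : V) := (fun t : R => x + t *: (y - x)) @` `[0, 1]%classic.
have -> : ball x r = \bigcup_(y in ball x r) sg y.
  apply/seteqP; split=> [y xy|z [y xy [t t01 <-]]].
    exists y => //; exists 1; first by rewrite /= in_itv /= lexx ler01.
    by rewrite scale1r addrC subrK.
  by apply: ball_segment; [exact: xy|exact: ballxx|move: t01; rewrite /= in_itv].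
apply: bigcup_connected.
  exists x => y _; exists 0; first by rewrite /= in_itv /= lexx ler01.
  by rewrite scale0r addr0.
move=> y _; apply: connected_continuous_connected; first exact: segment_connected.
apply: continuous_subspaceT => t.
have -> : (fun t : R => x + t *: (y - x)) = cst x \+ (fun t => t *: (y - x)) by [].
by apply: continuousD; [exact: cst_continuous|exact: scalel_continuous].
Qed.

(** Changes of charts must have connected domains; a coordinate ball provides one inside any
    neighbourhood. *)
Lemma manifold_connected_nbhd n (T : topologicalType) (M : smooth_manifold R n T)
    (W : set T) x : open W -> W x -> exists W0, [/\ open W0, connected W0, W0 x & W0 `<=` W].
Proof.
move=> oW Wx; set c := chart_at M x.
have cx : mc_dom c x by exact: mc_dom_chart_at.
have h : \forall y \near mc_fwd c x, W (mc_bwd c y).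
  by apply: near_mc_bwd => //; exact: open_nbhs_nbhs.
have /nbhs_ballP[r /= r0 rB] : \forall y \near mc_fwd c x, W (mc_bwd c y) /\ mc_img c y.
  exact: filterI h (near_mc_img cx).
exists (mc_bwd c @` ball (mc_fwd c x) r); split.
- by apply: mc_bwd_open; [exact: ball_open|move=> y /rB[]].
- apply: connected_continuous_connected; first exact: connected_ball.
  by apply: continuous_in_subspaceT => y /set_mem/rB[_]; exact: mc_bwd_cont.
- by exists (mc_fwd c x); [exact: ballxx|exact: mc_fwdK].
- by move=> _ [y /rB[Wy _] <-].
Qed.

End connectedness.

Section diffeo.
Variables (R : realType) (n : nat) (S T U : topologicalType).
Variables (M : smooth_manifold R n S) (N : smooth_manifold R n T) (P : smooth_manifold R n U).

Lemma diffeo_intro (W : set S) (V : set T) (h : S -> T) (h' : T -> S) :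
  open W -> open V -> h @` W `<=` V -> h' @` V `<=` W ->
  (forall p, W p -> h' (h p) = p) -> (forall q, V q -> h (h' q) = q) ->
  (forall p, W p -> msmooth M N h p) -> (forall q, V q -> msmooth N M h' q) ->
  diffeo_on M N W h.
Proof.
move=> oW oV hW hV hK hK' sh sh'.
have E : h @` W = V.
  by apply/seteqP; split=> // q Vq; exists (h' q); [apply: hV; exists q|exact: hK'].
split=> //; [by rewrite E|exact/smooth_mapP|].
by exists h'; split=> //; rewrite E; exact/smooth_mapP.
Qed.

Lemma diffeo_elim (W : set S) (h : S -> T) : diffeo_on M N W h -> exists h' : T -> S,
  [/\ open W, open (h @` W), (forall p, W p -> h' (h p) = p),
      (forall p, W p -> msmooth M N h p) & (forall q, (h @` W) q -> msmooth N M h' q)].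
Proof.
move=> [oW oV sh [h' [sh' hK]]]; exists h'; split=> //; exact/smooth_mapP.
Qed.

Lemma diffeo_sub (W W0 : set S) (h : S -> T) : diffeo_on M N W h -> open W0 -> W0 `<=` W ->
  diffeo_on M N W0 h.
Proof.
move=> /diffeo_elim[h' [oW oV hK sh sh']] oW0 W0W.
have hW q : (h @` W0) q -> (h @` W) q by move=> [p /W0W Wp <-]; exists p.
have E : h @` W0 = h @` W `&` h' @^-1` W0.
  apply/seteqP; split=> [q W0q|q [[p Wp <-]]]; last by rewrite /= hK// => W0p; exists p.
  by split; [exact: hW|case: W0q => p W0p <-; rewrite /= hK//; exact: W0W].
apply: (@diffeo_intro W0 (h @` W0) h h') => //.
- rewrite E openE => q [Wq W0q]; apply: filterI; first exact: open_nbhs_nbhs.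
  by apply: (msmooth_continuous (sh' q Wq)); exact: open_nbhs_nbhs.
- by move=> _ [_ [p W0p <-] <-]; rewrite hK//; exact: W0W.
- by move=> p /W0W; exact: hK.
- by move=> _ [p W0p <-]; rewrite hK//; exact: W0W.
- by move=> p /W0W; exact: sh.
- by move=> q /hW; exact: sh'.
Qed.

Lemma mdiff_diffeo_inj (W : set S) (h : S -> T) p : diffeo_on M N W h -> W p ->
  injective (mdiff M N h p).
Proof.
move=> /diffeo_elim[h' [oW oV hK sh sh']] Wp u v e.
have hh : \near p, p = (h' \o h) p.
  by apply: filterS (open_nbhs_nbhs (conj oW Wp)) => q /hK.
have sc : msmooth N M h' (h p) by apply: sh'; exists p.
have E w : mdiff N M h' (h p) (mdiff M N h p w) = w.
  rewrite -(mdiff_comp _ (sh _ Wp) sc) -(near_eq_mdiff _ hh); first exact: mdiff_id.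
  exact: msmooth_id.
exact: etrans (esym (E u)) (etrans (congr1 _ e) (E v)).
Qed.

End diffeo.

(** * Finite groups acting on orbifold charts *)

Section orbichart_theory.
Variables (R : realType) (n : nat) (Q : topologicalType) (c : orbichart R n Q).
Implicit Types (x y : oc_space c) (a b : oc_space c -> oc_space c).

Lemma group_msmooth a x : oc_group c a -> msmooth (oc_mfd c) (oc_mfd c) a x.
Proof. by move=> /oc_group_smooth/smooth_mapP; apply=> //; exact: openT. Qed.

Lemma group_continuous a : oc_group c a -> continuous a.
Proof. by move=> Ga x; exact: msmooth_continuous (group_msmooth x Ga). Qed.

Lemma proj_group a x : oc_group c a -> oc_proj c (a x) = oc_proj c x.
Proof. by move=> Ga; apply/esym/oc_fiber; exists a. Qed.

Lemma proj_continuous : continuous (oc_proj c).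
Proof.
apply/continuousP => V oV.
have oVr : open (V `&` range (oc_proj c)) by apply: openI => //; exact: oc_open.
have -> : oc_proj c @^-1` V = oc_proj c @^-1` (V `&` range (oc_proj c)).
  by apply/seteqP; split=> z /= => [Vz|[]//]; split=> //; exists z.
have h : V `&` range (oc_proj c) `<=` range (oc_proj c) by move=> z [].
exact: ((oc_quotient h).1 oVr).
Qed.

(** The saturation of [U] is the union of its preimages under the group elements, and openness is
    tested upstairs. *)
Lemma proj_open (U : set (oc_space c)) : open U -> open (oc_proj c @` U).
Proof.
move=> oU; apply/oc_quotient; first by move=> _ [x _ <-]; exists x.
have -> : oc_proj c @^-1` (oc_proj c @` U) = \bigcup_(a in oc_group c) a @^-1` U.
  apply/seteqP; split=> [x [u Uu /esym/oc_fiber[a Ga ax]]|x [a Ga Ux]].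
    by exists a => //; rewrite /= ax.
  by exists (a x) => //; exact: proj_group.
apply: bigcup_open => a Ga; move/continuousP: (group_continuous Ga); exact.
Qed.

Lemma isotropy_group a x : isotropy x a -> oc_group c a.
Proof. by case. Qed.

Lemma isotropy_id x : isotropy x id.
Proof. by split=> //; exact: oc_group_id. Qed.

Lemma isotropy_comp x a b : isotropy x a -> isotropy x b -> isotropy x (a \o b).
Proof.
move=> [Ga ax] [Gb bx]; split; first exact: oc_group_comp.
by rewrite /= bx.
Qed.

Lemma isotropy_inv x a : isotropy x a ->
  exists b, [/\ isotropy x b, cancel a b & cancel b a].
Proof.
move=> [Ga ax]; have [b [Gb ab ba]] := oc_group_inv Ga; exists b; split=> //.
by split=> //; rewrite -{1}ax ab.
Qed.

Lemma isotropy_finite x : finite_set (isotropy x).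
Proof. by apply: sub_finite_set (oc_group_fin c) => a []. Qed.

Lemma isotropy_enum x : exists2 s : seq (oc_space c -> oc_space c), uniq s & isotropy x = [set` s].
Proof.
have /finite_seqP[s sE] := isotropy_finite x; exists (undup s); first exact: undup_uniq.
by rewrite sE; apply/seteqP; split=> a /=; rewrite mem_undup.
Qed.

(** Hausdorff separation of [x] from each of its finitely many other translates gives a
    neighbourhood [V] disjoint from its images under the elements moving [x]. *)
Lemma isotropy_nbhd_exists x (N : set (oc_space c)) : nbhs x N ->
  exists2 W, isotropy_nbhd x W & W `<=` N.
Proof.
move=> xN.
have hT := mf_hausdorff (oc_mfd c).
have hV a : exists U, oc_group c a -> a x <> x -> [/\ open U, U x & a @` U `&` U = set0].
  have [[Ga nax]|h] := pselect (oc_group c a /\ a x <> x); last first.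
    by exists setT => Ga nax; case: h.
  have xax : x != a x by apply/eqP => e; apply: nax.
  move: hT; rewrite open_hausdorff => /(_ x (a x) xax).
  move=> [[A B] /= [/set_mem Ax /set_mem Bax] [oA oB AB]].
  exists (A `&` a @^-1` B) => _ _; split=> //.
    by apply: openI => //; move/continuousP: (group_continuous Ga); exact.
  rewrite -subset0 => z [[u [_ Bu] <-] [Aau _]].
  by have : (A `&` B) (a u) by []; rewrite (eqP AB).
have [U UP] := choice hV.
have xU : \forall y \near x, forall a, oc_group c a -> a x <> x -> U a y.
  apply: (near_finite (P := fun a y => a x <> x -> U a y)) (oc_group_fin c) _ => a Ga.
  have [ax|nax] := pselect (a x = x); first by apply: nearW.
  have [oU Ux _] := UP a Ga nax.
  by apply: filterS (open_nbhs_nbhs (conj oU Ux)).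
pose V := (N `&` [set y | forall a, oc_group c a -> a x <> x -> U a y])^°.
have Vx : V x by exact: filterI.
have oV : open V by exact: open_interior.
have VU y : V y -> N y /\ forall a, oc_group c a -> a x <> x -> U a y.
  by move=> /interior_subset.
(* The intersection of the preimages of [V] under the isotropy group is stable under that group, and
   open because the group is finite. *)
pose W := [set y | forall b, isotropy x b -> V (b y)].
have WV : W `<=` V by move=> y /(_ id (isotropy_id x)).
have aW a : isotropy x a -> a @` W `<=` W.
  by move=> ia _ [y Wy <-] b ib; exact: (Wy (b \o a) (isotropy_comp ib ia)).
exists W; last by move=> y /WV/VU[].
split=> //.
- rewrite openE => y Wy; apply: (near_finite (P := fun b z => V (b z))).
    exact: isotropy_finite.
  move=> b ib; apply: (group_continuous ib.1); apply: open_nbhs_nbhs.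
  by split=> //; exact: Wy.
- by move=> b [_ bx]; rewrite bx.
- move=> a ia; apply/seteqP; split; first exact: aW.
  have [b [ib ab ba]] := isotropy_inv ia.
  by move=> y Wy; exists (b y); [apply: (aW _ ib); exists y|exact: ba].
- move=> a Ga nax; have [_ _ aU] := UP a Ga nax.
  rewrite -subset0 => z [[y /WV/VU[_ Vy] <-] /WV/VU[_ Vay]].
  have : (a @` U a `&` U a) (a y) by split; [exists y => //; exact: Vy|exact: Vay].
  by rewrite aU.
Qed.

End orbichart_theory.

(** * Maps agreeing on open sets that accumulate at a point *)

Lemma mdiff_comp_at (R : realType) (m n k : nat) (S T U : topologicalType)
    (M : smooth_manifold R m S) (N : smooth_manifold R n T) (P : smooth_manifold R k U)
    (f : S -> T) (g : T -> U) p q v : f p = q ->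
  msmooth M N f p -> msmooth N P g q ->
  mdiff M P (g \o f) p v = mdiff N P g q (mdiff M N f p v).
Proof. by move=> <-; exact: mdiff_comp. Qed.

(** The derivatives coincide at the points [y], which come arbitrarily close to [x], and both are
    continuous at [x]. *)
Lemma diff_eq_frequently (R : realType) (V W : normedModType R) (f g : V -> W) x v :
  smooth_at f x -> smooth_at g x ->
  (forall U, nbhs x U -> exists2 y, U y & \forall z \near y, f z = g z) ->
  'd f x v = 'd g x v.
Proof.
move=> sf sg H.
rewrite -(deriveE _ (smooth_at_differentiable sf)) -(deriveE _ (smooth_at_differentiable sg)).
have c1 := smooth_at_continuous (smooth_at_derive v sf).
have c2 := smooth_at_continuous (smooth_at_derive v sg).
pose D y := `|'D_v f y - 'D_v g y|.
have cD : {for x, continuous D}.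
  apply: (@continuous_comp _ _ _ (fun y => 'D_v f y - 'D_v g y) (fun z : W => `|z|)).
    exact: continuousB.
  exact: norm_continuous.
apply/eqP; apply: contrapT => /negP ne.
have Dx : D x != 0 by rewrite normr_eq0 subr_eq0.
have [y Dy fg] : exists2 y, D y != 0 & \forall z \near y, f z = g z.
  apply: (H [set y | D y != 0]).
  have nD : nbhs (D x) [set z | z != 0] by apply: open_nbhs_nbhs; split=> //; exact: open_neq.
  exact: cD nD.
by move: Dy; rewrite /D (near_eq_derive v fg) subrr normr0 eqxx.
Qed.

Lemma mdiff_eq_closure (R : realType) (m n : nat) (S T : topologicalType)
    (M : smooth_manifold R m S) (N : smooth_manifold R n T) (f g : S -> T) p v :
  msmooth M N f p -> msmooth M N g p ->
  f p = g p -> closure ([set q | f q = g q]^°) p -> mdiff M N f p v = mdiff M N g p v.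
Proof.
move=> sf sg fgp clp; have cp := mc_dom_chart_at M p.
have s1 := msmooth_chart_at sf; have s2 := msmooth_chart_at sg.
rewrite /mdiff -fgp; rewrite -fgp in s2.
apply: diff_eq_frequently s1 s2 _ => U xU.
have [q [/= iq [Uq cq]]] := clp _ (filterI (near_mc_fwd cp xU) (near_mc_dom cp)).
exists (mc_fwd (chart_at M p) q) => //.
by have := near_mc_bwd cq iq; apply: filterS => y /= e; rewrite /in_charts /= e.
Qed.

Lemma eq_closure (S T : topologicalType) (f g : S -> T) p : hausdorff_space T ->
  {for p, continuous f} -> {for p, continuous g} -> closure [set q | f q = g q] p -> f p = g p.
Proof.
move=> hT cf cg clp; apply: hT => A B Af Bg.
have Af' : \forall q \near p, A (f q) by exact: cf.
have Bg' : \forall q \near p, B (g q) by exact: cg.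
have [q [/= fgq [Aq Bq]]] := clp _ (filterI Af' Bg').
by exists (f q); split=> //; rewrite fgq.
Qed.

(** A finite Baire argument. Otherwise [x] has an open neighbourhood in which no [F i] has interior;
    removing the finitely many [F i] one after the other always leaves a nonempty open set, and its
    points are not covered. *)
Lemma finite_closed_cover_interior (T : topologicalType) (I : choiceType) (A : set I)
    (F : I -> set T) (U : set T) (x : T) : finite_set A -> open U -> U x ->
  (forall i, A i -> open (U `\` F i)) -> U `<=` \bigcup_(i in A) F i ->
  exists2 i, A i & closure ((F i)^°) x.
Proof.
move=> /finite_fsetP[s ->] oU Ux oF cF; apply: contrapT => H.
have [V [oV Vx VP]] : exists V, [/\ open V, V x & V `<=` U `&` 
    [set y | forall i, [set` s] i -> (~` closure ((F i)^°)) y]].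
  suff : nbhs x (U `&` [set y | forall i, [set` s] i -> (~` closure ((F i)^°)) y]).
    by rewrite nbhsE => -[V [oV Vx] VP]; exists V.
  apply: filterI; first exact: open_nbhs_nbhs.
  apply: near_finite; first exact: finite_fset.
  move=> i si; apply: open_nbhs_nbhs; split.
    by apply: closed_openC; exact: closed_closure.
  by move=> cl; apply: H; exists i.
have key (r : seq I) : {subset r <= s} -> exists V', [/\ open V', V' !=set0, V' `<=` V &
    forall i, i \in r -> V' `&` F i = set0].
  elim: r => [_|i r IH rs]; first by exists V; split=> //; exists x.
  have [j jr|V' [oV' [y Vy] V'V VF]] := IH.
    by apply: rs; rewrite in_cons jr orbT.
  have si : i \in s by apply: rs; rewrite mem_head.
  have E : V' `\` F i = V' `&` (U `\` F i).
    apply/seteqP; split=> z [Vz]; last by move=> [].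
    by move=> nF; split=> //; split=> //; have /VP[] := V'V _ Vz.
  exists (V' `\` F i); split.
  - by rewrite E; apply: openI => //; exact: oF.
  - apply: contrapT => h.
    have VFi : V' `<=` F i by move=> z Vz; apply: contrapT => nF; apply: h; exists z.
    have /VP[_ /(_ i si)] := V'V _ Vy; apply; apply: subset_closure.
    by apply: filterS VFi _; exact: open_nbhs_nbhs.
  - by move=> z [/V'V].
  - move=> j; rewrite in_cons => /orP[/eqP->|jr]; rewrite -subset0 => z [[Vz nF]] //.
    by move=> Fz; rewrite -(VF j jr); split.
have [|V' [_ [y Vy] V'V VF]] := key s; first by [].
have /VP[Uy _] := V'V _ Vy; have [i si Fy] := cF _ Uy.
by have : (V' `&` F i) y by []; rewrite VF.
Qed.

(** * Germs of changes of charts *)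

Section germs.
Variables (R : realType) (n : nat) (Q : topologicalType).
Implicit Types c d e : orbichart R n Q.

Definition germ_change c d (x : oc_space c) (y : oc_space d) := exists W h,
  [/\ change_of_charts W h, W x & h x = y].

Lemma germ_intro c d (W : set (oc_space c)) (h : oc_space c -> oc_space d) x :
  diffeo_on (oc_mfd c) (oc_mfd d) W h -> (forall z, W z -> oc_proj d (h z) = oc_proj c z) ->
  W x -> germ_change x (h x).
Proof.
move=> dh ph Wx; have [h' [oW _ _ _ _]] := diffeo_elim dh.
have [W0 [oW0 cW0 W0x W0W]] := manifold_connected_nbhd (oc_mfd c) oW Wx.
exists W0, h; split=> //; split=> //; first exact: diffeo_sub dh oW0 W0W.
by move=> z /W0W; exact: ph.
Qed.

Lemma germ_group c a (x : oc_space c) : oc_group c a -> germ_change x (a x).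
Proof.
move=> Ga; have [b [Gb ab ba]] := oc_group_inv Ga.
apply: (@germ_intro c c setT) => // [|z _]; last exact: proj_group.
apply: (@diffeo_intro _ _ _ _ (oc_mfd c) (oc_mfd c) setT setT a b) => //.
- exact: openT.
- exact: openT.
- by move=> p _; exact: group_msmooth.
- by move=> p _; exact: group_msmooth.
Qed.

Lemma germ_sym c d (x : oc_space c) (y : oc_space d) : germ_change x y -> germ_change y x.
Proof.
move=> [W [h [[_ dh ph] Wx <-]]]; have [h' [oW oV hK sh sh']] := diffeo_elim dh.
rewrite -{2}(hK x Wx); apply: (@germ_intro _ _ (h @` W)); last by exists x.
  apply: (@diffeo_intro _ _ _ _ (oc_mfd d) (oc_mfd c) (h @` W) W h' h) => //.
    by move=> _ [_ [z Wz <-] <-]; rewrite hK.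
  by move=> _ [z Wz <-]; rewrite hK.
by move=> _ [z Wz <-]; rewrite hK// ph.
Qed.

Lemma germ_trans c d e (x : oc_space c) (y : oc_space d) (z : oc_space e) :
  germ_change x y -> germ_change y z -> germ_change x z.
Proof.
move=> [W [h [[_ dh ph] Wx <-]]] [V [k [[_ dk pk] Vy <-]]].
have [h' [oW oWh hK sh sh']] := diffeo_elim dh.
have [k' [oV oVk kK sk sk']] := diffeo_elim dk.
have oU : open (W `&` h @^-1` V).
  rewrite openE => p [Wp Vp]; apply: filterI; first exact: open_nbhs_nbhs.
  by apply: (msmooth_continuous (sh p Wp)); exact: open_nbhs_nbhs.
have dhU := diffeo_sub dh oU (@subIsetl _ _ _).
have oU' : open (h @` (W `&` h @^-1` V)) by case: dhU.
have sub : h @` (W `&` h @^-1` V) `<=` V by move=> _ [p [_ Vp] <-].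
have dkU := diffeo_sub dk oU' sub.
have oU'' : open (k @` (h @` (W `&` h @^-1` V))) by case: dkU.
apply: (@germ_intro c e (W `&` h @^-1` V) (k \o h) x) => //; last first.
  by move=> p [Wp Vp] /=; rewrite pk// ph.
apply: (@diffeo_intro _ _ _ _ _ _ _ (k @` (h @` (W `&` h @^-1` V))) _ (h' \o k')) => //.
- by move=> _ [p Up <-]; exists (h p) => //; exists p.
- move=> _ [_ [_ [p [Wp Vp] <-] <-] <-] /=; rewrite kK// hK//.
- by move=> p [Wp Vp] /=; rewrite kK// hK.
- by move=> _ [_ [p [Wp Vp] <-] <-] /=; rewrite kK// hK.
- by move=> p [Wp Vp]; apply: msmooth_comp; [exact: sh|exact: sk].
- move=> _ [_ [p [Wp Vp] <-] <-]; apply: msmooth_comp; first by apply: sk'; exists (h p).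
  by rewrite kK//; apply: sh'; exists p.
Qed.

(** Compatibility only places [y] in the image of [h]. Its preimage [w] lies over the same point as
    [x], so a group element carrying [x] to [w] is applied first. *)
Lemma compatible_germ c d (x : oc_space c) (y : oc_space d) : oc_compatible c d ->
  oc_proj c x = oc_proj d y -> germ_change x y.
Proof.
move=> cd xy; have [W [h [[cW dh ph] Wx [w Ww hw]]]] := cd x y xy.
have /oc_fiber[a Ga ax] : oc_proj c x = oc_proj c w by rewrite xy -hw ph.
apply: germ_trans (germ_group x Ga) _; rewrite ax -hw.
exact: germ_intro dh ph Ww.
Qed.

Lemma germ_compatible c d :
  (forall (x : oc_space c) (y : oc_space d), oc_proj c x = oc_proj d y -> germ_change x y) ->
  oc_compatible c d.
Proof.
move=> H x y /H[W [h [ch Wx hx]]]; exists W, h; split=> //.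
by exists x.
Qed.

(* The maps [h \o a] and [b \o h], with [b] in the group of [d], agree on sets
   whose interiors accumulate at [x] for at least one [b]. *)
Lemma change_isotropy c d (W : set (oc_space c)) (h : oc_space c -> oc_space d) x a :
  change_of_charts W h -> W x -> isotropy x a -> exists2 b, isotropy (h x) b &
  forall v, mdiff (oc_mfd c) (oc_mfd d) h x (mdiff (oc_mfd c) (oc_mfd c) a x v) =
            mdiff (oc_mfd d) (oc_mfd d) b (h x) (mdiff (oc_mfd c) (oc_mfd d) h x v).
Proof.
move=> [_ dh ph] Wx [Ga ax]; have [h' [oW oWh hK sh sh']] := diffeo_elim dh.
have hT := mf_hausdorff (oc_mfd d).
have oN : open (W `&` a @^-1` W).
  by apply: openI => //; move/continuousP: (group_continuous Ga); exact.
have Nx : (W `&` a @^-1` W) x by rewrite /= ax.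
have [||b Gb clb] := @finite_closed_cover_interior _ _ (oc_group d)
    (fun b => [set z | h (a z) = b (h z)]) (W `&` a @^-1` W) x (oc_group_fin d) oN Nx.
- move=> b Gb; rewrite openE => z [[Wz Waz] /= ne].
  have sz1 : {for z, continuous (h \o a)}.
    apply: continuous_comp; first exact: group_continuous.
    exact: msmooth_continuous (sh _ Waz).
  have sz2 : {for z, continuous (b \o h)}.
    apply: continuous_comp; first exact: msmooth_continuous (sh _ Wz).
    exact: group_continuous.
  have ne' : h (a z) != b (h z) by apply/eqP.
  move: hT; rewrite open_hausdorff => /(_ _ _ ne').
  move=> [[A B] /= [/set_mem Aq /set_mem Bq] [oA oB AB]].
  apply: filterI; first by apply: open_nbhs_nbhs; split.
  have n1 : \forall y \near z, A (h (a y)) by apply: sz1; exact: open_nbhs_nbhs.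
  have n2 : \forall y \near z, B (b (h y)) by apply: sz2; exact: open_nbhs_nbhs.
  apply: filterS2 n1 n2 => y Ay By e.
  have : (A `&` B) (h (a y)) by split=> //; rewrite e.
  by rewrite (eqP AB).
- move=> z [Wz Waz]; have /oc_fiber[b Gb bh] : oc_proj d (h z) = oc_proj d (h (a z)).
    by rewrite !ph// proj_group.
  by exists b.
have hx : h (a x) = b (h x).
  apply: (eq_closure hT _ _ (closureS (@interior_subset _ _) clb)).
    apply: continuous_comp; first exact: group_continuous.
    by rewrite ax; exact: msmooth_continuous (sh _ Wx).
  apply: continuous_comp; first exact: msmooth_continuous (sh _ Wx).
  exact: group_continuous.
have bx : isotropy (h x) b by split=> //; rewrite -hx ax.
exists b; [exact: bx|move=> v].
have s1 := group_msmooth x Ga; have s2 := sh _ Wx.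
have s2' : msmooth (oc_mfd c) (oc_mfd d) h (a x) by rewrite ax.
have s3 := group_msmooth (h x) Gb.
have e1 := mdiff_comp_at v ax s1 s2.
have e2 := mdiff_comp v s2 s3.
have e3 := mdiff_eq_closure v (msmooth_comp s1 s2') (msmooth_comp s2 s3) hx clb.
exact: etrans (esym e1) (etrans e3 e2).
Qed.

End germs.

Lemma vspace_iso (F : fieldType) (U V : vectType F) (f : {linear U -> V}) (g : V -> U) :
  cancel f g -> cancel g f -> forall E : {vspace U},
  exists E' : {vspace V}, \dim E' = \dim E /\ forall w, w \in E' <-> g w \in E.
Proof.
move=> fK gK E; have fE v : linfun f v = f v by rewrite lfunE.
exists (linfun f @: E)%VS; split.
  apply: limg_dim_eq; have /eqP -> : lker (linfun f) == 0%VS.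
    by apply/lker0P => u v; rewrite !fE; exact: (can_inj fK).
  exact: capv0.
move=> w; split=> [/memv_imgP[v vE ->]|gw]; first by rewrite fE fK.
by apply/memv_imgP; exists (g w) => //; rewrite fE gK.
Qed.

(** * Independence of the singular dimension from the chart *)

Section fixed_tangent_theory.
Variables (R : realType) (n : nat) (Q : topologicalType).
Implicit Types c d : orbichart R n Q.

Lemma change_inverse c d (W : set (oc_space c)) (h : oc_space c -> oc_space d) x :
  change_of_charts W h -> W x -> exists h1, [/\ change_of_charts (h @` W) h1, h1 (h x) = x,
   cancel (mdiff (oc_mfd c) (oc_mfd d) h x) (mdiff (oc_mfd d) (oc_mfd c) h1 (h x)) &
   cancel (mdiff (oc_mfd d) (oc_mfd c) h1 (h x)) (mdiff (oc_mfd c) (oc_mfd d) h x)].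
Proof.
move=> [cW dh ph] Wx; have [h' [oW oV hK sh sh']] := diffeo_elim dh.
have Vhx : (h @` W) (h x) by exists x.
have hh : \near x, x = (h' \o h) x by apply: filterS (open_nbhs_nbhs (conj oW Wx)) => q /hK.
have hh' : \forall y \near h x, y = (h \o h') y.
  by apply: filterS (open_nbhs_nbhs (conj oV Vhx)) => _ [q Wq <-] /=; rewrite hK.
have s1 := sh _ Wx; have s2 := sh' _ Vhx; have e := hK _ Wx.
have s1' : msmooth (oc_mfd c) (oc_mfd d) h (h' (h x)) by rewrite e.
exists h'; split=> //.
- split.
  + apply: connected_continuous_connected => //.
    by apply: continuous_in_subspaceT => z /set_mem/sh; exact: msmooth_continuous.
  + apply: (@diffeo_intro _ _ _ _ (oc_mfd d) (oc_mfd c) (h @` W) W h' h) => //.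
      by move=> _ [_ [z Wz <-] <-]; rewrite hK.
    by move=> _ [z Wz <-]; rewrite hK.
  + by move=> _ [z Wz <-]; rewrite hK// ph.
- move=> v; apply: etrans (esym (mdiff_comp v s1 s2)) _.
  by apply: etrans (esym (near_eq_mdiff v hh (msmooth_id _ _))) _; exact: mdiff_id.
- move=> w; apply: etrans (esym (mdiff_comp_at w e s2 s1)) _.
  by apply: etrans (esym (near_eq_mdiff w hh' (msmooth_id _ _))) _; exact: mdiff_id.
Qed.

(** [change_isotropy] matches each isotropy element at [x] with some element at [h x], without
    saying that all elements there are reached. This gives the implication from [h x] back to [x];
    the converse comes from applying it to the inverse change of charts. *)
Let fixed_tangent_pull c d (W : set (oc_space c)) (h : oc_space c -> oc_space d) x v :
  change_of_charts W h -> W x ->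
  fixed_tangent (h x) (mdiff (oc_mfd c) (oc_mfd d) h x v) -> fixed_tangent x v.
Proof.
move=> ch Wx fv a ia; have [b ib e] := change_isotropy ch Wx ia.
have [_ dh _] := ch; apply: (mdiff_diffeo_inj dh Wx).
exact: etrans (e v) (fv b ib).
Qed.

Lemma fixed_tangent_change c d (W : set (oc_space c)) (h : oc_space c -> oc_space d) x v :
  change_of_charts W h -> W x ->
  fixed_tangent (h x) (mdiff (oc_mfd c) (oc_mfd d) h x v) <-> fixed_tangent x v.
Proof.
move=> ch Wx; split; first exact: fixed_tangent_pull ch Wx.
have [h1 [ch1 e hK _]] := change_inverse ch Wx => fv.
apply: (fixed_tangent_pull ch1); first by exists x.
have -> : mdiff (oc_mfd d) (oc_mfd c) h1 (h x) (mdiff (oc_mfd c) (oc_mfd d) h x v) = v by exact: hK.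
by rewrite e.
Qed.

Definition fixed_dim c (x : oc_space c) (k : nat) := exists E : {vspace 'rV[R]_n},
  \dim E = k /\ fixed_tangent x = [set v | v \in E].

Lemma fixed_dim_uniq c (x : oc_space c) k l : fixed_dim x k -> fixed_dim x l -> k = l.
Proof.
move=> [E [<- e]] [E' [<- e']]; congr (\dim _); apply/vspaceP => v.
have : [set v | v \in E] v = [set v | v \in E'] v by rewrite -e -e'.
by move=> /= h; apply/idP/idP; rewrite h.
Qed.

Lemma fixed_dim_exists c (x : oc_space c) : exists2 k, (k <= n)%N & fixed_dim x k.
Proof.
have /finite_seqP[s sE] := isotropy_finite x.
have H (r : seq (oc_space c -> oc_space c)) : exists E : {vspace 'rV[R]_n},
    forall v, v \in E <-> forall a, a \in r -> mdiff (oc_mfd c) (oc_mfd c) a x v = v.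
  elim: r => [|a r [E IH]]; first by exists fullv => v; split=> // _; exact: memvf.
  exists (E :&: fixedSpace (linfun (mdiff (oc_mfd c) (oc_mfd c) a x)))%VS => v.
  rewrite memv_cap; split=> [/andP[/IH vE /fixedSpaceP fv] b|H].
    by rewrite in_cons => /orP[/eqP->|/vE//]; rewrite lfunE in fv.
  apply/andP; split.
    by apply/IH => b br; apply: H; rewrite in_cons br orbT.
  by apply/fixedSpaceP; rewrite lfunE; apply: H; rewrite mem_head.
have [E EP] := H s; exists (\dim E).
  by apply: leq_trans (dimvS (subvf E)) _; rewrite dimvf dim_matrix mul1r.
exists E; split=> //; apply/seteqP; split=> v /=.
  by move=> fv; apply/EP => a ar; apply: fv; rewrite sE.
by move=> /EP vE a; rewrite sE => /vE.
Qed.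

Lemma fixed_dim_change c d (W : set (oc_space c)) (h : oc_space c -> oc_space d) x k :
  change_of_charts W h -> W x -> fixed_dim x k -> fixed_dim (h x) k.
Proof.
move=> ch Wx [E [dE EP]]; have [h1 [ch1 e hK hK']] := change_inverse ch Wx.
have [E' [dE' E'P]] := vspace_iso hK hK' E; exists E'; split; first by rewrite dE'.
apply/seteqP; split=> w /= => [fw|/E'P vE].
  apply/E'P; suff : fixed_tangent x (mdiff (oc_mfd d) (oc_mfd c) h1 (h x) w) by rewrite EP.
  by apply/(fixed_tangent_change _ ch Wx); rewrite hK'.
rewrite -(hK' w); apply/(fixed_tangent_change _ ch Wx).
by rewrite EP.
Qed.

Lemma fixed_dim_germ c d (x : oc_space c) (y : oc_space d) k :
  germ_change x y -> fixed_dim x k -> fixed_dim y k.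
Proof. by move=> [W [h [ch Wx <-]]]; exact: fixed_dim_change ch Wx. Qed.

End fixed_tangent_theory.

(** * The partition into strata and its topology *)

Section orbifold_theory.
Variables (R : realType) (n : nat) (Q : orbifold R n).
Implicit Types c d : orbichart R n Q.

Lemma orbifold_chart_orb i : orbifold_chart (orb_chart Q i).
Proof. by move=> j; exact: orb_compat. Qed.

Lemma orb_coverP (x : Q) : exists i (y : oc_space (orb_chart Q i)), oc_proj (orb_chart Q i) y = x.
Proof.
have : (\bigcup_i range (oc_proj (orb_chart Q i))) x by rewrite orb_cover.
by move=> [i _ [y _ yx]]; exists i, y.
Qed.

Lemma orbifold_chart_germ c d (x : oc_space c) (y : oc_space d) :
  orbifold_chart c -> orbifold_chart d -> oc_proj c x = oc_proj d y -> germ_change x y.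
Proof.
move=> Qc Qd xy; have [i [z zx]] := orb_coverP (oc_proj c x).
apply: (germ_trans (y := z)); first exact/compatible_germ/esym.
by apply: germ_sym; apply: compatible_germ => //; rewrite -xy.
Qed.

(** [singular_dim] refers to some chart of the atlas; any two orbifold charts are joined by a germ
    of change of charts, so the dimension may be read off in every orbifold chart. *)
Lemma Sigma_fixed_dim c x k : orbifold_chart c ->
  Sigma Q k (oc_proj c x) <-> fixed_dim x k.
Proof.
move=> Qc; split=> [[i [y [yx fy]]]|fx].
  apply: fixed_dim_germ fy; exact: orbifold_chart_germ (@orbifold_chart_orb i) Qc yx.
have [i [y yx]] := orb_coverP (oc_proj c x); exists i, y; split=> //.
by apply: fixed_dim_germ fx; exact: orbifold_chart_germ Qc (@orbifold_chart_orb i) (esym yx).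
Qed.

Lemma bigcup_Sigma : \bigcup_(k in [set k : nat | (k <= n)%N]) Sigma Q k = setT.
Proof.
apply/seteqP; split=> // x _; have [i [y yx]] := orb_coverP x.
have [k kn fk] := fixed_dim_exists y; exists k => //.
by rewrite -yx; apply/Sigma_fixed_dim => //; exact: orbifold_chart_orb.
Qed.

Lemma trivIset_Sigma : trivIset setT (Sigma Q).
Proof.
move=> k l _ _ [x [xk xl]]; have [i [y yx]] := orb_coverP x.
move: xk xl; rewrite -yx => /(Sigma_fixed_dim _ _ (@orbifold_chart_orb i)) yk.
move=> /(Sigma_fixed_dim _ _ (@orbifold_chart_orb i)) yl.
exact: fixed_dim_uniq yk yl.
Qed.

Lemma orb_locally_parametrized (x : Q) :
  exists (G : set 'rV[R]_n) (f : 'rV[R]_n -> Q), open_parametrization G f /\ (f @` G) x.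
Proof.
have [i [y yx]] := orb_coverP x.
pose c := chart_at (oc_mfd (orb_chart Q i)) y.
have cy : mc_dom c y by exact: mc_dom_chart_at.
exists (mc_img c), (oc_proj (orb_chart Q i) \o mc_bwd c); split; last first.
  by exists (mc_fwd c y); [exact: mc_img_fwd|rewrite /= mc_fwdK].
split; first exact: mc_img_open.
- move=> z cz; apply: continuous_comp; first exact: mc_bwd_cont.
  exact: proj_continuous.
- move=> U oU Uc; rewrite -image_comp; apply: proj_open; exact: mc_bwd_open.
Qed.

Lemma Sigma_paracompact k : paracompact (Sigma Q k).
Proof.
apply: locally_parametrized_paracompact.
- exact: orb_hausdorff.
- exact: orb_paracompact.
- exact: orb_locally_parametrized.
Qed.

Lemma Sigma_hausdorff k : hausdorff_space (Sigma Q k).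
Proof.
have := @orb_hausdorff _ _ Q; rewrite !open_hausdorff => h x y xy.
have /h[[A B] /= [/set_mem Ax /set_mem By] [oA oB AB]] : set_val x != set_val y.
  by apply: contra xy => /eqP/val_inj ->.
exists (set_val @^-1` A, set_val @^-1` B) => /=; first by split; exact/mem_set.
split; [by exists A|by exists B|].
apply/eqP; rewrite -subset0 => z [Az Bz].
by have : (A `&` B) (set_val z) by []; rewrite (eqP AB).
Qed.

End orbifold_theory.

(** * The invariant quadratic form and the radial diffeomorphism *)

Section smooth_at_scalar.
Variables (R : realType) (V : normedModType R).

Lemma smooth_at_preimage (W : normedModType R) (f : V -> W) (P : set W) x : smooth_at f x ->
  open P -> P (f x) -> exists U, [/\ open U, U x, forall y, U y -> P (f y) & smooth_on U f].
Proof.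
move=> [U [oU Ux sf]] oP Pfx; exists (U `&` f @^-1` P); split=> //.
- rewrite openE => y [Uy Py]; apply: filterI; first exact: open_nbhs_nbhs.
  have sy : smooth_at f y by exists U.
  by apply: (smooth_at_continuous sy); exact: open_nbhs_nbhs.
- by move=> y [].
- by move=> r; apply: class_C_sub (sf r) => y [].
Qed.

Lemma smooth_atV (f : V -> R) x : f x != 0 -> smooth_at f x ->
  smooth_at (fun y => (f y)^-1) x.
Proof.
move=> fx sf; have [U [oU Ux PU sU]] := smooth_at_preimage sf (@open_neq R 0) fx.
by exists U; split=> // r; exact: class_CV.
Qed.

Lemma smooth_at_sqrt (f : V -> R) x : 0 < f x -> smooth_at f x ->
  smooth_at (fun y => Num.sqrt (f y)) x.
Proof.
move=> fx sf; have [U [oU Ux PU sU]] := smooth_at_preimage sf (@open_gt R 0) fx.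
by exists U; split=> // r; exact: class_C_sqrt.
Qed.

Lemma smooth_at_scale (W : normedModType R) (k : V -> R) (w : W) x :
  smooth_at k x -> smooth_at (fun y => k y *: w) x.
Proof. by move=> [U [oU Ux sk]]; exists U; split=> // r; exact: class_C_scale. Qed.

Lemma smooth_at_mx m n (f : V -> 'M[R]_(m, n)) x :
  (forall i j, smooth_at (fun y => f y i j) x) -> smooth_at f x.
Proof.
move=> sf; rewrite (_ : f = fun x => \sum_i \sum_j f x i j *: delta_mx i j).
  by do 2![apply: smooth_at_sum => ?]; exact: smooth_at_scale.
by apply/funext => y; exact: matrix_sum_delta.
Qed.

Lemma smooth_at_scale_mx m n (k : V -> R) (f : V -> 'M[R]_(m, n)) x :
  smooth_at k x -> smooth_at f x -> smooth_at (fun y => k y *: f y) x.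
Proof.
move=> sk sf; apply: smooth_at_mx => i j.
under [X in smooth_at X]funext do rewrite mxE.
by apply: smooth_atM => //; exact: smooth_at_mxP.
Qed.

End smooth_at_scalar.

(* A finite group of matrices, given with multiplicities. *)
Section radial.
Variables (R : realType) (n : nat) (L : seq 'M[R]_n).
Hypothesis L1 : 1%:M \in L.
Hypothesis LM : forall B, B \in L -> perm_eq [seq B *m C | C <- L] L.

(** The standard Euclidean form summed over the group, as in Weyl's unitary trick; invariance is a
    reindexing by [LM]. *)
Definition group_form (v : 'rV[R]_n) : R := \sum_(C <- L) \sum_j (v *m C) 0 j ^+ 2.

Let q := group_form.

Let q_ge0 v : 0 <= q v.
Proof. by apply: sumr_ge0 => C _; apply: sumr_ge0 => j _; exact: sqr_ge0. Qed.

Lemma group_form0 : q 0 = 0.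
Proof.
rewrite /q /group_form big1// => C _; rewrite big1// => j _.
by rewrite mul0mx mxE expr0n.
Qed.

Lemma group_formM v B : B \in L -> q (v *m B) = q v.
Proof.
move=> BL; rewrite /q /group_form -[in RHS](perm_big _ (LM BL)) big_map.
by apply: eq_bigr => C _; rewrite mulmxA.
Qed.

Lemma group_formZ (k : R) v : q (k *: v) = k ^+ 2 * q v.
Proof.
rewrite /q /group_form mulr_sumr; apply: eq_bigr => C _.
by rewrite mulr_sumr; apply: eq_bigr => j _; rewrite -scalemxAl mxE exprMn.
Qed.

Lemma smooth_at_group_form v : smooth_at q v.
Proof.
apply: smooth_at_sum => C; apply: smooth_at_sum => j.
under [X in smooth_at X]funext do rewrite expr2.
by apply: smooth_atM; apply: (smooth_at_mxP (smooth_at_mulmxr C v)).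
Qed.

(** The identity matrix alone contributes the Euclidean square norm, which dominates the maximum
    norm. Hence the set where [q] is below [e ^+ 2] lies in the ball of radius [e]. *)
Lemma group_form_norm v : `|v| ^+ 2 <= q v.
Proof.
have h j : v 0 j ^+ 2 <= q v.
  rewrite /q /group_form (big_rem _ L1) /= mulmx1 (bigD1 j)//= -addrA lerDl.
  apply: addr_ge0; first by apply: sumr_ge0 => i _; exact: sqr_ge0.
  by apply: sumr_ge0 => C _; apply: sumr_ge0 => i _; exact: sqr_ge0.
rewrite -(sqr_sqrtr (q_ge0 v)) ler_sqr ?nnegrE ?sqrtr_ge0//.
apply: norm_rV_le => [|j]; first exact: sqrtr_ge0.
by rewrite -(ger0_norm (sqrtr_ge0 (q v))) -ler_sqr ?nnegrE// !real_normK ?num_real// sqr_sqrtr.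
Qed.

(* [v / sqrt (1 + q v)] maps the whole space onto the ball [q < e^2]. *)
Lemma radial_diffeo (e : R) : 0 < e -> exists rho sigma : 'rV[R]_n -> 'rV[R]_n,
  [/\ forall v, smooth_at rho v, forall w, q w < e ^+ 2 -> smooth_at sigma w,
      forall v, q (rho v) < e ^+ 2 /\ sigma (rho v) = v,
      forall w, q w < e ^+ 2 -> rho (sigma w) = w &
      rho 0 = 0 /\ forall v B, B \in L -> rho (v *m B) = rho v *m B].
Proof.
move=> e0.
pose rho v := (e * (Num.sqrt (1 + q v))^-1) *: v.
pose sigma w := (Num.sqrt (e ^+ 2 - q w))^-1 *: w.
have q1 v : 0 < 1 + q v by rewrite ltr_pwDl.
have qr v : q (rho v) = e ^+ 2 * (q v / (1 + q v)).
  rewrite group_formZ exprMn exprVn sqr_sqrtr ?ltW//.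
  by rewrite -mulrA [X in _ * X]mulrC.
(* This identity makes the scalar factor of [sigma] at [rho v] reciprocal to that of [rho] at
   [v]. *)
have qr' v : e ^+ 2 - q (rho v) = e ^+ 2 / (1 + q v).
  by rewrite qr; field; rewrite gt_eqF.
have sq (a : R) : 0 < a -> Num.sqrt (e ^+ 2 / a) = e / Num.sqrt a.
  by move=> a0; rewrite sqrtrM ?sqr_ge0// sqrtr_sqr gtr0_norm// sqrtrV// ltW.
exists rho, sigma; split.
- move=> v; apply: smooth_at_scale_mx; last exact: smooth_at_id.
  apply: smooth_atM; first exact: smooth_at_cst.
  apply: smooth_atV; first by rewrite gt_eqF// sqrtr_gt0.
  apply: smooth_at_sqrt => //; apply: smooth_atD; first exact: smooth_at_cst.
  exact: smooth_at_group_form.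
- move=> w qw; have qw' : 0 < e ^+ 2 - q w by rewrite subr_gt0.
  apply: smooth_at_scale_mx; last exact: smooth_at_id.
  apply: smooth_atV; first by rewrite gt_eqF// sqrtr_gt0.
  apply: smooth_at_sqrt => //; apply: smooth_atD; first exact: smooth_at_cst.
  under [X in smooth_at X]funext do rewrite -scaleN1r.
  exact/smooth_atZ/smooth_at_group_form.
- move=> v; split.
    by rewrite -subr_gt0 qr' divr_gt0// exprn_gt0.
  rewrite /sigma qr' sq// /rho scalerA -[RHS]scale1r; congr (_ *: _).
  by field; rewrite !gt_eqF ?sqrtr_gt0.
- move=> w qw; have qw' : 0 < e ^+ 2 - q w by rewrite subr_gt0.
  have q1s : 1 + q (sigma w) = e ^+ 2 / (e ^+ 2 - q w).
    rewrite group_formZ exprVn sqr_sqrtr ?ltW//.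
    by field; rewrite gt_eqF.
  rewrite /rho q1s sq// /sigma scalerA -[RHS]scale1r; congr (_ *: _).
  by field; rewrite !gt_eqF ?sqrtr_gt0.
- by split=> [|v B BL]; rewrite /rho ?scaler0// group_formM// scalemxAl.
Qed.

End radial.

Lemma smooth_at_sum_in (R : realType) (V W : normedModType R) (I : eqType) (s : seq I)
    (F : I -> V -> W) x : (forall i, i \in s -> smooth_at (F i) x) ->
  smooth_at (fun y => \sum_(i <- s) F i y) x.
Proof.
move=> sF; pose G i := if i \in s then F i else cst 0.
have sG i : smooth_at (G i) x by rewrite /G; case: ifP => [/sF//|_]; exact: smooth_at_cst.
have := smooth_at_sum s sG; congr smooth_at; apply/funext => y.
by rewrite big_seq [RHS]big_seq; apply: eq_bigr => i is_; rewrite /G is_.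
Qed.

Lemma invmx_cancel (F : fieldType) n (P P' : 'M[F]_n) : P \in unitmx -> P' \in unitmx ->
  invmx P = invmx (P' *m P) *m P'.
Proof.
move=> uP uP'; have uPP : P' *m P \in unitmx by rewrite unitmx_mul uP'.
by rewrite -[LHS]mul1mx -(mulVmx uPP) -!mulmxA mulmxV// mulmx1.
Qed.

Lemma derive_sum_seq (R : realType) (V W : normedModType R) (I : eqType) (s : seq I)
    (F : I -> V -> W) x v : (forall i, i \in s -> differentiable (F i) x) ->
  differentiable (fun y => \sum_(i <- s) F i y) x /\
  'D_v (fun y => \sum_(i <- s) F i y) x = \sum_(i <- s) 'D_v (F i) x.
Proof.
elim: s => [_|i s IH dF].
  have -> : (fun y => \sum_(i <- [::]) F i y) = cst 0 by apply/funext => y; rewrite big_nil.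
  by split; [exact: differentiable_cst|rewrite big_nil derive_cst].
have [j js|d e] := IH; first by apply: dF; rewrite in_cons js orbT.
have di : differentiable (F i) x by apply: dF; exact: mem_head.
have -> : (fun y => \sum_(j <- i :: s) F j y) = F i + (fun y => \sum_(j <- s) F j y).
  by apply/funext => y; rewrite big_cons.
split; first exact: differentiableD.
by rewrite big_cons -e; apply: deriveD; exact: diff_derivable.
Qed.

Lemma derive_mxE (R : realType) (V : normedModType R) m n (f : V -> 'M[R]_(m, n)) x v i j : smooth_at f x ->
  'D_v f x i j = 'D_v (fun y => f y i j) x.
Proof.
by move=> sf; rewrite derive_mx ?mxE//; exact/diff_derivable/smooth_at_differentiable.
Qed.

Lemma derive_mulmx (R : realType) (V : normedModType R) m n p (f : V -> 'M[R]_(m, n)) (g : V -> 'M[R]_(n, p)) x v :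
  smooth_at f x -> smooth_at g x ->
  'D_v (fun y => f y *m g y) x = 'D_v f x *m g x + f x *m 'D_v g x.
Proof.
move=> sf sg; apply/matrixP => i j; rewrite derive_mxE; last exact: smooth_at_mulmx.
rewrite !mxE -big_split /=.
have -> : (fun y => (f y *m g y) i j) = fun y => \sum_l f y i l * g y l j.
  by apply/funext => y; rewrite mxE.
have sfl l : smooth_at (fun y => f y i l) x by exact: smooth_at_mxP.
have sgl l : smooth_at (fun y => g y l j) x by exact: smooth_at_mxP.
have sfg l : differentiable (fun y => f y i l * g y l j) x.
  by apply/smooth_at_differentiable/smooth_atM.
have [_ ->] := @derive_sum_seq _ _ _ _ (index_enum 'I_n) (fun l y => f y i l * g y l j) x v
  (fun l _ => sfg l).
apply: eq_bigr => l _; rewrite !derive_mxE//.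
have := deriveM (v := v) (diff_derivable (smooth_at_differentiable (sfl l)))
  (diff_derivable (smooth_at_differentiable (sgl l))).
by move=> e; rewrite [RHS]addrC [X in _ + X]mulrC; exact: e.
Qed.

Lemma derive_mulmxr (R : realType) (V : normedModType R) m n p (f : V -> 'M[R]_(m, n))
    (B : 'M[R]_(n, p)) x v : smooth_at f x -> 'D_v (fun y => f y *m B) x = 'D_v f x *m B.
Proof.
move=> sf; rewrite (derive_mulmx _ sf (smooth_at_cst B x)).
by rewrite (derive_cst B) mulmx0 addr0.
Qed.

Lemma mdiffE_at (R : realType) (m n : nat) (S T : topologicalType)
    (M : smooth_manifold R m S) (N : smooth_manifold R n T) (f : S -> T) p q v : f p = q ->
  msmooth M N f p ->
  mdiff M N f p v = 'D_v (in_charts (chart_at M p) (chart_at N q) f) (mc_fwd (chart_at M p) p).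
Proof. by move=> <-; exact: mdiffE. Qed.

(** * The isotropy representation and its linearization *)

Section isotropy_representation.
Variables (R : realType) (n : nat) (Q : topologicalType) (c : orbichart R n Q).
Variable x : oc_space c.
Let M := oc_mfd c.

Fact isotropy_mx_key : unit. Proof. by []. Qed.

(** Matrices act on row vectors from the right, so composition becomes the product in reverse order.
    The lock keeps conversion from unfolding the differential. *)
Definition isotropy_mx (a : oc_space c -> oc_space c) : 'M[R]_n :=
  locked_with isotropy_mx_key (lin1_mx (mdiff M M a x)).

Lemma mul_isotropy_mx a v : v *m isotropy_mx a = mdiff M M a x v.
Proof. by rewrite /isotropy_mx unlock; exact: mul_rV_lin1. Qed.

Lemma isotropy_mx_id : isotropy_mx id = 1%:M.
Proof.
apply/row_matrixP => i; rewrite !rowE mulmx1; apply: etrans (mul_isotropy_mx _ _) _.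
exact: mdiff_id.
Qed.

Lemma isotropy_mx_comp a b : isotropy x a -> isotropy x b ->
  isotropy_mx (a \o b) = isotropy_mx b *m isotropy_mx a.
Proof.
move=> [Ga ax] [Gb bx]; apply/row_matrixP => i; rewrite !rowE mulmxA.
apply: etrans (mul_isotropy_mx _ _) _.
apply: etrans (mdiff_comp_at _ bx (group_msmooth x Gb) (group_msmooth x Ga)) _.
by rewrite !mul_isotropy_mx.
Qed.

Lemma isotropy_mx_unit a : isotropy x a -> isotropy_mx a \in unitmx.
Proof.
move=> ia; have [b [ib ab ba]] := isotropy_inv ia.
have : isotropy_mx a *m isotropy_mx b = 1%:M.
  by rewrite -isotropy_mx_comp// (_ : b \o a = id) ?isotropy_mx_id//; apply/funext.
by move: (isotropy_mx a) (isotropy_mx b) => P P' /mulmx1_unit[].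
Qed.

(** Right translation serves the equivariance of the averaged chart, left translation the invariance
    of an averaged tangent vector. *)
Lemma isotropy_perm (s : seq (oc_space c -> oc_space c)) b : uniq s ->
  isotropy x = [set` s] -> isotropy x b ->
  perm_eq [seq a \o b | a <- s] s /\ perm_eq [seq b \o a | a <- s] s.
Proof.
move=> us sE ib; have [b' [ib' bb' b'b]] := isotropy_inv ib.
have memE a : a \in s <-> isotropy x a by rewrite sE.
have key f g : cancel f g -> cancel g f -> (forall a, isotropy x a -> isotropy x (f a)) ->
    (forall a, isotropy x a -> isotropy x (g a)) -> perm_eq [seq f a | a <- s] s.
  move=> fK gK fi gi; apply: uniq_perm; rewrite ?(map_inj_uniq (can_inj fK))// => a.
  apply/mapP/idP => [[a' /memE ia ->]|/memE ia]; first exact/memE/fi.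
  by exists (g a); [exact/memE/gi|rewrite gK].
split.
- apply: (key (fun a => a \o b) (fun a => a \o b')).
  + by move=> a; apply/funext => z /=; rewrite b'b.
  + by move=> a; apply/funext => z /=; rewrite bb'.
  + by move=> a ia; exact: isotropy_comp.
  + by move=> a ia; exact: isotropy_comp.
- apply: (key (fun a => b \o a) (fun a => b' \o a)).
  + by move=> a; apply/funext => z /=; rewrite bb'.
  + by move=> a; apply/funext => z /=; rewrite b'b.
  + by move=> a ia; exact: isotropy_comp.
  + by move=> a ia; exact: isotropy_comp.
Qed.

End isotropy_representation.

Section linearization.
Variables (R : realType) (n : nat) (Q : topologicalType) (c : orbichart R n Q).
Variable x : oc_space c.
Let M := oc_mfd c.
Local Notation A := (@isotropy_mx R n Q c x).

(* Averaging a chart over the isotropy group makes it equivariant. *)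
Lemma equivariant_chart : exists U F, [/\ isotropy_nbhd x U,
  (forall z, U z -> msmooth M (rV_mfd R n) F z), F x = 0,
  (forall a z, isotropy x a -> F (a z) = F z *m A a) &
  exists G : 'rV[R]_n -> oc_space c, [/\ open (F @` U), forall z, U z -> G (F z) = z &
    forall w, (F @` U) w -> msmooth (rV_mfd R n) M G w]].
Proof.
have [s us sE] := isotropy_enum x.
have memE a : a \in s <-> isotropy x a by rewrite sE.
have s_gt0 : (0 < size s)%N.
  by have /memE := isotropy_id x; case: (s).
have sR0 : (size s)%:R != 0 :> R by rewrite pnatr_eq0 -lt0n.
pose phi := chart_at M x; set x0 := mc_fwd phi x.
have Mphi : mf_atlas M phi by exact: mf_atlas_chart_at.
have phix : mc_dom phi x by exact: mc_dom_chart_at.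
have [U0 [oU0 U0x aU0 _] U0phi] := isotropy_nbhd_exists (near_mc_dom phix).
have U0a a z : isotropy x a -> U0 z -> U0 (a z) by move=> ia Uz; rewrite -(aU0 a ia); exists z.
(* Bochner's average: the factor [invmx (A a)] undoes the differential of [a], so each summand has
   the identity as derivative at [x], while reindexing by right translation makes the sum
   equivariant. *)
pose F z := (size s)%:R^-1 *: \sum_(a <- s) (mc_fwd phi (a z) - x0) *m invmx (A a).
have FA b z : isotropy x b -> F (b z) = F z *m A b.
  move=> ib; rewrite /F -scalemxAl; congr (_ *: _).
  rewrite mulmx_suml -[in RHS](perm_big _ (isotropy_perm us sE ib).1) big_map.
  rewrite big_seq [in RHS]big_seq; apply: eq_bigr => a /memE ia /=.
  have Aab : A (a \o b) = A b *m A a by exact: isotropy_mx_comp.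
  have uab : A b *m A a \in unitmx.
    by rewrite -Aab; apply: isotropy_mx_unit; exact: isotropy_comp.
  rewrite Aab -mulmxA; congr (_ *m _).
  have ua : A a \in unitmx by exact: isotropy_mx_unit.
  have ub : A b \in unitmx by exact: isotropy_mx_unit.
  exact: (invmx_cancel ua ub).
have Fx : F x = 0.
  rewrite /F big_seq big1 ?scaler0// => a /memE[_ ax].
  by rewrite ax subrr mul0mx.
pose f := F \o mc_bwd phi.
have sf z : U0 z -> smooth_at f (mc_fwd phi z).
  move=> Uz; have sfa a : a \in s -> smooth_at (in_charts phi phi a) (mc_fwd phi z).
    move=> /memE ia; have := @msmooth_in_charts _ _ _ _ _ _ _ _ _ phi phi
      (group_msmooth z (proj1 ia)) Mphi Mphi (U0phi _ Uz) (U0phi _ (U0a _ _ ia Uz)).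
    by [].
  apply: smooth_atZ.
  apply: (smooth_at_sum_in (F := fun a y => (in_charts phi phi a y - x0) *m invmx (A a))).
  move=> a /sfa sa; apply: smooth_at_mulmx; last exact: smooth_at_cst.
  by apply: smooth_atD => //; exact: smooth_at_cst.
have sF z : U0 z -> msmooth M (rV_mfd R n) F z.
  move=> Uz; have phz := U0phi _ Uz.
  have s1 : msmooth M (rV_mfd R n) (f \o mc_fwd phi) z.
    apply: (msmooth_comp (N := rV_mfd R n)); first exact: msmooth_fwd.
    exact/msmooth_rVP/sf.
  apply: near_eq_msmooth s1; apply: filterS (near_mc_dom phz) => z' hz'.
  by rewrite /f /= mc_fwdK.
have df v : 'D_v f x0 = v.
  have sterm a : a \in s -> smooth_at (in_charts phi phi a) x0.
    move=> /memE[Ga ax]; apply: (msmooth_in_charts (group_msmooth x Ga) Mphi Mphi phix).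
    by rewrite ax.
  pose G a y := (in_charts phi phi a y - x0) *m invmx (A a).
  have sG a : a \in s -> smooth_at (fun y => in_charts phi phi a y - x0) x0.
    by move=> /sterm sa; apply: smooth_atD => //; exact: smooth_at_cst.
  have dG a : a \in s -> differentiable (G a) x0.
    move=> sa; apply/smooth_at_differentiable/smooth_at_mulmx; first exact: sG.
    exact: smooth_at_cst.
  have DG a : a \in s -> 'D_v (G a) x0 = v.
    move=> sa; have /memE ia := sa; rewrite derive_mulmxr; last exact: sG.
    have da := smooth_at_differentiable (sterm a sa).
    have -> : 'D_v (fun y => in_charts phi phi a y - x0) x0 = v *m A a.
      rewrite (deriveB (diff_derivable da)); last exact: derivable_cst.
      rewrite derive_cst subr0 mul_isotropy_mx.
      exact: esym (mdiffE_at v ia.2 (group_msmooth x ia.1)).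
    by rewrite mulmxK//; exact: isotropy_mx_unit.
  have [dS eS] := derive_sum_seq v dG.
  have -> : f = fun y => (size s)%:R^-1 *: \sum_(a <- s) G a y by [].
  rewrite (deriveZ _ (diff_derivable dS)) eS big_seq (eq_bigr (fun=> v)); last first.
    by move=> a /DG.
  have -> : \sum_(a <- s | a \in s) v = (size s)%:R *: v.
    rewrite -big_seq big_const_seq count_predT scaler_nat.
    by elim: (size s) => [|N IH] /=; rewrite ?mulr0n// IH mulrS.
  by rewrite scalerA mulVf// scale1r.
pose D := mc_fwd phi @` U0.
have oD : open D by apply: mc_fwd_open.
have Dx0 : D x0 by exists x.
have sD : smooth_on D f by apply: smooth_at_on => _ [z Uz <-]; exact: sf.
have [V [g [oV Vx0 VD oW [gK sg]]]] := inverse_function oD Dx0 sD df.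
have phV y : V y -> mc_img phi y by move=> /VD[z /U0phi hz <-]; exact: mc_img_fwd.
have xV : nbhs x (mc_bwd phi @` V).
  apply: open_nbhs_nbhs; split; first exact: mc_bwd_open.
  by exists x0 => //; exact: mc_fwdK.
(* The domain supplied by the inverse function theorem need not be stable under the isotropy group,
   hence this second shrinking. *)
have [U nU UV] := isotropy_nbhd_exists xV; have [oU _ _ _] := nU.
have FU z : U z -> exists y, [/\ V y, mc_bwd phi y = z & F z = f y].
  by move=> /UV[y Vy <-]; exists y.
have gF z : U z -> mc_bwd phi (g (F z)) = z.
  by move=> /FU[y [Vy yz ->]]; rewrite gK.
have FUW : F @` U `<=` f @` V.
  by move=> _ [z /FU[y [Vy yz ->]] <-]; exists y.
have UU0 : U `<=` U0.
  move=> z /UV[y /VD[z' Uz' <-] <-]; rewrite mc_fwdK//; exact: U0phi.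
have sG w : (f @` V) w -> msmooth (rV_mfd R n) M (mc_bwd phi \o g) w.
  move=> Ww; apply: (msmooth_comp (N := rV_mfd R n)).
    by apply/msmooth_rVP; exact: smooth_on_at oW sg Ww.
  by apply: msmooth_bwd => //; apply: phV; case: Ww => y Vy <-; rewrite gK.
have GK z : U z -> (mc_bwd phi \o g) (F z) = z by exact: gF.
have oFU : open (F @` U).
  have -> : F @` U = f @` V `&` (mc_bwd phi \o g) @^-1` U.
    apply/seteqP; split=> w.
      by move=> Fw; split; [exact: FUW|case: Fw => z Uz <-; rewrite /preimage /= gF].
    move=> [[y Vy <-]]; rewrite /preimage /= gK; last exact: Vy.
    by move=> Uy; exists (mc_bwd phi y).
  rewrite openE => w [Ww Uw]; apply: filterI; first exact: open_nbhs_nbhs.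
  by apply: (msmooth_continuous (sG _ Ww)); exact: open_nbhs_nbhs.
exists U, F; split.
- exact: nU.
- by move=> z /UU0; exact: sF.
- exact: Fx.
- by move=> a z; exact: FA.
- exists (mc_bwd phi \o g); split; [exact: oFU|exact: GK|].
  by move=> w /FUW; exact: sG.
Qed.

(** A ball for the maximum norm need not be stable under the matrices [A a], whereas a ball of the
    invariant form is. Its preimage under the equivariant chart is thus an isotropy neighbourhood,
    and [rho] commutes with the matrices because its scalar factor depends on the form only. *)
Theorem linearization : exists psi psi', [/\ psi 0 = x,
  forall v, msmooth (rV_mfd R n) M psi v, forall v, psi' (psi v) = v,
  forall z, range psi z -> msmooth M (rV_mfd R n) psi' z &
  isotropy_nbhd x (range psi) /\
  forall a v, isotropy x a -> psi (v *m A a) = a (psi v)].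
Proof.
have [U [F [nU sF Fx FA [G [oW GK sG]]]]] := equivariant_chart.
have [oU Ux aU aU0] := nU.
have [s us sE] := isotropy_enum x.
have memE a : a \in s <-> isotropy x a by rewrite sE.
pose L := [seq A a | a <- s].
have AL a : isotropy x a -> A a \in L by move=> /memE; exact: map_f.
have L1 : 1%:M \in L by rewrite -(isotropy_mx_id x); apply: AL; exact: isotropy_id.
have LM B : B \in L -> perm_eq [seq B *m C | C <- L] L.
  move=> /mapP[b /memE ib ->].
  have -> : [seq A b *m C | C <- L] = [seq A a | a <- [seq a \o b | a <- s]].
    rewrite /L -!map_comp; apply/eq_in_map => a /memE ia /=.
    by rewrite isotropy_mx_comp.
  exact: (perm_map A (isotropy_perm us sE ib).1).
pose q := group_form L.
have [e e0 eW] : exists2 e : R, 0 < e & ball 0 e `<=` F @` U.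
  have : nbhs (0 : 'rV[R]_n) (F @` U).
    by apply: open_nbhs_nbhs; split=> //; exists x.
  by move=> /nbhs_ballP[e /= e0 eW]; exists e.
have qW w : q w < e ^+ 2 -> (F @` U) w.
  move=> qw; apply: eW; rewrite -ball_normE /= sub0r normrN.
  rewrite -ltr_sqr ?nnegrE ?(ltW e0)//.
  by apply: le_lt_trans qw; exact: group_form_norm.
have [rho [sigma [srho ssigma rhoK sigmaK [rho0 rhoM]]]] := radial_diffeo LM e0.
pose psi v := G (rho v); pose psi' z := sigma (F z).
have rW v : (F @` U) (rho v) by apply: qW; have [] := rhoK v.
have FG w : (F @` U) w -> F (G w) = w by move=> [z Uz <-]; rewrite GK.
have GU w : (F @` U) w -> U (G w) by move=> [z Uz <-]; rewrite GK.
have rangeE : range psi = [set z | U z /\ q (F z) < e ^+ 2].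
  apply/seteqP; split=> [_ [v _ <-]|z [Uz qz]] /=.
    by rewrite FG//; split; [exact: GU|have [] := rhoK v].
  by exists (sigma (F z)) => //; rewrite /psi sigmaK// GK.
have Ua a z : isotropy x a -> U z -> U (a z) by move=> ia Uz; rewrite -(aU a ia); exists z.
have qF a z : isotropy x a -> q (F (a z)) = q (F z).
  by move=> ia; rewrite FA// /q (group_formM LM)//; exact: AL.
have Ra a : isotropy x a -> a @` range psi `<=` range psi.
  by move=> ia _ [z + <-]; rewrite !rangeE /= qF// => -[Uz qz]; split=> //; exact: Ua.
exists psi, psi'; split.
- have G0 : (F @` U) 0 by exists x.
  by rewrite /psi rho0 -Fx GK.
- move=> v; apply: (msmooth_comp (N := rV_mfd R n)); last exact: sG.
  exact/msmooth_rVP.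
- by move=> v; rewrite /psi' /psi FG//; have [_] := rhoK v.
- move=> z; rewrite rangeE => -[Uz qz]; apply: (msmooth_comp (N := rV_mfd R n)).
    exact: sF.
  by apply/msmooth_rVP; exact: ssigma.
- split.
    split.
    + rewrite rangeE openE => z [Uz qz]; apply: filterI; first exact: open_nbhs_nbhs.
      have cq : {for z, continuous (q \o F)}.
        apply: continuous_comp; first exact: msmooth_continuous (sF _ Uz).
        exact: smooth_at_continuous (smooth_at_group_form _ _).
      have nq : nbhs ((q \o F) z) [set r | r < e ^+ 2].
        by apply: open_nbhs_nbhs; split=> //; exact: open_lt.
      exact: cq nq.
    + by rewrite rangeE; split=> //; rewrite Fx /q group_form0 exprn_gt0.
    + move=> a ia; apply/seteqP; split; first exact: Ra.
      have [b [ib ab ba]] := isotropy_inv ia.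
      by move=> z Rz; exists (b z); [apply: (Ra b ib); exists z|exact: ba].
    + move=> a Ga nax; rewrite -subset0 => z [[y + <-]]; rewrite !rangeE => -[Uy _] [Uay _].
      by rewrite -(aU0 a Ga nax); split=> //; exists y.
  move=> a v ia; rewrite /psi (rhoM _ _ (AL _ ia)).
  have {1}-> : rho v = F (G (rho v)) by rewrite FG.
  by rewrite -FA// GK//; apply: Ua => //; exact: GU.
Qed.

End linearization.

(** * The orbifold chart on a Euclidean space *)

Section rV_simply_connected.
Variables (R : realType) (n : nat).

(** Precomposition with the retraction of the line onto the unit interval makes a path globally
    continuous, so the contracting homotopy can be built from continuous maps on the whole plane. *)
Lemma continuous_clamp (V : topologicalType) (p : R -> V) :
  {within `[0, 1], continuous p} -> continuous (fun t : R => p (Num.max 0 (Num.min 1 t))).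
Proof.
move=> cp t; set cl := fun t : R => Num.max 0 (Num.min 1 t).
have I01 s : `[(0 : R), 1]%classic (cl s).
  by rewrite /cl /= in_itv /= le_max lexx /= ge_max ler01 ge_min lexx.
have ccl : continuous cl.
  move=> s; apply: (@continuous_max R R (cst 0) (fun s => Num.min 1 s)).
    exact: cst_continuous.
  by apply: (@continuous_min R R (cst 1) id); [exact: cst_continuous|exact: cvg_id].
move=> A /(cp (cl t)) h0.
have h : \forall s \near cl t, `[(0 : R), 1]%classic s -> A (p s).
  by move: h0; rewrite /nbhs /= -nbhs_subspace_in// => h0; exact: h0.
suff : \forall s \near t, A (p (cl s)) by [].
have : \forall s \near t, `[(0 : R), 1]%classic (cl s) -> A (p (cl s)) by exact: ccl h.
by apply: filterS => s; apply.
Qed.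

Lemma rV_simply_connected : simply_connected R 'rV[R]_n.
Proof.
split=> [I x y|p cp p01].
  exists (fun t => x + t *: (y - x)); split.
  - apply: continuous_subspaceT => t.
    have -> : (fun t : R => x + t *: (y - x)) = cst x \+ (fun t => t *: (y - x)) by [].
    by apply: continuousD; [exact: cst_continuous|exact: scalel_continuous].
  - by rewrite scale0r addr0.
  - by rewrite scale1r addrC subrK.
pose q (t : R) := p (Num.max 0 (Num.min 1 t)).
have cq : continuous q by exact: continuous_clamp.
have qE t : `[(0 : R), 1]%classic t -> q t = p t.
  by rewrite /= in_itv /= => /andP[t0 t1]; rewrite /q min_r// max_r.
have I0 : `[(0 : R), 1]%classic 0 by rewrite /= in_itv /= lexx ler01.
have I1 : `[(0 : R), 1]%classic 1 by rewrite /= in_itv /= lexx ler01.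
exists (fun z : R * R => (1 - z.1) *: (q z.2 - p 0) + p 0); split.
- apply: continuous_subspaceT => z.
  apply: (@continuousD _ _ _ (fun z : R * R => (1 - z.1) *: (q z.2 - p 0)) (cst (p 0))).
    apply: (@cvgZ _ _ _ (nbhs z)).
      by apply: cvgB; [exact: cvg_cst|exact: cvg_fst].
    apply: cvgB; last exact: cvg_cst.
    by apply: (@continuous_comp _ _ _ snd q); [exact: cvg_snd|exact: cq].
  exact: cst_continuous.
- move=> t It; rewrite /= subr0 scale1r subrK qE// subrr scale0r add0r; split=> //.
- by move=> s Is; rewrite /= !qE// -p01 subrr scaler0 add0r.
Qed.

End rV_simply_connected.

(** The rows of [B] are a basis of [E], and [C] gives the coordinate functionals, which are defined
    on the whole space; [C *m B] is then a projector onto [E]. *)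
Lemma vspace_coordinates (F : fieldType) n (E : {vspace 'rV[F]_n}) :
  exists (B : 'M[F]_(\dim E, n)) (C : 'M[F]_(n, \dim E)), B *m C = 1%:M /\
  forall v, (v \in E) = (v *m C *m B == v).
Proof.
pose b := vbasis E; pose B : 'M[F]_(\dim E, n) := \matrix_i b`_i.
pose C : 'M[F]_(n, \dim E) := \matrix_(j, i) coord b i (delta_mx 0 j).
have CE v i : (v *m C) 0 i = coord b i v.
  rewrite mxE [in RHS](row_sum_delta v) linear_sum; apply: eq_bigr => j _.
  by rewrite mxE linearZ.
have BE u : u *m B = \sum_i u 0 i *: b`_i.
  by rewrite mulmx_sum_row; apply: eq_bigr => i _; rewrite rowK.
have fb : free b by exact: basis_free (vbasisP E).
exists B, C; split.
  apply/row_matrixP => i; rewrite row_mul rowK; apply/rowP => j.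
  by rewrite CE coord_free// row1 mxE eqxx /= eq_sym.
move=> v; apply/idP/eqP => [vE|<-].
  rewrite BE [RHS](coord_vbasis vE); apply: eq_bigr => i _.
  by rewrite CE.
rewrite BE; apply: memv_suml => i _; apply: memvZ; apply: vbasis_mem.
by rewrite mem_nth// size_tuple.
Qed.

Section linear_chart.
Variables (R : realType) (n : nat) (Q : topologicalType) (c : orbichart R n Q).
Variables (x : oc_space c) (psi : 'rV[R]_n -> oc_space c) (psi' : oc_space c -> 'rV[R]_n).
Local Notation M := (oc_mfd c).
Local Notation A := (@isotropy_mx R n Q c x).
Hypothesis psi0 : psi 0 = x.
Hypothesis psi_smooth : forall v, msmooth (rV_mfd R n) M psi v.
Hypothesis psiK : forall v, psi' (psi v) = v.
Hypothesis psi'_smooth : forall z, range psi z -> msmooth M (rV_mfd R n) psi' z.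
Hypothesis psi_nbhd : isotropy_nbhd x (range psi).
Hypothesis psi_equiv : forall a v, isotropy x a -> psi (v *m A a) = a (psi v).

Definition linear_group : set ('rV[R]_n -> 'rV[R]_n) :=
  [set (fun v => v *m A a) | a in isotropy x].

Let group_fin : finite_set linear_group.
Proof. exact/finite_image/isotropy_finite. Qed.

Let group_id : linear_group id.
Proof.
exists id; first exact: isotropy_id.
by apply/funext => v; rewrite isotropy_mx_id mulmx1.
Qed.

Let group_comp f g : linear_group f -> linear_group g -> linear_group (f \o g).
Proof.
move=> [a ia <-] [b ib <-]; exists (a \o b); first exact: isotropy_comp.
by apply/funext => v; rewrite isotropy_mx_comp//= mulmxA.
Qed.

Let mxK a b : isotropy x a -> isotropy x b -> cancel a b -> A a *m A b = 1%:M.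
Proof.
move=> ia ib ab; rewrite -isotropy_mx_comp// (_ : b \o a = id) ?isotropy_mx_id//.
exact/funext.
Qed.

Let group_inv f : linear_group f -> exists g, [/\ linear_group g, cancel f g & cancel g f].
Proof.
move=> [a ia <-]; have [b [ib ab ba]] := isotropy_inv ia.
exists (fun v => v *m A b); split; first by exists b.
  by move=> v; rewrite -mulmxA mxK// mulmx1.
by move=> v; rewrite -mulmxA mxK// mulmx1.
Qed.

Let group_smooth f : linear_group f -> smooth_map (rV_mfd R n) (rV_mfd R n) setT f.
Proof.
move=> [a ia <-]; apply/smooth_mapP; first exact: openT.
by move=> v _; apply/msmooth_rVP; exact: smooth_at_mulmxr.
Qed.

Let proj := oc_proj c \o psi.

Let open_psi (U : set 'rV[R]_n) : open U -> open (psi @` U).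
Proof.
move=> oU; have [oW _ _ _] := psi_nbhd.
have -> : psi @` U = range psi `&` psi' @^-1` U.
  apply/seteqP; split=> [_ [u Uu <-]|_ [[u _ <-]]].
    by split; [exists u|rewrite /= psiK].
  by rewrite /= psiK => Uu; exists u.
rewrite openE => z [Wz Uz]; apply: filterI; first exact: open_nbhs_nbhs.
by apply: (msmooth_continuous (psi'_smooth Wz)); exact: open_nbhs_nbhs.
Qed.

Let cont_proj : continuous proj.
Proof.
move=> v; apply: continuous_comp; first exact: msmooth_continuous (psi_smooth v).
exact: proj_continuous.
Qed.

Let open_proj (U : set 'rV[R]_n) : open U -> open (proj @` U).
Proof. by move=> oU; rewrite -image_comp; apply: proj_open; exact: open_psi. Qed.

Let open_range : open (range proj).
Proof. by apply: open_proj; exact: openT. Qed.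

Let fiber u v : proj u = proj v <-> exists2 f, linear_group f & f u = v.
Proof.
split=> [/oc_fiber[a Ga auv]|[_ [a ia <-] <-]]; last first.
  by rewrite /proj /= psi_equiv// proj_group//; case: ia.
have [_ _ _ disj] := psi_nbhd.
(* A group element joining two points of [range psi] must fix [x], since the other translates of
   that set are disjoint from it. *)
have ia : isotropy x a.
  split=> //; apply: contrapT => nax; have := disj a Ga nax.
  rewrite -subset0 => /(_ (psi v)); apply; split; last by exists v.
  by exists (psi u) => //; exists u.
exists (fun w => w *m A a); first by exists a.
by rewrite -[LHS]psiK psi_equiv// auv psiK.
Qed.

Let quotient (V : set Q) : V `<=` range proj -> (open V <-> open (proj @^-1` V)).
Proof.
move=> VR; split=> [oV|oV]; first by move/continuousP : cont_proj; exact.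
have -> : V = proj @` (proj @^-1` V); last exact: open_proj.
apply/seteqP; split=> [q Vq|_ [v Vv <-]//].
by have [v _ vq] := VR q Vq; exists v => //; rewrite /= vq.
Qed.

Definition linear_chart : orbichart R n Q :=
  @OrbiChart R n Q 'rV[R]_n (rV_mfd R n) (@rV_simply_connected R n) linear_group
    group_fin group_id group_comp group_inv group_smooth proj open_range fiber quotient.

Lemma linear_chart_germ (v : oc_space linear_chart) : germ_change v (psi v).
Proof.
have [oW _ _ _] := psi_nbhd.
apply: (@germ_intro _ _ _ linear_chart c setT psi) => //.
apply: (@diffeo_intro _ _ _ _ (rV_mfd R n) M setT (range psi) psi psi') => //.
- exact: openT.
- by move=> _ [v' _ <-]; rewrite psiK.
Qed.

Lemma mdiff_linear_group a v u : mdiff (rV_mfd R n) (rV_mfd R n) (fun v => v *m A a) v u = u *m A a.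
Proof. by rewrite mdiff_rV; exact: diff_mulmxr. Qed.

End linear_chart.

(** * Slices: Euclidean parametrizations of the strata *)

Section slices.
Variables (R : realType) (n : nat) (Q : orbifold R n) (k : nat).
Implicit Types c d : orbichart R n Q.

(* [E] parametrizes the part of the stratum [Sigma k] in [W], with retraction [r]. *)
Definition slice c (W : set (oc_space c)) (E : 'rV[R]_k -> oc_space c)
    (r : oc_space c -> 'rV[R]_k) :=
  [/\ orbifold_chart c, open W,
      forall u, [/\ W (E u), msmooth (rV_mfd R k) (oc_mfd c) E u & r (E u) = u],
      forall z, W z -> msmooth (oc_mfd c) (rV_mfd R k) r z &
      (forall z, W z -> (Sigma Q k (oc_proj c z) <-> E (r z) = z)) /\
      (forall z u, W z -> oc_proj c z = oc_proj c (E u) -> z = E u)].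

End slices.

Section local_slices.
Variables (R : realType) (n : nat) (Q : orbifold R n) (c : orbichart R n Q).
Variables (x : oc_space c) (psi : 'rV[R]_n -> oc_space c) (psi' : oc_space c -> 'rV[R]_n).
Local Notation M := (oc_mfd c).
Local Notation A := (@isotropy_mx R n Q c x).
Hypothesis Qc : orbifold_chart c.
Hypothesis psi0 : psi 0 = x.
Hypothesis psi_smooth : forall v, msmooth (rV_mfd R n) M psi v.
Hypothesis psiK : forall v, psi' (psi v) = v.
Hypothesis psi'_smooth : forall z, range psi z -> msmooth M (rV_mfd R n) psi' z.
Hypothesis psi_nbhd : isotropy_nbhd x (range psi).
Hypothesis psi_equiv : forall a v, isotropy x a -> psi (v *m A a) = a (psi v).

Local Notation d := (linear_chart psi_smooth psiK psi'_smooth psi_nbhd psi_equiv).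

Lemma linear_chart_orbifold_chart : orbifold_chart d.
Proof.
move=> i; apply: germ_compatible => v y vy.
have g1 := linear_chart_germ v.
have g2 : germ_change (psi v) y by apply: compatible_germ; [exact: Qc|exact: vy].
exact: germ_trans g1 g2.
Qed.

Lemma linear_chart_isotropy0 : isotropy (c := d) (0 : 'rV[R]_n) = oc_group d.
Proof.
apply/seteqP; split=> [f []//|f df]; split=> //.
by case: df => a ia <-; rewrite mul0mx.
Qed.

Variable E : {vspace 'rV[R]_n}.
Hypothesis fixE : fixed_tangent (c := d) (0 : 'rV[R]_n) = [set v | v \in E].

(** A linear map is its own differential at every point, and the isotropy of [v] consists of the
    matrices fixing [v]. *)
Lemma fixed_tangentP (v : 'rV[R]_n) u : fixed_tangent (c := d) v u <->
  forall a, isotropy x a -> v *m A a = v -> u *m A a = u.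
Proof.
split=> [fu a ia va|fu f [[a ia <-] va]]; last first.
  exact: etrans (@mdiff_linear_group R n Q c x a v u) (fu a ia va).
apply: etrans (esym (@mdiff_linear_group R n Q c x a v u)) (fu (fun w => w *m A a) _).
by split; [exists a|exact: va].
Qed.

Lemma mem_fixedP v : v \in E <-> forall a, isotropy x a -> v *m A a = v.
Proof.
have -> : (v \in E) = fixed_tangent (c := d) (0 : 'rV[R]_n) v :> Prop by rewrite fixE.
rewrite fixed_tangentP; split=> [fv a ia|fv a ia _]; last exact: fv.
by apply: fv => //; rewrite mul0mx.
Qed.

(** The isotropy at [v] is part of the whole linear group, so the fixed space [E1] at [v] contains
    [E]. Equal dimensions force equality, and [v] belongs to [E1] because its own isotropy fixes
    it. *)
Lemma Sigma_mem_fixed v : Sigma Q (\dim E) (oc_proj c (psi v)) <-> v \in E.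
Proof.
have -> : oc_proj c (psi v) = oc_proj d v by [].
rewrite (Sigma_fixed_dim _ _ linear_chart_orbifold_chart); split.
  move=> [E1 [dE1 e1]]; suff <- : E1 = E.
    have : [set w | w \in E1] v; last by [].
    by rewrite -e1; apply/fixed_tangentP.
  apply/esym/eqP; rewrite eqEdim dE1 leqnn andbT; apply/subvP => w /mem_fixedP fw.
  have : [set w | w \in E1] w; last by [].
  by rewrite -e1; apply/fixed_tangentP => a ia _; exact: fw.
move=> /mem_fixedP fv; exists E; split=> //; apply/seteqP; split=> w /=.
  move=> /fixed_tangentP fw; apply/mem_fixedP => a ia.
  by apply: fw => //; exact: fv.
by move=> /mem_fixedP fw; apply/fixed_tangentP => a ia _; exact: fw.
Qed.

Lemma proj_fixed_inj v w : w \in E -> oc_proj c (psi v) = oc_proj c (psi w) -> v = w.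
Proof.
move=> /mem_fixedP fw e.
have /oc_fiber[f [a ia <-]] : oc_proj d w = oc_proj d v by exact: esym e.
by rewrite fw.
Qed.

(** One slice lives in the linear chart, whose group is the full isotropy group, the other in the
    original chart; they serve the two clauses of [natural_structure]. *)
Lemma linear_slices : exists (u : 'rV[R]_(\dim E) -> 'rV[R]_n) (r : 'rV[R]_n -> 'rV[R]_(\dim E)),
  [/\ slice (c := d) setT u r, slice (range psi) (psi \o u) (r \o psi'),
   forall v, fixed_points (c := d) (oc_group d) v <-> u (r v) = v &
   forall z, range psi z -> (fixed_points (isotropy x) z <-> (psi \o u) ((r \o psi') z) = z)].
Proof.
have [B [C [BC EBC]]] := vspace_coordinates E.
have BE u : u *m B \in E by rewrite EBC -(mulmxA u) BC mulmx1.
have [oW _ _ _] := psi_nbhd.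
have fE v : v *m C *m B = v <-> v \in E by rewrite EBC; split=> [->|/eqP].
exists (fun u => u *m B), (fun v => v *m C); split.
- split.
  + exact: linear_chart_orbifold_chart.
  + exact: openT.
  + move=> u; split; [exact: I| |by rewrite -mulmxA BC mulmx1].
    apply/msmooth_rVP; exact: smooth_at_mulmxr.
  + move=> z _; apply/msmooth_rVP; exact: smooth_at_mulmxr.
  + split=> [z _|z u _ /proj_fixed_inj]; last by apply; exact: BE.
    by rewrite fE; exact: Sigma_mem_fixed.
- split.
  + exact: Qc.
  + exact: oW.
  + move=> u; split; [by exists (u *m B)| |by rewrite /= psiK -mulmxA BC mulmx1].
    apply: (msmooth_comp (N := rV_mfd R n)); last exact: psi_smooth.
    apply/msmooth_rVP; exact: smooth_at_mulmxr.
  + move=> z Wz; apply: (msmooth_comp (N := rV_mfd R n)); first exact: psi'_smooth.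
    apply/msmooth_rVP; exact: smooth_at_mulmxr.
  + split=> [z [v _ <-]|z u [v _ <-] /=].
      rewrite Sigma_mem_fixed -fE /= psiK; split=> [->//|/(congr1 psi')].
      by rewrite !psiK.
    by move=> /proj_fixed_inj ->.
- move=> v; rewrite fE mem_fixedP; split=> [fv a ia|fv _ [a ia <-]].
    by apply: (fv (fun v => v *m A a)); exists a.
  exact: fv.
- move=> _ [v _ <-]; rewrite /= psiK.
  have -> : fixed_points (isotropy x) (psi v) <-> v \in E.
    rewrite mem_fixedP; split=> fv a ia; last by rewrite -psi_equiv// fv.
    by rewrite -[LHS]psiK psi_equiv// fv.
  rewrite -fE; split=> [->//|/(congr1 psi')].
  by rewrite !psiK.
Qed.

End local_slices.

Theorem local_slices (R : realType) (n : nat) (Q : orbifold R n) (k : nat)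
    (c : orbichart R n Q) (x : oc_space c) :
  orbifold_chart c -> Sigma Q k (oc_proj c x) ->
  (exists (d : orbichart R n Q) y (E : 'rV[R]_k -> oc_space d) r,
     [/\ oc_proj d y = oc_proj c x, isotropy y = oc_group d, slice setT E r &
         forall z, fixed_points (oc_group d) z <-> E (r z) = z]) /\
  (exists W (E : 'rV[R]_k -> oc_space c) r, [/\ isotropy_nbhd x W, slice W E r &
     forall z, W z -> (fixed_points (isotropy x) z <-> E (r z) = z)]).
Proof.
move=> Qc Sx; have [psi [psi' [psi0 spsi psiK spsi' [nW eq]]]] := linearization x.
pose d := linear_chart spsi psiK spsi' nW eq.
have Qd : orbifold_chart d by exact: linear_chart_orbifold_chart.
have px : oc_proj d (0 : 'rV[R]_n) = oc_proj c x.
  by rewrite /= psi0.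
have : Sigma Q k (oc_proj d (0 : 'rV[R]_n)) by rewrite px.
(* The dimension appears in the type of the parametrizing space, so [k] is replaced by [\dim E]
   throughout. *)
move=> /(Sigma_fixed_dim _ _ Qd)[E [dE fE]]; subst k.
have [u [r [s1 s2 f1 f2]]] := linear_slices Qc fE.
split.
  exists d, (0 : 'rV[R]_n), u, r; split.
  - exact: px.
  - exact: linear_chart_isotropy0.
  - exact: s1.
  - exact: f1.
by exists (range psi), (psi \o u), (r \o psi'); split; [exact: nW|exact: s2|exact: f2].
Qed.

Lemma set_type_continuous (S T : topologicalType) (Y : set T) (f : S -> Y) x :
  {for x, continuous (set_val \o f)} -> {for x, continuous f}.
Proof.
move=> cf A [_ /= [[W oW <-] /= Wx] WA].
have : \forall y \near x, W (set_val (f y)) by apply: cf; exact: open_nbhs_nbhs.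
by apply: filterS => y Wy; exact: WA.
Qed.

(** * The manifold structure of the strata *)

Section slice_chart.
Variables (R : realType) (n : nat) (Q : orbifold R n) (k : nat) (c : orbichart R n Q).
Variables (W : set (oc_space c)) (E : 'rV[R]_k -> oc_space c) (r : oc_space c -> 'rV[R]_k).
Hypothesis s : slice W E r.
Local Notation M := (oc_mfd c).

Lemma slice_mem u : W (E u). Proof. by have [_ _ /(_ u)[]] := s. Qed.
Lemma slice_smooth u : msmooth (rV_mfd R k) M E u. Proof. by have [_ _ /(_ u)[]] := s. Qed.
Lemma slice_retract u : r (E u) = u. Proof. by have [_ _ /(_ u)[]] := s. Qed.
Lemma slice_retract_smooth z : W z -> msmooth M (rV_mfd R k) r z.
Proof. by have [_ _ _ /(_ z)] := s. Qed.
Lemma slice_open : open W. Proof. by case: s. Qed.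
Lemma slice_orbifold_chart : orbifold_chart c. Proof. by case: s. Qed.
Lemma slice_Sigma z : W z -> Sigma Q k (oc_proj c z) <-> E (r z) = z.
Proof. by have [_ _ _ _ [H _]] := s => /H. Qed.
Lemma slice_proj_inj z u : W z -> oc_proj c z = oc_proj c (E u) -> z = E u.
Proof. by have [_ _ _ _ [_ H]] := s; exact: H. Qed.

Lemma slice_in_Sigma u : oc_proj c (E u) \in Sigma Q k.
Proof. by apply/mem_set/(slice_Sigma (slice_mem u)); rewrite slice_retract. Qed.

Definition slice_bwd u : Sigma Q k := exist _ (oc_proj c (E u)) (slice_in_Sigma u).
Definition slice_dom : set (Sigma Q k) := [set q | exists u, oc_proj c (E u) = set_val q].
(** The parameter is unique where it exists, by [slice_proj_inj]; the default 0 only concerns points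
    outside [slice_dom]. *)
Definition slice_fwd (q : Sigma Q k) : 'rV[R]_k := xget 0 [set u | oc_proj c (E u) = set_val q].

Lemma slice_domP q : slice_dom q <-> stratum_in W q.
Proof.
split=> [[u uq]|[z Wz zq]]; first by exists (E u) => //; exact: slice_mem.
exists (r z); rewrite (slice_Sigma Wz).1//.
by rewrite zq; exact: set_valP.
Qed.

Lemma proj_slice_fwd q : slice_dom q -> oc_proj c (E (slice_fwd q)) = set_val q.
Proof. by move=> [u uq]; rewrite /slice_fwd; case: xgetP => [//|/(_ u)]. Qed.

Lemma slice_fwdE q u : oc_proj c (E u) = set_val q -> slice_fwd q = u.
Proof.
move=> uq; have dq : slice_dom q by exists u.
rewrite -[LHS]slice_retract -[RHS]slice_retract; congr r.
by apply: slice_proj_inj; [exact: slice_mem|rewrite proj_slice_fwd].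
Qed.

Lemma slice_bwdK u : slice_fwd (slice_bwd u) = u. Proof. exact: slice_fwdE. Qed.

Lemma slice_fwdK q : slice_dom q -> slice_bwd (slice_fwd q) = q.
Proof. by move=> dq; apply: val_inj; exact: proj_slice_fwd. Qed.

Let dom_open : open slice_dom.
Proof.
have -> : slice_dom = set_val @^-1` (oc_proj c @` W).
  by apply/seteqP; split=> q /slice_domP.
by exists (oc_proj c @` W) => //; apply: proj_open; exact: slice_open.
Qed.

Let imgT : slice_fwd @` slice_dom = setT.
Proof.
apply/seteqP; split=> // u _; exists (slice_bwd u); last exact: slice_bwdK.
by exists u.
Qed.

Let img_open : open (slice_fwd @` slice_dom).
Proof. by rewrite imgT; exact: openT. Qed.

Let fwd_cont q : slice_dom q -> {for q, continuous slice_fwd}.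
Proof.
move=> dq U; rewrite nbhsE => -[V [oV Vq] VU].
(* A stratum point over [z] in [W] has [E (r z) = z], so its parameter is [r z]; continuity thus
   follows from that of [r] and from openness of the projection. *)
suff : nbhs q (set_val @^-1` (oc_proj c @` (W `&` r @^-1` V))).
  apply: filterS => p [z [Wz Vz] zp]; apply: VU.
  have Ez : E (r z) = z by apply/(slice_Sigma Wz); rewrite zp; exact: set_valP.
  by rewrite (@slice_fwdE p (r z))// Ez.
apply: open_nbhs_nbhs; split; last first.
  exists (E (slice_fwd q)); last exact: proj_slice_fwd.
  by split; [exact: slice_mem|rewrite /= slice_retract].
exists (oc_proj c @` (W `&` r @^-1` V)) => //; apply: proj_open.
rewrite openE => z [Wz Vz]; apply: filterI.
  by apply: open_nbhs_nbhs; split=> //; exact: slice_open.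
by apply: (msmooth_continuous (slice_retract_smooth Wz)); exact: open_nbhs_nbhs.
Qed.

Let bwd_cont u : (slice_fwd @` slice_dom) u -> {for u, continuous slice_bwd}.
Proof.
move=> _; apply: set_type_continuous.
apply: (@continuous_comp _ _ _ E (oc_proj c)).
  exact: msmooth_continuous (slice_smooth u).
exact: proj_continuous.
Qed.

Definition slice_chart : mchart R k (Sigma Q k) :=
  MChart dom_open img_open slice_fwdK fwd_cont bwd_cont.

Lemma slice_chart_img u : mc_img slice_chart u.
Proof. by suff : (slice_fwd @` slice_dom) u by []; rewrite imgT. Qed.

End slice_chart.

Section stratum_manifold.
Variables (R : realType) (n : nat) (Q : orbifold R n) (k : nat).

Definition slice_atlas : set (mchart R k (Sigma Q k)) :=
  [set m | exists (c : orbichart R n Q) (W : set (oc_space c)) (E : 'rV[R]_k -> oc_space c)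
      (r : oc_space c -> 'rV[R]_k) (s : slice W E r), m = slice_chart s].

Let atlas_cover (q : Sigma Q k) : exists m, slice_atlas m /\ mc_dom m q.
Proof.
have [i [y yq]] := orb_coverP (set_val q).
have Sy : Sigma Q k (oc_proj (orb_chart Q i) y) by rewrite yq; exact: set_valP.
have [_ [W [E [r [[oW Wy _ _] s f]]]]] := local_slices (@orbifold_chart_orb _ _ Q i) Sy.
exists (slice_chart s); split; first by exists (orb_chart Q i), W, E, r, s.
by apply/(slice_domP s); exists y.
Qed.

(** Near [u] the transition map is the composite of [E], a change of charts [h] sending [E u] to
    [E' u'], and the retraction [r']: [h (E v)] lies over the stratum, so [E'] recovers it from its
    retraction. *)
Lemma slice_transition (c d : orbichart R n Q) (W : set (oc_space c)) (W' : set (oc_space d))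
    E E' r r' (s : slice (k := k) W E r) (s' : slice (k := k) W' E' r') u u' :
  oc_proj c (E u) = oc_proj d (E' u') -> smooth_at (slice_fwd E' \o slice_bwd s) u.
Proof.
move=> uu'; have Qc := slice_orbifold_chart s; have Qd := slice_orbifold_chart s'.
have [Wh [h [[_ dh ph] Whu hu]]] := orbifold_chart_germ Qc Qd uu'.
have [h' [oWh _ _ sh _]] := diffeo_elim dh.
have sE := slice_smooth s u; have shu := sh _ Whu.
have W'h : W' (h (E u)) by rewrite hu; exact: slice_mem s' u'.
have sr := slice_retract_smooth s' W'h.
have : smooth_at (r' \o (h \o E)) u.
  apply/msmooth_rVP; apply: (msmooth_comp (N := oc_mfd d)); last exact: sr.
  exact: msmooth_comp sE shu.
apply: near_eq_smooth_at.
have n1 : \forall v \near u, Wh (E v).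
  by apply: (msmooth_continuous sE); exact: open_nbhs_nbhs.
have n2 : \forall v \near u, W' (h (E v)).
  apply: (msmooth_continuous (msmooth_comp sE shu)); apply: open_nbhs_nbhs.
  by split=> //; exact: slice_open s'.
apply: filterS2 n1 n2 => v Whv W'v; apply/esym.
have ev : oc_proj d (h (E v)) = oc_proj c (E v) by exact: ph.
have Er : E' (r' (h (E v))) = h (E v).
  by apply/(slice_Sigma s' W'v); rewrite ev; apply: set_mem; exact: slice_in_Sigma s v.
by apply: (slice_fwdE s'); rewrite Er.
Qed.

Let atlas_compat m m' : slice_atlas m -> slice_atlas m' ->
  smooth_on (mc_fwd m @` (mc_dom m `&` mc_dom m')) (mc_fwd m' \o mc_bwd m).
Proof.
move=> [c [W [E [r [s ->]]]]] [d [W' [E' [r' [s' ->]]]]].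
apply: smooth_at_on => _ [q [[u uq] [u' u'q]] <-] /=.
by rewrite (slice_fwdE s uq); apply: (slice_transition s s' (u' := u')); rewrite uq u'q.
Qed.

Definition stratum_mfd : smooth_manifold R k (Sigma Q k) :=
  SmoothManifold (@Sigma_hausdorff R n Q k) (@Sigma_paracompact R n Q k) atlas_cover atlas_compat.

Lemma slice_chart_atlas c W E r (s : @slice R n Q k c W E r) : mf_atlas stratum_mfd (slice_chart s).
Proof. by exists c, W, E, r, s. Qed.

Section lift.
Variables (c : orbichart R n Q) (W : set (oc_space c)).
Variables (E : 'rV[R]_k -> oc_space c) (r : oc_space c -> 'rV[R]_k) (s : slice W E r).
Local Notation M := (oc_mfd c).

Definition slice_lift : Sigma Q k -> oc_space c := E \o slice_fwd E.

Lemma slice_lift_smooth q : stratum_in W q -> msmooth stratum_mfd M slice_lift q.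
Proof.
move=> /(slice_domP s) dq; apply: (msmooth_comp (N := rV_mfd R k)).
  exact: (msmooth_fwd (slice_chart_atlas s)).
exact: slice_smooth s _.
Qed.

Lemma slice_chart_retract_smooth z : W z -> msmooth M stratum_mfd (slice_bwd s \o r) z.
Proof.
move=> Wz; apply: (msmooth_comp (N := rV_mfd R k)); first exact: slice_retract_smooth s _ Wz.
exact: (msmooth_bwd (slice_chart_atlas s) (slice_chart_img s _)).
Qed.

Lemma proj_slice_lift q : stratum_in W q -> oc_proj c (slice_lift q) = set_val q.
Proof. by move=> /(slice_domP s); exact: proj_slice_fwd. Qed.

Lemma slice_liftK q : stratum_in W q -> (slice_bwd s \o r) (slice_lift q) = q.
Proof. by move=> /(slice_domP s) dq; rewrite /slice_lift /= (slice_retract s) slice_fwdK. Qed.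

Lemma open_stratum_in (V : set (oc_space c)) : open V -> open (stratum_in (k := k) V).
Proof. by move=> oV; exists (oc_proj c @` V) => //; exact: proj_open. Qed.

(** The embedding property rests on two left inverses of the lift: [slice_bwd s \o r] is smooth and
    makes the differential injective, while the continuous projection gives injectivity and the
    subspace topology. *)
Lemma slice_stratum_lift (G : set (oc_space c -> oc_space c)) :
  (forall z, W z -> (fixed_points G z <-> E (r z) = z)) -> stratum_lift stratum_mfd G W slice_lift.
Proof.
move=> GE; have oW := slice_open s; have oS := open_stratum_in oW.
split.
- exact: oW.
- exact: proj_slice_lift.
- apply/seteqP; split=> [_ [q dq <-]|z [Wz /(GE z Wz) Ez]].
    have WE := slice_mem s (slice_fwd E q).
    by split; [exact: WE|apply/(GE _ WE); rewrite (slice_retract s)].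
  exists (slice_bwd s (r z)); first by exists z => //; exact: (congr1 (oc_proj c) (esym Ez)).
  by rewrite /slice_lift /= slice_bwdK.
- split.
  + exact: oS.
  + by apply/smooth_mapP => // q; exact: slice_lift_smooth.
  + move=> q dq u v e.
    have sl := slice_lift_smooth dq.
    have Wl : W (slice_lift q) by exact: slice_mem s _.
    have sb := slice_chart_retract_smooth Wl.
    have hh : \near q, q = ((slice_bwd s \o r) \o slice_lift) q.
      by apply: filterS (open_nbhs_nbhs (conj oS dq)) => p dp; rewrite [RHS]slice_liftK.
    have I w : mdiff M stratum_mfd (slice_bwd s \o r) (slice_lift q)
        (mdiff stratum_mfd M slice_lift q w) = w.
      apply: etrans (esym (mdiff_comp w sl sb)) _.
      by apply: etrans (esym (near_eq_mdiff w hh (msmooth_id _ _))) _; exact: mdiff_id.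
    exact: etrans (esym (I u)) (etrans (congr1 _ e) (I v)).
  + move=> p q /set_mem dp /set_mem dq e; apply: val_inj.
    by rewrite -!set_valE -(proj_slice_lift dp) -(proj_slice_lift dq) e.
  + move=> V [P oP <-] VW; exists (oc_proj c @^-1` P).
      by move/continuousP: (@proj_continuous _ _ _ c); exact.
    apply/seteqP; split=> [_ [q Vq <-]|_ [[q dq <-]] /=].
      by split; [exists q => //; exact: VW|rewrite /= proj_slice_lift//; exact: VW].
    by rewrite proj_slice_lift// => Pq; exists q.
Qed.

End lift.

Theorem stratum_natural_structure : natural_structure stratum_mfd.
Proof.
split=> [p|c x Qc Sx].
  have [i [y yp]] := orb_coverP (set_val p).
  have Sy : Sigma Q k (oc_proj (orb_chart Q i) y) by rewrite yp; exact: set_valP.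
  have [[d [z [E [r [zy iz s f]]]]] _] := local_slices (@orbifold_chart_orb _ _ Q i) Sy.
  exists d, z, (slice_lift E); split.
  - exact: slice_orbifold_chart s.
  - by rewrite zy.
  - exact: iz.
  - by apply: (slice_stratum_lift s) => w _; exact: f.
have [_ [W [E [r [nW s f]]]]] := local_slices Qc Sx.
by exists W, (slice_lift E); split; [exact: nW|exact: slice_stratum_lift s _ f].
Qed.

End stratum_manifold.

(** * Lifts of strata and tangent spaces *)

Lemma injective_surj (F : fieldType) (U V : vectType F) (f : {linear U -> V}) (E : {vspace V}) :
  injective f -> (forall u, f u \in E) -> \dim E = dim U -> forall v, v \in E -> exists u, f u = v.
Proof.
move=> fI fE dE v vE; have lE u : linfun f u = f u by rewrite lfunE.
have EE : (linfun f @: fullv)%VS = E.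
  apply/eqP; rewrite eqEdim; apply/andP; split.
    by apply/subvP => _ /memv_imgP[u _ ->]; rewrite lE.
  rewrite limg_dim_eq ?dimvf ?dE//.
  have /eqP -> : lker (linfun f) == 0%VS by apply/lker0P => u w; rewrite !lE; exact: fI.
  exact: capv0.
by move: vE; rewrite -EE => /memv_imgP[u _ ->]; exists u; rewrite lE.
Qed.

Section stratum_lifts.
Variables (R : realType) (n : nat) (Q : orbifold R n) (k : nat).
Variable S : smooth_manifold R k (Sigma Q k).
Implicit Types c d : orbichart R n Q.

Lemma stratum_lift_smooth c G (W : set (oc_space c)) s q :
  stratum_lift S G W s -> stratum_in W q -> msmooth S (oc_mfd c) s q.
Proof. by move=> [_ _ _ [oS /(smooth_mapP _ _ _ oS) ss _ _ _]]; exact: ss. Qed.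

Lemma stratum_lift_nbhs c G (W : set (oc_space c)) s q :
  stratum_lift S G W s -> stratum_in W q -> \forall q' \near (q : Sigma Q k), stratum_in W q'.
Proof. by move=> [_ _ _ [oS _ _ _ _]] qW; exact: open_nbhs_nbhs. Qed.

(** Since [x] is fixed by its own isotropy group it is a value of [s], and the projection identifies
    the argument as [p]. *)
Lemma stratum_lift_at c (W : set (oc_space c)) s x (p : Sigma Q k) :
  stratum_lift S (isotropy x) W s -> W x -> oc_proj c x = set_val p ->
  stratum_in W p /\ s p = x.
Proof.
move=> [_ ps sE _] Wx xp; split; first by exists x.
have : (s @` stratum_in W) x by rewrite sE; split=> // a [].
move=> [q dq sq]; suff -> : p = q by [].
by apply: val_inj; rewrite -!set_valE -xp -sq ps.
Qed.

Lemma stratum_lift_fixed c G (W : set (oc_space c)) s q :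
  stratum_lift S G W s -> stratum_in W q -> fixed_points G (s q).
Proof.
move=> [_ _ sE _] dq.
suff : (W `&` fixed_points G) (s q) by case.
by rewrite -sE; exists q.
Qed.

Lemma mdiff_stratum_lift_inj c G (W : set (oc_space c)) s q :
  stratum_lift S G W s -> stratum_in W q -> injective (mdiff S (oc_mfd c) s q).
Proof. by move=> [_ _ _ [_ _ iS _ _]]; exact: iS. Qed.

(** The points [h (s q)] and [s' q] differ by a group element [b]. For [q] near [p] both lie in an
    isotropy neighbourhood of [h x], so [b] fixes [h x], and such elements fix the values of
    [s']. *)
Lemma near_lift_change c d (x : oc_space c) (p : Sigma Q k) W s W' s'
    (Wh : set (oc_space c)) (h : oc_space c -> oc_space d) :
  oc_proj c x = set_val p -> W x -> stratum_lift S (isotropy x) W s ->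
  change_of_charts Wh h -> Wh x -> W' (h x) -> stratum_lift S (isotropy (h x)) W' s' ->
  \forall q \near p, (h \o s) q = s' q.
Proof.
move=> xp Wx ls ch Whx W'h ls'; have [_ dh ph] := ch.
have [h' [oWh _ _ sh _]] := diffeo_elim dh.
have [pW sp] := stratum_lift_at ls Wx xp.
have hxp : oc_proj d (h x) = set_val p by rewrite ph.
have [pW' s'p] := stratum_lift_at ls' W'h hxp.
have [V [oV Vh _ Vdisj] _] := isotropy_nbhd_exists (filterT : nbhs (h x) setT).
have n1 := stratum_lift_nbhs ls pW; have n2 := stratum_lift_nbhs ls' pW'.
have cs := msmooth_continuous (stratum_lift_smooth ls pW).
have cs' := msmooth_continuous (stratum_lift_smooth ls' pW').
have n3 : \forall q \near p, Wh (s q) by apply: cs; rewrite sp; exact: open_nbhs_nbhs.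
have shx : msmooth (oc_mfd c) (oc_mfd d) h (s p) by rewrite sp; exact: sh.
have chs : {for p, continuous (h \o s)}.
  by apply: continuous_comp; [exact: cs|exact: msmooth_continuous shx].
have n4 : \forall q \near p, V (h (s q)) by apply: chs; rewrite /= sp; exact: open_nbhs_nbhs.
have n5 : \forall q \near p, V (s' q) by apply: cs'; rewrite s'p; exact: open_nbhs_nbhs.
apply: filterS (filterI n1 (filterI n2 (filterI n3 (filterI n4 n5)))) => q.
move=> [q1 [q2 [q3 [q4 q5]]]].
have [_ ps _ _] := ls; have [_ ps' _ _] := ls'.
have /oc_fiber[b Gb bE] : oc_proj d (s' q) = oc_proj d (h (s q)) by rewrite ph// ps// ps'.
have [bx|nbx] := pselect (b (h x) = h x).
  by have := stratum_lift_fixed ls' q2 (conj Gb bx); rewrite bE.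
have := Vdisj b Gb nbx; rewrite -subset0 => /(_ (h (s q)))[].
by split=> //; exists (s' q).
Qed.

Lemma mdiff_lift_change c d (x : oc_space c) (p : Sigma Q k) W s W' s'
    (Wh : set (oc_space c)) (h : oc_space c -> oc_space d) u :
  oc_proj c x = set_val p -> W x -> stratum_lift S (isotropy x) W s ->
  change_of_charts Wh h -> Wh x -> W' (h x) -> stratum_lift S (isotropy (h x)) W' s' ->
  mdiff (oc_mfd c) (oc_mfd d) h x (mdiff S (oc_mfd c) s p u) = mdiff S (oc_mfd d) s' p u.
Proof.
move=> xp Wx ls ch Whx W'h ls'.
have near := near_lift_change xp Wx ls ch Whx W'h ls'.
have [_ dh ph] := ch; have [h' [oWh _ _ sh _]] := diffeo_elim dh.
have [pW sp] := stratum_lift_at ls Wx xp.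
have ss := stratum_lift_smooth ls pW.
have shx : msmooth (oc_mfd c) (oc_mfd d) h (s p) by rewrite sp; exact: sh.
apply: etrans (esym (mdiff_comp_at u sp ss (sh _ Whx))) _.
exact: near_eq_mdiff near (msmooth_comp ss shx).
Qed.

(** Isotropy elements fix the values of the lift near [p]; differentiating that equation shows that
    they fix the image of its differential. *)
Lemma mdiff_lift_fixed c (x : oc_space c) (p : Sigma Q k) W s u :
  oc_proj c x = set_val p -> W x -> stratum_lift S (isotropy x) W s ->
  fixed_tangent x (mdiff S (oc_mfd c) s p u).
Proof.
move=> xp Wx ls a ia; have [pW sp] := stratum_lift_at ls Wx xp.
have ss := stratum_lift_smooth ls pW.
have Ga := isotropy_group ia.
have near : \forall q \near p, (a \o s) q = s q.
  by apply: filterS (stratum_lift_nbhs ls pW) => q qW; exact: stratum_lift_fixed ls qW a ia.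
apply: etrans (esym (mdiff_comp_at u sp ss (group_msmooth x Ga))) _.
exact: near_eq_mdiff near (msmooth_comp ss (group_msmooth (s p) Ga)).
Qed.

(** The differential of a lift is injective into the fixed space, which has dimension [k] because
    the point lies in [Sigma k]; surjectivity is a dimension count. *)
Theorem stratum_tangent_identification : tangent_identification S.
Proof.
split=> [c x p W s Qc xp Wx ls|c d x p W s W' s' Wh h _ _ xp Wx ls ch Whx W'h ls' u];
  last exact: mdiff_lift_change xp Wx ls ch Whx W'h ls'.
have [pW sp] := stratum_lift_at ls Wx xp.
have Sx : Sigma Q k (oc_proj c x) by rewrite xp; exact: set_valP.
have [E [dE fE]] := (Sigma_fixed_dim x k Qc).1 Sx.
have fU u := mdiff_lift_fixed u xp Wx ls.
have inj := mdiff_stratum_lift_inj ls pW.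
split.
- by move=> u _; exact: fU.
- by move=> u v _ _; exact: inj.
- move=> v fv; have fUE u : mdiff S (oc_mfd c) s p u \in E by move: (fU u); rewrite fE.
  have vE : v \in E by move: fv; rewrite fE.
  have dE' : \dim E = dim 'rV[R]_k by rewrite dE dim_matrix mul1r.
  by have [u uv] := injective_surj inj fUE dE' vE; exists u.
Qed.

End stratum_lifts.

(** * The Euler-Lagrange covector and the Christoffel symbols *)

Section matrix_derivatives.
Variables (R : realType) (V : normedModType R).

Lemma derive_trmx m n (f : V -> 'M[R]_(m, n)) x v : smooth_at f x ->
  'D_v (fun y => (f y)^T) x = ('D_v f x)^T.
Proof.
move=> sf; apply/matrixP => i j; rewrite derive_mxE; last exact: smooth_at_trmx.
rewrite [RHS]mxE derive_mxE//; congr ('D_v _ x).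
by apply/funext => y; rewrite mxE.
Qed.

Lemma derive_swap_mx m n (f : V -> 'M[R]_(m, n)) x u v : smooth_at f x ->
  'D_u ('D_v f) x = 'D_v ('D_u f) x.
Proof.
move=> sf; apply/matrixP => i j.
have key w w' : 'D_w ('D_w' f) x i j = 'D_w ('D_w' (fun y => f y i j)) x.
  apply: etrans (derive_mxE w i j (smooth_at_derive w' sf)) _.
  apply: near_eq_derive; apply: filterS (smooth_at_near sf) => y sy.
  exact: derive_mxE.
have [U [oU Ux sU]] := smooth_at_mxP sf i j.
exact: etrans (key u v) (etrans (derive_swap v u oU Ux (sU 2)) (esym (key v u))).
Qed.

End matrix_derivatives.

Lemma pullback_form (R : comNzRingType) k n (a b : 'rV[R]_k) (J : 'M[R]_(k, n)) (G : 'M[R]_n) :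
  a *m (J *m G *m J^T) *m b^T = a *m J *m G *m (b *m J)^T.
Proof. by rewrite trmx_mul !mulmxA. Qed.

Section euler_lagrange.
Variable R : realType.

(* The Euler-Lagrange covector of the energy of [z], evaluated at [w]. *)
Definition euler_lagrange n (G : 'rV[R]_n -> 'M[R]_n) (z : R -> 'rV[R]_n) (t : R)
    (w : 'rV[R]_n) : 'M[R]_1 :=
  'D_1 (fun s => 'D_1 z s *m G (z s) *m w^T) t
  - 2^-1 *: 'D_w (fun x => 'D_1 z t *m G x *m ('D_1 z t)^T) (z t).

Lemma mx11_sym n (a b : 'rV[R]_n) (G : 'M[R]_n) : G^T = G -> b *m G *m a^T = a *m G *m b^T.
Proof.
move=> sG; rewrite -[LHS]trmxK (_ : (b *m G *m a^T)^T = a *m G *m b^T).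
  by apply/matrixP => i j; rewrite mxE !ord1.
by rewrite !trmx_mul trmxK sG mulmxA.
Qed.

Lemma near_eq_euler_lagrange n (G G' : 'rV[R]_n -> 'M[R]_n) (z z' : R -> 'rV[R]_n) t w :
  {for t, continuous z} ->
  (\forall x \near z t, G x = G' x) -> (\forall s \near t, z s = z' s) ->
  euler_lagrange G z t w = euler_lagrange G' z' t w.
Proof.
move=> cz GG zz; have zt : z t = z' t by exact: nbhs_singleton zz.
have Dz : \forall s \near t, 'D_1 z s = 'D_1 z' s.
  move/nbhs_interior : zz; apply: filterS => s zs.
  exact: near_eq_derive.
have Dzt : 'D_1 z t = 'D_1 z' t by exact: nbhs_singleton Dz.
have nG : \forall s \near t, G (z s) = G' (z s) by exact: cz GG.
have E1 : 'D_1 (fun s => 'D_1 z s *m G (z s) *m w^T) t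
    = 'D_1 (fun s => 'D_1 z' s *m G' (z' s) *m w^T) t.
  by apply: near_eq_derive; apply: filterS (filterI nG (filterI zz Dz)) => s [-> [<- <-]].
have E2 : 'D_w (fun x => 'D_1 z t *m G x *m ('D_1 z t)^T) (z t)
    = 'D_w (fun x => 'D_1 z' t *m G' x *m ('D_1 z' t)^T) (z' t).
  by rewrite -zt -Dzt; apply: near_eq_derive; apply: filterS GG => x ->.
exact: (congr2 (fun a b => a - 2^-1 *: b) E1 E2).
Qed.

Lemma euler_lagrangeE n (G : 'rV[R]_n -> 'M[R]_n) (z : R -> 'rV[R]_n) t w :
  smooth_at z t -> smooth_at G (z t) ->
  euler_lagrange G z t w = 'D_1 (fun s => 'D_1 z s *m G (z s)) t *m w^T
    - 2^-1 *: ('D_1 z t *m 'D_w G (z t) *m ('D_1 z t)^T).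
Proof.
move=> sz sG; have sDz := smooth_at_derive (1 : R) sz.
have sGz : smooth_at (fun s => G (z s)) t by exact: (smooth_at_comp sz sG).
have sP : smooth_at (fun s => 'D_1 z s *m G (z s)) t by exact: smooth_at_mulmx.
rewrite /euler_lagrange derive_mulmx//; last exact: smooth_at_cst.
rewrite derive_cst mulmx0 addr0; congr (_ - _ *: _).
have sc : smooth_at (fun x => 'D_1 z t *m G x) (z t).
  by apply: smooth_at_mulmx => //; exact: smooth_at_cst.
rewrite derive_mulmx//; last exact: smooth_at_cst.
rewrite derive_cst mulmx0 addr0; congr (_ *m _).
rewrite derive_mulmx//; last exact: smooth_at_cst.
by rewrite derive_cst mul0mx add0r.
Qed.

(** [B] stands for the mixed second derivative of [f]. By symmetry of [G] its two contributions to
    the energy term are equal, and with the factor 1/2 they cancel the one coming from the time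
    derivative. *)
Lemma el_algebra n (A B C : 'rV[R]_n) (D : 'M[R]_(1, n)) (G H : 'M[R]_n) : G^T = G ->
  D *m C^T + A *m G *m B^T - 2^-1 *: ((B *m G + A *m H) *m A^T + A *m G *m B^T)
  = D *m C^T - 2^-1 *: (A *m H *m A^T).
Proof.
move=> sG; rewrite mulmxDl (mx11_sym _ _ sG).
apply/matrixP => i j; rewrite !mxE; set X := \sum_l _; set Y := \sum_l _; set Z := \sum_l _.
by field.
Qed.

(** The energy of [y] for the pulled-back form is that of [f \o y], so the covector of [y] is the
    restriction of the covector of [f \o y] to the image of the Jacobian. The dimensions may differ:
    this covers lifts of strata as well as isometries. *)
Lemma euler_lagrange_natural k n (f : 'rV[R]_k -> 'rV[R]_n) (G : 'rV[R]_n -> 'M[R]_n)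
    (y : R -> 'rV[R]_k) t u :
  smooth_at y t -> smooth_at f (y t) -> smooth_at G (f (y t)) -> (forall x, (G x)^T = G x) ->
  euler_lagrange (fun x => 'J f x *m G (f x) *m ('J f x)^T) y t u =
  euler_lagrange G (f \o y) t (u *m 'J f (y t)).
Proof.
move=> sy sf sG Gsym; set v := 'D_1 y t; set z := f \o y.
have sz : smooth_at z t by exact: smooth_at_comp.
have Jf w x : smooth_at f x -> w *m 'J f x = 'D_w f x.
  by move=> sfx; rewrite -deriveEjacobian//; exact: smooth_at_differentiable.
have Dz s : smooth_at y s -> smooth_at f (y s) -> 'D_1 z s = 'D_('D_1 y s) f (y s).
  by move=> sys sfs; rewrite /z derive_comp//; exact: smooth_at_differentiable.
have nf : \forall s \near t, smooth_at f (y s).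
  by have cy := smooth_at_continuous sy; exact: cy (smooth_at_near sf).
rewrite (euler_lagrangeE _ sz sG) Jf//.
pose P s := 'D_1 z s *m G (z s).
have sGz : smooth_at (fun s => G (z s)) t by exact: (smooth_at_comp sz sG).
have sP : smooth_at P t by apply: smooth_at_mulmx => //; exact: smooth_at_derive.
have sDu w : smooth_at ('D_w f) (y t) by exact: smooth_at_derive.
have sDuy : smooth_at (fun s => 'D_u f (y s)) t by exact: (smooth_at_comp sy (sDu u)).
(* Symmetry of second derivatives enters here: differentiating the variation in time equals varying
   the velocity. *)
have e0 : 'D_1 (fun s => 'D_u f (y s)) t = 'D_u ('D_v f) (y t).
  apply: etrans (@derive_comp _ _ _ _ y ('D_u f) t 1 _ _) _.
  - exact: smooth_at_differentiable.
  - exact: smooth_at_differentiable (sDu u).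
  - exact: derive_swap_mx.
have e1 := etrans (derive_trmx (1 : R) sDuy) (congr1 trmx e0).
rewrite /euler_lagrange.
have -> : 'D_1 (fun s => 'D_1 y s *m ('J f (y s) *m G (f (y s)) *m ('J f (y s))^T) *m u^T) t
    = 'D_1 P t *m ('D_u f (y t))^T + P t *m ('D_u ('D_v f) (y t))^T.
  rewrite (_ : 'D_1 _ t = 'D_1 (fun s => P s *m ('D_u f (y s))^T) t); last first.
    apply: near_eq_derive; apply: filterS (filterI nf (smooth_at_near sy)) => s [sfs sys].
    exact: etrans (pullback_form _ _ _ _) (congr2 (fun p q => p *m G (z s) *m q^T)
      (etrans (Jf ('D_1 y s) _ sfs) (esym (Dz s sys sfs))) (Jf u _ sfs)).
  exact: etrans (derive_mulmx (1 : R) sP (smooth_at_trmx sDuy)) (congr1 (fun X => _ + P t *m X) e1).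
have eG : 'D_u (fun x => G (f x)) (y t) = 'D_('D_u f (y t)) G (z t).
  exact: derive_comp (smooth_at_differentiable sf) (smooth_at_differentiable sG).
have -> : 'D_u (fun x => v *m ('J f x *m G (f x) *m ('J f x)^T) *m v^T) (y t)
    = ('D_u ('D_v f) (y t) *m G (z t) + 'D_v f (y t) *m 'D_('D_u f (y t)) G (z t)) *m
        ('D_v f (y t))^T + 'D_v f (y t) *m G (z t) *m ('D_u ('D_v f) (y t))^T.
  rewrite (_ : 'D_u _ _ = 'D_u (fun x => 'D_v f x *m G (f x) *m ('D_v f x)^T) (y t)); last first.
    apply: near_eq_derive; apply: filterS (smooth_at_near sf) => x sfx.
    exact: etrans (pullback_form _ _ _ _) (congr2 (fun p q => p *m G (f x) *m q^T)
      (Jf v x sfx) (Jf v x sfx)).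
  have sGf : smooth_at (fun x => G (f x)) (y t) by exact: (smooth_at_comp sf sG).
  apply: etrans (derive_mulmx u (smooth_at_mulmx (sDu v) sGf) (smooth_at_trmx (sDu v))) _.
  apply: congr2; last exact: congr1 (derive_trmx u (sDu v)).
  have e2 := derive_mulmx u (sDu v) sGf.
  rewrite eG in e2; exact: (congr1 (fun X => X *m ('D_v f (y t))^T) e2).
have Dzt : 'D_1 z t = 'D_v f (y t) by exact: Dz.
rewrite /P Dzt -[G (f (y t))]/(G (z t)).
exact: el_algebra.
Qed.

End euler_lagrange.

Section acceleration.
Variables (R : realType) (n : nat).
Implicit Types (G : 'rV[R]_n -> 'M[R]_n) (z : R -> 'rV[R]_n).

Definition christoffel_of G (x : 'rV[R]_n) (l i j : 'I_n) : R :=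
  2^-1 * \sum_(m < n) invmx (G x) l m *
    ('D_(delta_mx 0 i) (fun y => G y j m) x + 'D_(delta_mx 0 j) (fun y => G y i m) x
     - 'D_(delta_mx 0 m) (fun y => G y i j) x).

Definition acceleration G z t : 'rV[R]_n :=
  \row_l (derive1n 2 z t 0 l
    + \sum_(i < n) \sum_(j < n) christoffel_of G (z t) l i j * derive1 z t 0 i * derive1 z t 0 j).

Lemma derive_mx_sum_delta m p (F : 'rV[R]_n -> 'M[R]_(m, p)) x v i j : smooth_at F x ->
  'D_v F x i j = \sum_a v 0 a * 'D_(delta_mx 0 a) (fun y => F y i j) x.
Proof.
move=> sF; rewrite derive_mxE//; apply: derive_sum_delta.
exact/smooth_at_differentiable/smooth_at_mxP.
Qed.

(** The first two terms of the Christoffel bracket become equal after exchanging [i] and [j],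
    because they are contracted with the symmetric product of [a] with itself. *)
Lemma christoffel_contract (d : 'I_n -> 'I_n -> 'I_n -> R) (a w : 'I_n -> R) :
  \sum_m (\sum_i \sum_j (d i j m + d j i m - d m i j) * a i * a j) * w m =
  2 * (\sum_m (\sum_j a j * \sum_i a i * d i j m) * w m)
  - \sum_j (\sum_i a i * \sum_m w m * d m i j) * a j.
Proof.
pose S1 := \sum_m \sum_i \sum_j d i j m * a i * a j * w m.
pose S3 := \sum_m \sum_i \sum_j d m i j * a i * a j * w m.
have -> : \sum_m (\sum_j a j * \sum_i a i * d i j m) * w m = S1.
  apply: eq_bigr => m _; rewrite mulr_suml exchange_big; apply: eq_bigr => j _.
  rewrite mulr_sumr mulr_suml; apply: eq_bigr => i _; ring.
have -> : \sum_j (\sum_i a i * \sum_m w m * d m i j) * a j = S3.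
  rewrite /S3 exchange_big/=; under [RHS]eq_bigr do rewrite exchange_big/=.
  rewrite [RHS]exchange_big; apply: eq_bigr => j _.
  rewrite mulr_suml; apply: eq_bigr => i _.
  rewrite mulr_sumr mulr_suml; apply: eq_bigr => m _; ring.
have -> : 2 * S1 = S1 + S1 by ring.
rewrite {2}/S1; under [X in _ = _ + X - _]eq_bigr do rewrite exchange_big/=.
rewrite -big_split -sumrB; apply: eq_bigr => m _.
rewrite mulr_suml -big_split -sumrB; apply: eq_bigr => i _.
rewrite mulr_suml -big_split -sumrB; apply: eq_bigr => j _ /=; ring.
Qed.

Lemma christoffel_raise (e : 'I_n -> 'I_n -> 'I_n -> R) (a I : 'I_n -> R) (h : R) :
  \sum_i \sum_j (h * \sum_m I m * e m i j) * a i * a j =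
  h * \sum_m (\sum_i \sum_j e m i j * a i * a j) * I m.
Proof.
rewrite mulr_sumr; under [RHS]eq_bigr => m _.
  rewrite mulr_suml mulr_sumr; under eq_bigr => i _ do rewrite mulr_suml mulr_sumr.
  over.
rewrite [RHS]exchange_big/=; apply: eq_bigr => i _.
rewrite [RHS]exchange_big/=; apply: eq_bigr => j _.
rewrite mulr_sumr !mulr_suml; apply: eq_bigr => m _; ring.
Qed.

(** Lowering the index of the covariant acceleration cancels the inverse metric in the Christoffel
    symbols and leaves the expanded Euler-Lagrange expression. *)
Lemma acceleration_euler_lagrange G z t w :
  smooth_at z t -> smooth_at G (z t) -> (forall x, (G x)^T = G x) -> G (z t) \in unitmx ->
  acceleration G z t *m G (z t) *m w^T = euler_lagrange G z t w.
Proof.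
move=> sz sG symG uG; rewrite (euler_lagrangeE _ sz sG).
have sDz := smooth_at_derive (1 : R) sz.
have sGz : smooth_at (fun s => G (z s)) t by exact: (smooth_at_comp sz sG).
rewrite (derive_mulmx _ sDz sGz).
rewrite (@derive_comp _ _ _ _ z G); [|exact: smooth_at_differentiable..].
have D1 : 'D_1 z = derive1 z by apply/funext => s; rewrite derive1E.
set a := 'D_1 z t.
(* Twice the quadratic Christoffel term with its index lowered. *)
pose b : 'rV[R]_n := \row_m \sum_(i < n) \sum_(j < n)
  ('D_(delta_mx 0 i) (fun y => G y j m) (z t) + 'D_(delta_mx 0 j) (fun y => G y i m) (z t)
     - 'D_(delta_mx 0 m) (fun y => G y i j) (z t)) * a 0 i * a 0 j.
have bw : b *m w^T = 2 *: (a *m 'D_a G (z t) *m w^T) - a *m 'D_w G (z t) *m a^T.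
  apply/matrixP => i0 j0; rewrite !ord1 {i0 j0} !mxE.
  under eq_bigr do rewrite !mxE.
  rewrite christoffel_contract; congr (_ * _ - _).
    apply: eq_bigr => m _; rewrite !mxE; congr (_ * _).
    by apply: eq_bigr => j _; rewrite derive_mx_sum_delta.
  apply: eq_bigr => j _; rewrite !mxE; congr (_ * _).
  by apply: eq_bigr => i _; rewrite derive_mx_sum_delta.
have acc : acceleration G z t *m G (z t) = 'D_1 ('D_1 z) t *m G (z t) + 2^-1 *: b.
  have symI : (invmx (G (z t)))^T = invmx (G (z t)) by rewrite trmx_inv symG.
  have -> : acceleration G z t = 'D_1 ('D_1 z) t + 2^-1 *: (b *m invmx (G (z t))).
    apply/rowP => l; rewrite !mxE D1 -derive1E; congr (_ + _).
    rewrite christoffel_raise; congr (_ * _).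
    have Isym m : invmx (G (z t)) l m = invmx (G (z t)) m l by rewrite -[in LHS]symI mxE.
    have az j : derive1 z t 0 j = a 0 j by rewrite derive1E.
    apply: eq_bigr => m _; rewrite Isym [b 0 m]mxE; apply: (congr1 ( *%R^~ _)).
    apply: eq_bigr => i _; apply: eq_bigr => j _.
    exact: (congr2 (fun p q => _ * p * q) (az i) (az j)).
  by rewrite mulmxDl -scalemxAl mulmxKV.
rewrite acc [LHS]mulmxDl -scalemxAl bw scalerBr scalerA mulVf ?pnatr_eq0// scale1r.
by rewrite mulmxDl addrA.
Qed.

End acceleration.

(** * Gram matrices, form-preserving maps and geodesics *)

Lemma form_ext (F : fieldType) m n (A B : 'M[F]_(m, n)) :
  (forall (u : 'rV_m) (v : 'rV_n), u *m A *m v^T = u *m B *m v^T) -> A = B.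
Proof.
move=> H; apply/matrixP => i j; have /matrixP/(_ 0 0) := H (delta_mx 0 i) (delta_mx 0 j).
by rewrite -!rowE trmx_delta -!colE !mxE.
Qed.

Section gram_matrices.
Variables (R : realType) (n : nat) (T : topologicalType) (M : smooth_manifold R n T).
Implicit Types (c : mchart R n T) (g : T -> 'M[R]_n).
Local Notation rV := (rV_mfd R n).

Lemma mdiff_fwd_bwd c p v : mf_atlas M c -> mc_dom c p ->
  mdiff M rV (mc_fwd c) p (mdiff rV M (mc_bwd c) (mc_fwd c p) v) = v.
Proof.
move=> Mc cp; have sb := msmooth_bwd Mc (mc_img_fwd cp).
apply: etrans (esym (mdiff_comp_at v (mc_fwdK cp) sb (msmooth_fwd Mc cp))) _.
apply: etrans (mdiff_id rV (mc_fwd c p) v); apply: esym; apply: near_eq_mdiff (msmooth_id _ _).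
by apply: filterS (near_mc_img cp) => q cq /=; rewrite mc_bwdK.
Qed.

Lemma gram_form g c p u v : mf_atlas M c -> mc_dom c p ->
  u *m gram_of M g c (mc_fwd c p) *m v^T =
  mdiff rV M (mc_bwd c) (mc_fwd c p) u *m g p *m (mdiff rV M (mc_bwd c) (mc_fwd c p) v)^T.
Proof.
move=> Mc cp; have sb := msmooth_bwd Mc (mc_img_fwd cp).
have e w : w *m jacobian (mc_fwd (chart_at M (mc_bwd c (mc_fwd c p))) \o mc_bwd c) (mc_fwd c p)
    = mdiff rV M (mc_bwd c) (mc_fwd c p) w.
  rewrite /mdiff chart_at_rV; exact: mul_rV_lin1.
have e1 := congr1 (fun a => a *m g (mc_bwd c (mc_fwd c p))) (e u).
have e2 := congr2 (fun a b => a *m b^T) e1 (e v).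
apply: etrans (pullback_form _ _ _ _) _; apply: etrans e2 _.
exact: (congr1 (fun q => _ *m g q *m _) (mc_fwdK cp)).
Qed.

Lemma gram_sym g c x : (forall p, (g p)^T = g p) -> (gram_of M g c x)^T = gram_of M g c x.
Proof. by move=> sg; rewrite /gram_of !trmx_mul trmxK sg mulmxA. Qed.

Lemma gram_unit (g : riemannian_metric M) c p : mf_atlas M c -> mc_dom c p ->
  gram g c (mc_fwd c p) \in unitmx.
Proof.
move=> Mc cp; rewrite -row_free_unit; apply: inj_row_free => v v0.
have := gram_form (rm_form g) v v Mc cp; rewrite -[gram_of _ _ _ _]/(gram g c (mc_fwd c p)) v0.
rewrite mul0mx; set w := mdiff _ _ _ _ v => /matrixP/(_ 0 0) e.
have w0 : w = 0.
  have [//|/(rm_pos g p)] := eqVneq w 0; by rewrite -e mxE ltxx.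
exact: etrans (esym (mdiff_fwd_bwd v Mc cp)) (etrans (congr1 _ w0) (linear0 _)).
Qed.

Lemma gram_smooth (g : riemannian_metric M) c p : mf_atlas M c -> mc_dom c p ->
  smooth_at (gram g c) (mc_fwd c p).
Proof.
move=> Mc cp; have h := smooth_on_at (@mc_img_open _ _ _ c) (rm_smooth g Mc).
exact: (h _ (mc_img_fwd cp)).
Qed.

End gram_matrices.

Section pullback.
Variables (R : realType) (m n : nat) (S T : topologicalType).
Variables (M : smooth_manifold R m S) (N : smooth_manifold R n T).
Variables (g : S -> 'M[R]_m) (g' : T -> 'M[R]_n) (f : S -> T).
Local Notation rVm := (rV_mfd R m).
Local Notation rVn := (rV_mfd R n).

(** Unlike [isometric_on], this allows different dimensions and bare matrix fields, so that it
    applies to lifts before the induced form is known to be a metric. *)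
Definition preserves_form q := forall u v,
  mdiff M N f q u *m g' (f q) *m (mdiff M N f q v)^T = u *m g q *m v^T.

Variables (c : mchart R m S) (d : mchart R n T).
Hypotheses (Mc : mf_atlas M c) (Nd : mf_atlas N d).

Lemma mdiff_in_charts_bwd q u : msmooth M N f q -> mc_dom c q -> mc_dom d (f q) ->
  mdiff M N f q (mdiff rVm M (mc_bwd c) (mc_fwd c q) u) =
  mdiff rVn N (mc_bwd d) (mc_fwd d (f q)) (u *m jacobian (in_charts c d f) (mc_fwd c q)).
Proof.
move=> sf cq dq; have sb := msmooth_bwd Mc (mc_img_fwd cq).
have sd := msmooth_bwd Nd (mc_img_fwd dq).
have sfc := msmooth_in_charts sf Mc Nd cq dq.
have sfc' : msmooth rVm rVn (in_charts c d f) (mc_fwd c q) by apply/msmooth_rVP.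
have fx : in_charts c d f (mc_fwd c q) = mc_fwd d (f q) by rewrite /in_charts /= mc_fwdK.
have -> : u *m jacobian (in_charts c d f) (mc_fwd c q)
    = mdiff rVm rVn (in_charts c d f) (mc_fwd c q) u.
  by rewrite mdiff_rV; exact: mul_rV_lin1.
apply: etrans (esym (mdiff_comp_at u (mc_fwdK cq) sb sf)) _.
apply: etrans (mdiff_comp_at u fx sfc' sd).
have sf' : msmooth M N f (mc_bwd c (mc_fwd c q)) by rewrite mc_fwdK.
apply: near_eq_mdiff; last exact: msmooth_comp sb sf'.
have nd : \forall q' \near q, mc_dom d (f q') by apply: (msmooth_continuous sf); exact: near_mc_dom.
by apply: filterS (near_mc_bwd cq nd) => x dx; rewrite /in_charts /= mc_fwdK.
Qed.

Lemma gram_pullback q : msmooth M N f q -> mc_dom c q -> mc_dom d (f q) -> preserves_form q ->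
  gram_of M g c (mc_fwd c q) = jacobian (in_charts c d f) (mc_fwd c q)
    *m gram_of N g' d (in_charts c d f (mc_fwd c q))
    *m (jacobian (in_charts c d f) (mc_fwd c q))^T.
Proof.
move=> sf cq dq pf; apply: form_ext => u v.
have fx : in_charts c d f (mc_fwd c q) = mc_fwd d (f q) by rewrite /in_charts /= mc_fwdK.
apply: etrans (esym (pullback_form _ _ _ _)); rewrite fx.
apply: etrans (gram_form g u v Mc cq) _.
apply: etrans (esym (gram_form g' _ _ Nd dq)).
apply: etrans (esym (pf _ _)) _.
exact: (congr2 (fun a b => a *m g' (f q) *m b^T) (mdiff_in_charts_bwd u sf cq dq)
  (mdiff_in_charts_bwd v sf cq dq)).
Qed.

End pullback.

Section near_pullback.
Variables (R : realType) (m n : nat) (S T : topologicalType).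
Variables (M : smooth_manifold R m S) (N : smooth_manifold R n T).
Variables (g : S -> 'M[R]_m) (g' : T -> 'M[R]_n) (f : S -> T).

Lemma near_gram_pullback c d p : mf_atlas M c -> mf_atlas N d -> mc_dom c p -> mc_dom d (f p) ->
  (\forall q \near p, msmooth M N f q /\ preserves_form M N g g' f q) ->
  \forall x \near mc_fwd c p, gram_of M g c x = jacobian (in_charts c d f) x
    *m gram_of N g' d (in_charts c d f x) *m (jacobian (in_charts c d f) x)^T.
Proof.
move=> Mc Nd cp dp near; have [sf _] := nbhs_singleton near.
have nd : \forall q \near p, mc_dom d (f q) by apply: (msmooth_continuous sf); exact: near_mc_dom.
apply: filterS (filterI (near_mc_img cp) (filterI (near_mc_bwd cp near)
  (filterI (near_mc_bwd cp nd) (near_mc_bwd cp (near_mc_dom cp))))) => x [cx [[sq pq] [dq cq]]].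
have := gram_pullback Mc Nd sq cq dq pq.
by rewrite (mc_bwdK cx).
Qed.

End near_pullback.

Section curves.
Variables (R : realType) (n : nat) (T : topologicalType) (M : smooth_manifold R n T).
Variable g : riemannian_metric M.
Implicit Types (c : mchart R n T) (gamma : R -> T).
Local Notation rV := (rV_mfd R n).

(* The Euler-Lagrange covector at [gamma t] read in the chart [c]; it vanishes
   exactly when the covariant acceleration of [gamma] does. *)
Definition energy_covector c gamma t (v : 'rV[R]_n) : 'M[R]_1 :=
  euler_lagrange (gram g c) (mc_fwd c \o gamma) t (mdiff M rV (mc_fwd c) (gamma t) v).

Lemma near_eq_energy_covector c gamma gamma' t v : mc_dom c (gamma t) ->
  {for t, continuous gamma} -> (\forall s \near t, gamma s = gamma' s) ->
  energy_covector c gamma t v = energy_covector c gamma' t v.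
Proof.
move=> ct cg near; rewrite /energy_covector -(nbhs_singleton near).
apply: near_eq_euler_lagrange.
- by apply: continuous_comp => //; exact: mc_fwd_cont.
- exact: filterE.
- by apply: filterS near => s /= ->.
Qed.

Lemma energy_covectorE c gamma t v : mf_atlas M c -> mc_dom c (gamma t) ->
  smooth_at (mc_fwd c \o gamma) t ->
  energy_covector c gamma t v = acceleration (gram g c) (mc_fwd c \o gamma) t
    *m gram g c (mc_fwd c (gamma t)) *m (mdiff M rV (mc_fwd c) (gamma t) v)^T.
Proof.
move=> Mc cp sg; rewrite /energy_covector -acceleration_euler_lagrange//.
- exact: gram_smooth.
- by move=> x; apply: gram_sym; exact: rm_sym.
- exact: gram_unit.
Qed.

(** Every coordinate vector is the image of a tangent vector under the chart differential, and the
    Gram matrix is invertible. *)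
Lemma acceleration_eq0 c gamma t : mf_atlas M c -> mc_dom c (gamma t) ->
  smooth_at (mc_fwd c \o gamma) t -> (forall v, energy_covector c gamma t v = 0) ->
  acceleration (gram g c) (mc_fwd c \o gamma) t = 0.
Proof.
move=> Mc cp sg H; have uG := gram_unit g Mc cp.
set G := gram g c (mc_fwd c (gamma t)) in uG.
suff : acceleration (gram g c) (mc_fwd c \o gamma) t *m G = 0.
  by move=> e; rewrite -[LHS](mulmxK uG) e mul0mx.
apply: form_ext => u v; rewrite mulmx0 mul0mx.
have := H (mdiff rV M (mc_bwd c) (mc_fwd c (gamma t)) v).
rewrite (energy_covectorE _ Mc cp sg) (mdiff_fwd_bwd v Mc cp) -/G => e.
by rewrite -[LHS]mulmxA e mulmx0.
Qed.

Lemma geodesic_energy (J : set R) gamma t c : open J -> geodesic g J gamma -> J t ->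
  mf_atlas M c -> mc_dom c (gamma t) ->
  smooth_at (mc_fwd c \o gamma) t /\ forall v, energy_covector c gamma t v = 0.
Proof.
move=> oJ [cg H] Jt Mc ct; have [sx ax] := H c Mc.
have sg : smooth_at (mc_fwd c \o gamma) t.
  have : nbhs t (J `&` gamma @^-1` mc_dom c).
    apply: filterI; first exact: open_nbhs_nbhs.
    exact: cg (near_mc_dom ct).
  move=> /nbhs_interior/nbhs_singleton ti.
  apply: (smooth_on_at (@open_interior _ _)) ti => r.
  apply: class_C_sub (sx r); exact: interior_subset.
split=> // v; rewrite (energy_covectorE v Mc ct sg).
have -> : acceleration (gram g c) (mc_fwd c \o gamma) t = 0.
  apply/rowP => l; rewrite !mxE; exact: ax.
by rewrite !mul0mx.
Qed.

Lemma energy_geodesic (J : set R) gamma :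
  (forall t, J t -> {for t, continuous gamma}) ->
  (forall t c, J t -> mf_atlas M c -> mc_dom c (gamma t) ->
    smooth_at (mc_fwd c \o gamma) t /\ forall v, energy_covector c gamma t v = 0) ->
  geodesic g J gamma.
Proof.
move=> cg H; split=> // c Mc; split.
  by apply: smooth_at_on => t [Jt ct]; have [] := H t c Jt Mc ct.
move=> t Jt ct l; have [sg e] := H t c Jt Mc ct.
by have /rowP/(_ l) := acceleration_eq0 Mc ct sg e; rewrite !mxE.
Qed.

End curves.

Section energy_natural.
Variables (R : realType) (m n : nat) (S T : topologicalType).
Variables (M : smooth_manifold R m S) (N : smooth_manifold R n T).
Variables (g : riemannian_metric M) (g' : riemannian_metric N) (f : S -> T).

Lemma smooth_curve_comp c d (gamma : R -> S) t : mf_atlas M c -> mf_atlas N d ->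
  mc_dom c (gamma t) -> mc_dom d (f (gamma t)) -> {for t, continuous gamma} ->
  msmooth M N f (gamma t) -> smooth_at (mc_fwd c \o gamma) t ->
  smooth_at (mc_fwd d \o (f \o gamma)) t /\
  \forall s \near t, (in_charts c d f \o (mc_fwd c \o gamma)) s = (mc_fwd d \o (f \o gamma)) s.
Proof.
move=> Mc Nd ct dt cg sf sg.
have near : \forall s \near t,
    (in_charts c d f \o (mc_fwd c \o gamma)) s = (mc_fwd d \o (f \o gamma)) s.
  have ns : \forall s \near t, mc_dom c (gamma s) by exact: cg (near_mc_dom ct).
  apply: filterS ns => s cs.
  by rewrite /in_charts /= mc_fwdK.
split=> //; apply: near_eq_smooth_at near _.
exact: smooth_at_comp sg (msmooth_in_charts sf Mc Nd ct dt).
Qed.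

(** The form must be preserved on a neighbourhood and not just along the curve, since the covector
    contains derivatives of the Gram matrix in all directions. *)
Lemma energy_covector_natural c d gamma t v : mf_atlas M c -> mf_atlas N d ->
  mc_dom c (gamma t) -> mc_dom d (f (gamma t)) -> {for t, continuous gamma} ->
  smooth_at (mc_fwd c \o gamma) t ->
  (\forall q \near gamma t, msmooth M N f q /\ preserves_form M N (rm_form g) (rm_form g') f q) ->
  energy_covector g c gamma t v =
  energy_covector g' d (f \o gamma) t (mdiff M N f (gamma t) v).
Proof.
move=> Mc Nd ct dt cg sg near; have [sf _] := nbhs_singleton near.
have [_ nz] := smooth_curve_comp Mc Nd ct dt cg sf sg.
have cx : {for t, continuous (mc_fwd c \o gamma)} by exact: smooth_at_continuous.
have sfx := msmooth_in_charts sf Mc Nd ct dt.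
have fx : in_charts c d f (mc_fwd c (gamma t)) = mc_fwd d (f (gamma t)).
  by rewrite /in_charts /= mc_fwdK.
have nG := near_gram_pullback Mc Nd ct dt near.
have sG : smooth_at (gram g' d) (in_charts c d f (mc_fwd c (gamma t))).
  by rewrite fx; exact: gram_smooth.
have symG x : (gram g' d x)^T = gram g' d x by apply: gram_sym; exact: rm_sym.
set u := mdiff M (rV_mfd R m) (mc_fwd c) (gamma t) v.
have z1 : \forall s \near t, (mc_fwd c \o gamma) s = (mc_fwd c \o gamma) s by exact: filterE.
have e1 := near_eq_euler_lagrange u cx nG z1.
have G2 : \forall x \near (in_charts c d f \o (mc_fwd c \o gamma)) t,
  gram g' d x = gram g' d x by exact: filterE.
apply: etrans e1 _.
apply: etrans (euler_lagrange_natural u sg sfx sG symG) _.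
have cfx : {for t, continuous (in_charts c d f \o (mc_fwd c \o gamma))}.
  by apply: continuous_comp; [exact: cx|exact: smooth_at_continuous sfx].
apply: etrans (near_eq_euler_lagrange _ cfx G2 nz) _.
rewrite /energy_covector; apply: congr1.
have -> : u *m jacobian (in_charts c d f) (mc_fwd c (gamma t))
    = mdiff (rV_mfd R m) (rV_mfd R n) (in_charts c d f) (mc_fwd c (gamma t)) u.
  by rewrite mdiff_rV; exact: mul_rV_lin1.
have sfc' : msmooth (rV_mfd R m) (rV_mfd R n) (in_charts c d f) (mc_fwd c (gamma t)).
  by apply/msmooth_rVP.
have sc := msmooth_fwd Mc ct.
apply: etrans (esym (mdiff_comp v sc sfc')) _.
apply: etrans (mdiff_comp v sf (msmooth_fwd Nd dt)).
apply: near_eq_mdiff; last exact: msmooth_comp sc sfc'.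
by apply: filterS (near_mc_dom ct) => q cq; rewrite /in_charts /= mc_fwdK.
Qed.

End energy_natural.

(** * The induced metric on a stratum *)

Section induced_metric.
Variables (R : realType) (n : nat) (Q : orbifold R n) (k : nat).
Variables (S : smooth_manifold R k (Sigma Q k)) (g : riemannian_orbifold Q).
Hypothesis natS : natural_structure S.
Local Notation chart i := (orb_chart Q i).
Local Notation M i := (oc_mfd (orb_chart Q i)).
Local Notation form i := (rm_form (ro_metric g i)).

Lemma isometric_preserves_form m (U V : topologicalType) (N : smooth_manifold R m U)
    (P : smooth_manifold R m V) (gN : riemannian_metric N) (gP : riemannian_metric P) W h q :
  isometric_on gN gP W h -> W q -> preserves_form N P (rm_form gN) (rm_form gP) h q.
Proof.
move=> iso Wq u v; apply/matrixP => a b; rewrite !ord1; exact: iso.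
Qed.

Lemma lift_exists i (x : oc_space (chart i)) (p : Sigma Q k) : oc_proj (chart i) x = set_val p ->
  exists W s, isotropy_nbhd x W /\ stratum_lift S (isotropy x) W s.
Proof.
move=> xp; apply: (natS.2 (chart i) x); first exact: @orbifold_chart_orb.
by rewrite xp; exact: set_valP.
Qed.

(** A change of charts from [x] to [y] intertwines the differentials of the two lifts and is an
    isometry. *)
Lemma lift_form_unique i j (x : oc_space (chart i)) (y : oc_space (chart j)) (p : Sigma Q k)
    W s W' s' : oc_proj (chart i) x = set_val p -> oc_proj (chart j) y = set_val p ->
  W x -> stratum_lift S (isotropy x) W s -> W' y -> stratum_lift S (isotropy y) W' s' ->
  forall u v, mdiff S (M i) s p u *m form i x *m (mdiff S (M i) s p v)^T =
    mdiff S (M j) s' p u *m form j y *m (mdiff S (M j) s' p v)^T.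
Proof.
move=> xp yp Wx ls W'y ls' u v.
have [Wh [h [ch Whx hx]]] : germ_change x y.
  by apply: orbifold_chart_germ; [exact: @orbifold_chart_orb|exact: @orbifold_chart_orb|rewrite xp yp].
subst y.
have e w := mdiff_lift_change w xp Wx ls ch Whx W'y ls'.
have pf := isometric_preserves_form (ro_change g ch) Whx.
apply: etrans (esym (pf _ _)) _.
exact: (congr2 (fun a b => a *m _ *m b^T) (e u) (e v)).
Qed.

Definition lift_form (G : Sigma Q k -> 'M[R]_k) := forall i (x : oc_space (chart i)) p W s,
  oc_proj (chart i) x = set_val p -> W x -> stratum_lift S (isotropy x) W s ->
  forall u v, mdiff S (M i) s p u *m form i x *m (mdiff S (M i) s p v)^T = u *m G p *m v^T.

Lemma lift_form_exists : exists G, lift_form G.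
Proof.
have /choice[G GP] : forall p : Sigma Q k, exists A : 'M[R]_k, forall i (x : oc_space (chart i)) W s,
    oc_proj (chart i) x = set_val p -> W x -> stratum_lift S (isotropy x) W s ->
    forall u v, mdiff S (M i) s p u *m form i x *m (mdiff S (M i) s p v)^T = u *m A *m v^T.
  move=> p; have [i [x xp]] := @orb_coverP _ _ Q (set_val p).
  have [W [s [[_ Wx _ _] ls]]] := lift_exists xp.
  pose F := lin1_mx (mdiff S (M i) s p).
  have Fe u : u *m F = mdiff S (M i) s p u by exact: mul_rV_lin1.
  exists (F *m form i x *m F^T) => j y W' s' yp W'y ls' u v.
  apply: etrans (lift_form_unique yp xp W'y ls' Wx ls u v) _.
  apply: esym; apply: etrans (pullback_form _ _ _ _) _.
  exact: (congr2 (fun a b => a *m _ *m b^T) (Fe u) (Fe v)).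
by exists G => i x p; exact: GP.
Qed.

Variable G : Sigma Q k -> 'M[R]_k.
Hypothesis GP : lift_form G.

Lemma lift_at_all (p : Sigma Q k) : exists i (x : oc_space (chart i)) W s,
  [/\ oc_proj (chart i) x = set_val p, isotropy_nbhd x W & stratum_lift S (isotropy x) W s].
Proof.
have [i [x xp]] := @orb_coverP _ _ Q (set_val p).
by have [W [s [iW ls]]] := lift_exists xp; exists i, x, W, s.
Qed.

(** Isotropy is constant along a lift: values of [s] are fixed by the isotropy of [x], and all other
    elements move [W] off itself. A lift based at [x] is therefore also a lift based at each of its
    values, so pointwise facts spread to a neighbourhood. *)
Lemma lift_isotropy i (x : oc_space (chart i)) W s (q : Sigma Q k) :
  isotropy_nbhd x W -> stratum_lift S (isotropy x) W s -> stratum_in W q ->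
  isotropy (s q) = isotropy x /\ W (s q).
Proof.
move=> [_ Wx _ Wdisj] ls qW; have [_ ps sE _] := ls.
have [Wsq fsq] : (W `&` fixed_points (isotropy x)) (s q) by rewrite -sE; exists q.
split=> //; apply/seteqP; split=> a ia; last by split; [exact: isotropy_group ia|exact: fsq].
split; first exact: isotropy_group ia.
apply: contrapT => nax; have := Wdisj a ia.1 nax; rewrite -subset0 => /(_ (s q))[].
by split=> //; exists (s q) => //; case: ia.
Qed.

Lemma lift_preserves_form i (x : oc_space (chart i)) W s (q : Sigma Q k) :
  isotropy_nbhd x W -> stratum_lift S (isotropy x) W s -> stratum_in W q ->
  preserves_form S (M i) G (form i) s q.
Proof.
move=> iW ls qW u v; have [_ ps _ _] := ls; have [iE Wsq] := lift_isotropy iW ls qW.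
have ls' : stratum_lift S (isotropy (s q)) W s by rewrite iE.
exact: (GP (ps q qW) Wsq ls').
Qed.

Lemma lift_form_sym p : (G p)^T = G p.
Proof.
have [i [x [W [s [xp [_ Wx _ _] ls]]]]] := lift_at_all p.
have e u v := GP xp Wx ls u v.
apply: form_ext => u v; apply: etrans (e u v).
have t1 (A : 'M[R]_1) : A^T = A by apply/matrixP => a b; rewrite mxE !ord1.
rewrite -(mx11_sym _ _ (rm_sym _ _)) (_ : u *m (G p)^T *m v^T = (v *m G p *m u^T)^T).
  by rewrite t1; exact: esym (e v u).
by rewrite !trmx_mul trmxK mulmxA.
Qed.

(** Positivity is inherited from the chart because the differential of a lift is injective. *)
Lemma lift_form_pos p (u : 'rV[R]_k) : u != 0 -> 0 < (u *m G p *m u^T) 0 0.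
Proof.
move=> u0; have [i [x [W [s [xp [_ Wx _ _] ls]]]]] := lift_at_all p.
have [pW _] := stratum_lift_at ls Wx xp.
have e := GP xp Wx ls u u.
have nz : mdiff S (M i) s p u != 0.
  apply: contra u0 => /eqP e0; apply/eqP.
  exact: (mdiff_stratum_lift_inj ls pW (etrans e0 (esym (linear0 _)))).
rewrite -e; exact: rm_pos nz.
Qed.

(** [G] was chosen point by point; smoothness holds because near each point its Gram matrix is the
    pullback of a smooth one by a single smooth lift. *)
Lemma lift_form_smooth c : mf_atlas S c -> smooth_on (mc_img c) (gram_of S G c).
Proof.
move=> Sc; apply: smooth_at_on => _ [p cp <-].
have [i [x [W [s [xp iW ls]]]]] := lift_at_all p.
have [_ Wx _ _] := iW; have [pW sp] := stratum_lift_at ls Wx xp.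
set d := chart_at (M i) (s p).
have Md : mf_atlas (M i) d by exact: mf_atlas_chart_at.
have dp : mc_dom d (s p) by exact: mc_dom_chart_at.
have near : \forall q \near p, msmooth S (M i) s q /\ preserves_form S (M i) G (form i) s q.
  apply: filterS (stratum_lift_nbhs ls pW) => q qW; split; first exact: stratum_lift_smooth ls qW.
  exact: lift_preserves_form iW ls qW.
have nG := near_gram_pullback Sc Md cp dp near.
have [ss _] := nbhs_singleton near.
have sf := msmooth_in_charts ss Sc Md cp dp.
have fx : in_charts c d s (mc_fwd c p) = mc_fwd d (s p) by rewrite /in_charts /= mc_fwdK.
have sG : smooth_at (gram_of (M i) (form i) d) (in_charts c d s (mc_fwd c p)).
  by rewrite fx; exact: gram_smooth.
have sJ := smooth_at_jacobian sf.
have sGf := smooth_at_comp sf sG.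
have sP := smooth_at_mulmx (smooth_at_mulmx sJ sGf) (smooth_at_trmx sJ).
by apply: near_eq_smooth_at sP; apply: filterS nG => y ->.
Qed.

End induced_metric.

(** Applying an element of the group only permutes the summands, by left translation. *)
Lemma isotropy_average (R : realType) (n : nat) (Q : topologicalType) (c : orbichart R n Q)
    (x : oc_space c) (s : seq (oc_space c -> oc_space c)) v : uniq s ->
  isotropy x = [set` s] -> fixed_tangent x (\sum_(a <- s) v *m @isotropy_mx R n Q c x a).
Proof.
move=> us sE b ib; apply: etrans (esym (mul_isotropy_mx _ _ _)) _.
have memE a : a \in s <-> isotropy x a by rewrite sE.
rewrite mulmx_suml -[RHS](perm_big _ (isotropy_perm us sE ib).2) big_map.
apply: eq_big_seq => a /memE ia.
by rewrite (isotropy_mx_comp ib ia) mulmxA.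
Qed.

(** * Total geodesy of the strata *)

Section totally_geodesic.
Variables (R : realType) (n : nat) (Q : orbifold R n) (k : nat).
Variables (S : smooth_manifold R k (Sigma Q k)) (g : riemannian_orbifold Q).
Hypothesis natS : natural_structure S.
Local Notation chart i := (orb_chart Q i).
Local Notation M i := (oc_mfd (orb_chart Q i)).
Local Notation form i := (rm_form (ro_metric g i)).

Lemma lift_metric_exists : exists gS : riemannian_metric S, @lift_form R n Q k S g (rm_form gS).
Proof.
have [G GP] := lift_form_exists g natS.
by exists (RiemannianMetric (lift_form_sym natS GP) (lift_form_pos natS GP)
  (lift_form_smooth natS GP)).
Qed.

Variable gS : riemannian_metric S.
Hypothesis gSP : @lift_form R n Q k S g (rm_form gS).

Lemma lift_form_induced : induced_metric g gS.
Proof. by move=> i x p W s xp Wx ls u v; rewrite /inner (gSP xp Wx ls). Qed.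

(* The covariant acceleration of the lifted curve is orthogonal to the fixed
   directions because the lift is isometric, and to its own average over the
   isotropy group because that group acts by isometries fixing the curve. *)
Lemma lift_energy_eq0 i (x : oc_space (chart i)) W s (gamma : R -> Sigma Q k) (J : set R) t d v :
  isotropy_nbhd x W -> stratum_lift S (isotropy x) W s -> open J -> geodesic gS J gamma ->
  J t -> stratum_in W (gamma t) -> mf_atlas (M i) d -> mc_dom d (s (gamma t)) ->
  smooth_at (mc_fwd d \o (s \o gamma)) t /\
  energy_covector (ro_metric g i) d (s \o gamma) t v = 0.
Proof.
move=> iW ls oJ geo Jt tW Md dt.
have cg : {for t, continuous gamma} by exact: geo.1.
set m := chart_at S (gamma t).
have Sm : mf_atlas S m by exact: mf_atlas_chart_at.
have mt : mc_dom m (gamma t) by exact: mc_dom_chart_at.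
have [sg eg] := geodesic_energy oJ geo Jt Sm mt.
have nW := stratum_lift_nbhs ls tW.
have ss := stratum_lift_smooth ls tW.
have near : \forall q \near gamma t,
    msmooth S (M i) s q /\ preserves_form S (M i) (rm_form gS) (form i) s q.
  apply: filterS nW => q qW; split; first exact: stratum_lift_smooth ls qW.
  exact: (lift_preserves_form gSP iW ls qW).
have [sd _] := smooth_curve_comp Sm Md mt dt cg ss sg.
split=> //.
have tangential u : energy_covector (ro_metric g i) d (s \o gamma) t
    (mdiff S (M i) s (gamma t) u) = 0.
  by rewrite -(energy_covector_natural u Sm Md mt dt cg sg near).
have csg : {for t, continuous (s \o gamma)}.
  by apply: continuous_comp; [exact: cg|exact: msmooth_continuous ss].
set x' := s (gamma t).
have x'p : oc_proj (chart i) x' = set_val (gamma t) by have [_ ps _ _] := ls; exact: ps.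
have [iE Wx'] := lift_isotropy iW ls tW.
have ls' : stratum_lift S (isotropy x') W s by rewrite iE.
have invariant a w : isotropy x' a -> energy_covector (ro_metric g i) d (s \o gamma) t
    (mdiff (M i) (M i) a x' w) = energy_covector (ro_metric g i) d (s \o gamma) t w.
  move=> ia; have Ga := isotropy_group ia.
  have na : \forall z \near (s \o gamma) t,
      msmooth (M i) (M i) a z /\ preserves_form (M i) (M i) (form i) (form i) a z.
    apply: filterE => z; split; first exact: group_msmooth.
    by apply: isometric_preserves_form; [exact: ro_group Ga|].
  have dat : mc_dom d (a ((s \o gamma) t)) by rewrite [a _]ia.2.
  have e := energy_covector_natural w Md Md dt dat csg sd na.
  apply: etrans (esym e).
  have nt : \forall r \near t, stratum_in W (gamma r) by exact: cg nW.
  have na' : \forall r \near t, (s \o gamma) r = (a \o (s \o gamma)) r.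
    by apply: filterS nt => r rW; apply: esym; exact: (stratum_lift_fixed ls' rW ia).
  exact: (near_eq_energy_covector _ _ dt csg na').
have [r ur rE] := isotropy_enum x'.
(* The sum of the translates of [v] is fixed by the isotropy group at [x'], hence tangent to the
   stratum; the tangent identification applies at [x'] because [s] is also a lift based there. *)
have [u _ uE] : exists2 u, setT u & mdiff S (M i) s (gamma t) u
    = \sum_(a <- r) v *m @isotropy_mx R n Q (chart i) x' a.
  have [_ _ surj] := (stratum_tangent_identification S).1 (chart i) x' (gamma t) W s
    (@orbifold_chart_orb _ _ Q i) x'p Wx' ls'.
  exact: surj (isotropy_average v ur rE).
have := tangential u; rewrite uE.
set L := energy_covector _ _ _ _.
have LE w : L w = acceleration (gram (ro_metric g i) d) (mc_fwd d \o (s \o gamma)) t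
    *m gram (ro_metric g i) d (mc_fwd d x')
    *m (mdiff (M i) (rV_mfd R n) (mc_fwd d) x' w)^T.
  exact: energy_covectorE.
have -> : L (\sum_(a <- r) v *m @isotropy_mx R n Q (chart i) x' a) = \sum_(a <- r) L v.
  apply: etrans (LE _) _; rewrite linear_sum linear_sum /= mulmx_sumr.
  apply: eq_big_seq => a ra.
  apply: etrans (esym (LE _)) _; rewrite mul_isotropy_mx.
  by apply: invariant; rewrite rE.
(* By invariance the vanishing sum is the order of the group times [L v], and the order is nonzero
   since the identity belongs to the group. *)
rewrite big_const_seq count_predT iter_addr_0 => /eqP.
rewrite -scaler_nat scaler_eq0 pnatr_eq0 => /orP[|/eqP//].
have : id \in r by have := isotropy_id x'; rewrite rE.
by move: r {ur rE uE} => [].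
Qed.

(** The required lift is the composite of [gamma] with a stratum lift based at [x], on an interval
    short enough for [gamma] to stay in its domain. *)
Lemma stratum_totally_geodesic C : totally_geodesic g gS C.
Proof.
move=> J gamma oJ _ _ geo t0 i x Jt0 xp.
have [W [s [iW ls]]] := lift_exists natS xp; have [_ Wx _ _] := iW.
have [tW st] := stratum_lift_at ls Wx xp.
have cg : {for t0, continuous gamma} by exact: geo.1.
have nW : \forall t \near t0, stratum_in W (gamma t) by exact: cg (stratum_lift_nbhs ls tW).
have /nbhs_ballP[e /= e0 eB] : nbhs t0 (J `&` [set t | stratum_in W (gamma t)]).
  by apply: filterI => //; exact: open_nbhs_nbhs.
exists e, (s \o gamma); split=> //.
- by split=> // t /eB[].
- by move=> t /eB[_ Wt]; have [_ ps _ _] := ls; exact: ps.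
apply: energy_geodesic => [t /eB[Jt Wt]|t d /eB[Jt Wt] Md dt].
  apply: continuous_comp; first exact: geo.1.
  exact: msmooth_continuous (stratum_lift_smooth ls Wt).
(* Only the smoothness half is taken here, so the vector 0 is a placeholder. *)
split; first exact: (lift_energy_eq0 0 iW ls oJ geo Jt Wt Md dt).1.
by move=> v; exact: (lift_energy_eq0 v iW ls oJ geo Jt Wt Md dt).2.
Qed.

End totally_geodesic.

Theorem proposition2p4 (R : realType) (n : nat) (Q : orbifold R n) :
  [/\ \bigcup_(k in [set k : nat | (k <= n)%N]) Sigma Q k = setT,
      trivIset setT (Sigma Q) &
      forall k : nat, (k <= n)%N ->
      exists S : smooth_manifold R k (Sigma Q k),
        [/\ natural_structure S,
            tangent_identification S &
            forall g : riemannian_orbifold Q, (1 <= k)%N ->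
            exists gS : riemannian_metric S,
              induced_metric g gS /\
              forall p : Sigma Q k,
                totally_geodesic g gS (connected_component setT p)]].
Proof.
split; [exact: bigcup_Sigma|exact: trivIset_Sigma|move=> k _].
have natS := @stratum_natural_structure R n Q k.
exists (stratum_mfd Q k); split; [exact: natS|exact: stratum_tangent_identification|].
move=> g _; have [gS gSP] := lift_metric_exists g natS.
exists gS; split; first exact: lift_form_induced.
by move=> p; exact: stratum_totally_geodesic.
Qed.
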